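(* Let $\alpha>0$ and let $\mu$ be a positive Borel measure on $(0,\infty)$ with $\int_0^\infty\frac{d\mu(t)}{t}=1$. The following are equivalent: (i) There exist $0<p,q\le\infty$ such that $\mathcal{H}_\mu: F^p_\alpha\to F^q_\alpha$ is compact. (ii) $\mu((0,1])=0$. (iii) $\mathcal{H}_\mu: F^p_\alpha\to F^p_\alpha$ is compact for all $0<p\le\infty$.
   Context: For $\alpha>0$, $F^p_\alpha$ is the space of entire functions $f$ with $\|f\|_{p,\alpha}<\infty$, where $\|f\|_{p,\alpha}=\left(\frac{\alpha p}{2\pi}\int_{\mathbb C}|f(z)e^{-\frac{\alpha}{2}|z|^2}|^p\,dA(z)\right)^{1/p}$ for $0<p<\infty$ ($dA$ is area measure) and $\|f\|_{\infty,\alpha}=\sup_{z\in\mathbb C}|f(z)|e^{-\frac{\alpha}{2}|z|^2}$. It is a Banach space for $p\ge1$; for $0<p<1$ it is a complete metric space (quasi-Banach) with $d(f,g)=\|f-g\|_{p,\alpha}^p$. The Hausdorff operator is $\mathcal{H}_\mu(f)(z)=\int_0^\infty f\left(\frac{z}{t}\right)\frac{d\mu(t)}{t}$ for entire $f$. ''$\mathcal{H}_\mu:X\to Y$ is compact'' means it is well defined on $X$ with values in $Y$ and maps the unit ball of $X$ to a relatively compact subset of $Y$. *)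

(* Defs.v *)
From HB Require Import structures.
From mathcomp Require Import all_boot all_order all_algebra.
From mathcomp Require Import complex.
From mathcomp Require Import all_classical all_reals all_analysis.

Set Implicit Arguments.
Unset Strict Implicit.
Unset Printing Implicit Defensive.

Import Order.TTheory GRing.Theory Num.Theory.
Import numFieldNormedType.Exports.
Import Normc.

Local Open Scope classical_set_scope.
Local Open Scope complex_scope.
Local Open Scope ring_scope.

(* The topology (and normed module structure over itself) of the complex field
   R[i] lives on its regular module R[i]^o, so [derivable _ z 1] is complex
   differentiability at z. *)
Definition entire (R : realType) (f : R[i] -> R[i]) : Prop :=
  forall z : R[i], derivable (f : R[i]^o -> R[i]^o) z 1.

Definition fock_weighted (R : realType) (alpha : R) (f : R[i] -> R[i])
    (z : R[i]) : R :=
  normc (f z) * expR (- (alpha / 2) * normc z ^+ 2).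

(* The exponent ranges over ]0, +oo]; the value at p = -oo is junk. Area measure
   is the product Lebesgue measure on R * R, with z = x +i* y. *)
Definition fock_norm (R : realType) (alpha : R) (p : \bar R)
    (f : R[i] -> R[i]) : \bar R :=
  match p with
  | r%:E => (((alpha * r / (2 * pi))%:E *
      \int[(@lebesgue_measure R) \x (@lebesgue_measure R)]_w
        ((fock_weighted alpha f (w.1 +i* w.2)) `^ r)%:E) `^ (r^-1))%E
  | +oo%E => ereal_sup (range (fun z => (fock_weighted alpha f z)%:E))
  | -oo%E => 0%E
  end.

Definition fock_space (R : realType) (alpha : R) (p : \bar R) :
    set (R[i] -> R[i]) :=
  [set f | entire f /\ (fock_norm alpha p f < +oo)%E].

Definition fock (R : realType) (alpha : R) (p : \bar R) : Type :=
  set_type (fock_space alpha p).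

HB.instance Definition _ (R : realType) (alpha : R) (p : \bar R) :=
  Choice.on (fock alpha p).

Definition fock_dist (R : realType) (alpha : R) (p : \bar R)
    (f g : fock alpha p) : \bar R :=
  let d := fock_norm alpha p (fun z => val f z - val g z) in
  if (p < 1)%E then (d `^ fine p)%E else d.

Definition fock_open (R : realType) (alpha : R) (p : \bar R) :
    set (set (fock alpha p)) :=
  [set U | forall f, U f -> exists2 e : R, 0 < e &
     forall g, (fock_dist f g < e%:E)%E -> U g].

Lemma fock_openT (R : realType) (alpha : R) (p : \bar R) :
  fock_open [set: fock alpha p].
Proof. by move=> f _; exists 1. Qed.

Lemma fock_openI (R : realType) (alpha : R) (p : \bar R) :
  setI_closed (@fock_open R alpha p).
Proof.
move=> U V oU oV f [/oU[e e0 eU] /oV[d d0 dV]].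
exists (Num.min e d); first by rewrite lt_min e0.
by move=> g; rewrite EFin_min lt_min => /andP[/eU ? /dV].
Qed.

Lemma fock_open_bigU (R : realType) (alpha : R) (p : \bar R) (I : Type)
    (U : I -> set (fock alpha p)) :
  (forall i, fock_open (U i)) -> fock_open (\bigcup_i U i).
Proof.
move=> oU f [i _ /oU[e e0 eU]]; exists e => // g /eU Ug.
by exists i.
Qed.

(* The metric topology of F^p_alpha. *)
HB.instance Definition _ (R : realType) (alpha : R) (p : \bar R) :=
  isOpenTopological.Build (fock alpha p) (@fock_openT R alpha p)
    (@fock_openI R alpha p) (@fock_open_bigU R alpha p).

Definition cintegrable (d : measure_display) (T : measurableType d)
    (R : realType) (mu : {measure set T -> \bar R}) (D : set T) (g : T -> R[i]) : Prop :=
  mu.-integrable D (fun t => (complex.Re (g t))%:E) /\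
  mu.-integrable D (fun t => (complex.Im (g t))%:E).

Definition cintegral (d : measure_display) (T : measurableType d)
    (R : realType) (mu : {measure set T -> \bar R}) (D : set T) (g : T -> R[i]) : R[i] :=
  (\int[mu]_(t in D) complex.Re (g t)) +i* (\int[mu]_(t in D) complex.Im (g t)).

Definition hausdorff_integrand (R : realType) (f : R[i] -> R[i]) (z : R[i])
    (t : R) : R[i] :=
  f (z / t%:C) / t%:C.

(* A Borel measure on ]0, +oo[ is represented by a Borel measure on R, of which
   only the restriction to ]0, +oo[ is ever used. *)
Definition hausdorff_op (R : realType)
    (mu : {measure set (measurableTypeR R) -> \bar R})
    (f : R[i] -> R[i]) : R[i] -> R[i] :=
  fun z => cintegral mu `]0, +oo[ (hausdorff_integrand f z).

Definition hausdorff_well_defined (R : realType)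
    (mu : {measure set (measurableTypeR R) -> \bar R}) (alpha : R)
    (p q : \bar R) : Prop :=
  forall f, fock_space alpha p f ->
    (forall z, cintegrable mu `]0, +oo[ (hausdorff_integrand f z)) /\
    fock_space alpha q (hausdorff_op mu f).

Definition hausdorff_compact (R : realType)
    (mu : {measure set (measurableTypeR R) -> \bar R}) (alpha : R)
    (p q : \bar R) : Prop :=
  hausdorff_well_defined mu alpha p q /\
  precompact [set g : fock alpha q | exists f : fock alpha p,
    (fock_norm alpha p (val f) <= 1)%E /\ val g = hausdorff_op mu (val f)].

(* Main.v *)
(** Suppose first that [mu] is carried by ]1, +oo[. With [s = 1/t], [H f z] is an
    average of [f (s z)] over [0 < s < 1], and
      |f (s z)| e^(-alpha |z|^2 / 2) =
        |f (s z)| e^(-alpha |s z|^2 / 2) * e^(-alpha (1 - s^2) |z|^2 / 2).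
    A bound of [|f|^p] by its mean over unit discs, valid for every [p > 0], shows
    that the first factor times the square root of the second one, to the power
    [p], is at most a Gaussian average of [(|f| e^(-alpha |.|^2 / 2))^p] centered at
    [z], up to a constant. The average over [s] of the other square root tends to
    [0] as [|z|] grows. Hence [H u] has small norm as soon as [u] is bounded in norm and
    small on a large disc, and Montel's theorem turns this into compactness.

    Conversely, let [k_n] be the normalized coherent state centered at the real
    point [n], and let [g] be a cluster point of [H k_n]. At [n], the weighted modulus
    of [H k_n] is at least
      c e^(alpha n^2 (1/t0 - 1)) * \int_(]0, t0]) dmu(t) / t.
    It stays bounded along a subsequence, so [t0 = 1/2] gives [mu ]0, 1/2] = 0]. Then
    [H k_n] tends to [0] pointwise, so [g = 0]; and [t0 = 1] bounds the integral
    of [1/t] over ]0, 1] by the distance from [H k_n] to [g], up to a constant. *)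

From HB Require Import structures.
From mathcomp Require Import all_boot all_order all_algebra.
From mathcomp Require Import complex.
From mathcomp Require Import all_classical all_reals all_analysis.
From mathcomp Require Import measurable_realfun.
From mathcomp Require Import ring lra.
Require Import Defs.

Set Implicit Arguments.
Unset Strict Implicit.
Unset Printing Implicit Defensive.

Import Order.TTheory GRing.Theory Num.Theory.
Import numFieldNormedType.Exports.
Import Normc.

Local Open Scope classical_set_scope.
Local Open Scope complex_scope.
Local Open Scope ring_scope.

(** * Complex derivatives *)

(** The obstacle is that [p] may be less than 1, where Minkowski's inequality fails: the norm of an
    average over [s] cannot be bounded by the average of the norms. So the average over [s] is taken
    pointwise, before any power. The Gaussian bound has one and the same majorant for all [s], and
    Tonelli's theorem integrates the [p]-th power of this majorant. Splitting the decay into two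
    square roots serves both ends: one pays for moving the Gaussian from [s z] to [z], the other
    gives smallness at infinity. Holomorphy means only that a derivative exists at every point, so
    Cauchy's estimates start from Goursat's theorem; their constants are far from sharp. They lead
    to a second-order Taylor inequality whose constant depends only on a bound of |f| on a disc.
    Such an inequality survives pointwise limits and integration in a parameter: this is why the
    limits in Montel's theorem, and [H f], are entire. In the converse, the two values of [t0] come
    in this order because [z / t] is unbounded as [t] tends to 0: pointwise convergence of [H k_n]
    requires a margin at 0. *)

Section normc_facts.
Context {R : realType}.
Implicit Types z w : R[i].

Lemma normc_ge0 z : 0 <= normc z.
Proof. by case: z => a b; exact: sqrtr_ge0. Qed.

Lemma normc_real (x : R) : normc x%:C = `|x|.
Proof. by rewrite /= expr0n addr0 sqrtr_sqr. Qed.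

Lemma normc0E : normc (0 : R[i]) = 0.
Proof. by rewrite normc_real normr0. Qed.

Lemma normcBC z w : normc (z - w) = normc (w - z).
Proof. by rewrite -normcN opprB. Qed.

Lemma normc_gt0 z : (0 < normc z) = (z != 0).
Proof.
rewrite lt_neqAle normc_ge0 andbT eq_sym; apply/idP/idP => [|z0].
  by apply: contra => /eqP->; rewrite normc0E.
by apply: contra z0 => /eqP/eq0_normc->.
Qed.

Lemma normc_Re z : `|complex.Re z| <= normc z.
Proof.
case: z => a b /=; rewrite -sqrtr_sqr ler_wsqrtr//.
by rewrite lerDl sqr_ge0.
Qed.

Lemma normc_Im z : `|complex.Im z| <= normc z.
Proof.
case: z => a b /=; rewrite -sqrtr_sqr ler_wsqrtr//.
by rewrite lerDr sqr_ge0.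
Qed.

Lemma normc_sqr z : normc z ^+ 2 = complex.Re z ^+ 2 + complex.Im z ^+ 2.
Proof. by case: z => a b /=; rewrite sqr_sqrtr// addr_ge0// sqr_ge0. Qed.

Lemma normc_le_ReIm z : normc z <= `|complex.Re z| + `|complex.Im z|.
Proof.
rewrite -(@ler_pXn2r _ 2)// ?nnegrE ?normc_ge0 ?addr_ge0//.
by rewrite normc_sqr sqrrD !real_normK ?num_real// [leRHS]addrAC lerDl.
Qed.

Lemma norm_normc z : `|z| = (normc z)%:C.
Proof. by []. Qed.

Lemma le_normcB z w : normc z - normc w <= normc (z - w).
Proof. by rewrite lerBlDr -{1}(subrK w z) le_normcD. Qed.

Lemma le_normcB2 z w : normc (z - w) <= normc z + normc w.
Proof. by rewrite -(normcN w) le_normcD. Qed.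

End normc_facts.

Section derivatives.
Context {R : realType}.

(** Written without a quotient, so that [h = 0] is allowed and bounds on increments can be
    substituted directly. *)
Definition has_cderiv (f : R[i] -> R[i]) (z d : R[i]) : Prop :=
  forall e : R, 0 < e -> exists2 r : R, 0 < r &
    forall h, normc h < r -> normc (f (z + h) - f z - d * h) <= e * normc h.

Lemma derivable_has_cderiv (f : R[i] -> R[i]) z :
  derivable (f : R[i]^o -> R[i]^o) z 1 <-> exists d, has_cderiv f z d.
Proof.
split.
- move=> /cvg_ex[/= d fd]; exists d => e e0.
  move/cvgrPdist_le : fd => /(_ e%:C).
  have eC : (0 : R[i]) < e%:C by rewrite ltcR.
  move=> /(_ eC) /nbhs_ballP[/= r r0 rP].
  have rE : r = (complex.Re r)%:C by rewrite RRe_real// ger0_real// ltW.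
  move: r0; rewrite rE ltcR => r0.
  exists (complex.Re r) => // h hr.
  have [->|h0] := eqVneq h 0.
    by rewrite addr0 subrr mulr0 subr0 normc0E mulr0.
  have := rP h; rewrite /ball /= sub0r normrN norm_normc rE ltcR => /(_ hr h0).
  rewrite norm_normc lecR => hle.
  rewrite -(ler_pM2r (x := (normc h)^-1)) ?invr_gt0 ?normc_gt0//.
  rewrite mulfK; last by rewrite gt_eqF// normc_gt0.
  rewrite -normcV -normcM; apply: le_trans hle.
  rewrite -[in leRHS]normcN opprB /= /GRing.scale /= mulr1 [h + z]addrC.
  by rewrite mulrBl mulfK// [(_ - _) * _]mulrC.
- move=> [d fd]; apply/cvg_ex; exists d => /=.
  apply/cvgrPdist_le => e e0.
  have eE : e = (complex.Re e)%:C by rewrite RRe_real// ger0_real// ltW.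
  move: e0; rewrite eE ltcR => e0.
  have [r r0 rP] := fd _ e0.
  apply/nbhs_ballP; exists r%:C => /=; first by rewrite ltcR.
  move=> h; rewrite /ball /= sub0r normrN !norm_normc ltcR => hr h0.
  rewrite lecR /GRing.scale /= mulr1 -normcN opprB.
  rewrite -(ler_pM2r (x := normc h)) ?normc_gt0// -normcM.
  by rewrite mulrBl [_^-1 * _]mulrC divfK// [h + z]addrC rP.
Qed.

Lemma entireP (f : R[i] -> R[i]) :
  entire f <-> forall z, exists d, has_cderiv f z d.
Proof. by split=> fe z; apply/derivable_has_cderiv/fe. Qed.

End derivatives.

(** * Integrals along segments *)

Section primitives.
Context {R : realType}.
Notation mu := (@lebesgue_measure R).

(** Integration from the base point [a] yields a derivative only to the right of [a], hence the
    ray. *)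
Lemma ray_primitive (phi : R -> R) (a : R) : continuous phi ->
  exists Phi : R -> R, forall x : R, a < x -> is_derive x 1 Phi (phi x).
Proof.
move=> cphi.
exists (fun x => \int[mu]_(t in [set` Interval (BLeft a) (BRight x)]) phi t) => x ax.
have [dF <-] : derivable (fun x => \int[mu]_(t in [set` Interval (BLeft a) (BRight x)]) phi t) x 1 /\
  derive1 (fun x => \int[mu]_(t in [set` Interval (BLeft a) (BRight x)]) phi t) x = phi x.
  apply: (@continuous_FTC1_closed _ _ _ _ (x + 1)) => //; first by rewrite ltrDl.
  apply: continuous_compact_integrable; first exact: segment_compact.
  exact: continuous_subspaceT.
  exact: cphi.
by rewrite derive1E; exact: DeriveDef.
Qed.

Lemma derive0_ray_cst (F : R -> R) (a x y : R) :
  (forall x, a < x -> is_derive x 1 F 0) -> a < x -> a < y -> F x = F y.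
Proof.
move=> dF; wlog xy : x y / x <= y => [H ax ay|ax ay].
  by case: (leP x y) => [/H|/ltW /H h]; [exact|rewrite h].
have [||c _] := @MVT_segment _ F (cst 0) _ _ xy.
- by move=> z /itvP zxy; apply: dF; rewrite (lt_le_trans ax)// zxy.
- apply: continuous_in_subspaceT => z; rewrite inE/= => /itvP zxy.
  apply: differentiable_continuous; apply/derivable1_diffP.
  have : is_derive z 1 F 0 by apply: dF; rewrite (lt_le_trans ax)// zxy.
  by case.
- by rewrite mul0r => /eqP; rewrite subr_eq0 => /eqP.
Qed.

(** On a common ray two of the primitives based at [- n] differ by a constant, so they agree once
    normalized to vanish at 0, and they glue. The base point [- n] with [n > |x|] lies to the left
    of both [x] and 0. *)
Lemma primitive_exists (phi : R -> R) : continuous phi ->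
  exists Phi : R -> R, forall x : R, is_derive x 1 Phi (phi x).
Proof.
move=> cphi.
have /(_ _)/cid-/all_sig[P PP] := fun n : nat => @ray_primitive phi (- n%:R) cphi.
pose Phi x := let n := (Num.truncn `|x|).+1 in P n x - P n 0.
have trE (x : R) : - (Num.truncn `|x|).+1%:R < x.
  rewrite ltrNl (le_lt_trans (ler_norm _))// normrN.
  by have := truncnS_gt `|x|.
have PhiE n (x : R) : (0 < n)%N -> - n%:R < x -> Phi x = P n x - P n 0.
  move=> n0 nx; rewrite /Phi; set m := (_).+1.
  pose N := minn m n.
  have N0 : - N%:R < 0 :> R by rewrite oppr_lt0 ltr0n leq_min n0.
  have Nx : - N%:R < x by rewrite /N; case: (leqP m n) => _ //; exact: trE.
  have dG (y : R) : - N%:R < y -> is_derive y 1 (P m \- P n) 0.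
    move=> Ny; rewrite -(subrr (phi y)); apply: is_deriveB; apply: PP.
    - by apply: le_lt_trans Ny; rewrite lerN2 ler_nat geq_minl.
    - by apply: le_lt_trans Ny; rewrite lerN2 ler_nat geq_minr.
  by have /= := derive0_ray_cst dG N0 Nx; lra.
exists Phi => x; pose n := (Num.truncn `|x|).+1.
apply: (@near_eq_is_derive _ _ _ (fun x => P n x - P n 0)).
- have : \forall y \near x, - n%:R < y by apply: lt_nbhsr; exact: trE.
  by apply: filterS => y ny; rewrite (PhiE n).
- rewrite -[phi x]subr0; apply: is_deriveB.
  exact: PP (trE x).
Qed.

Definition ravg (phi : R -> R) : R := \int[mu]_(t in `[0, 1]) phi t.

Lemma ravgE (phi Phi : R -> R) : continuous phi -> (forall x : R, is_derive x 1 Phi (phi x)) ->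
  ravg phi = Phi 1 - Phi 0.
Proof.
move=> cphi dPhi; rewrite /ravg /Rintegral.
have cPhi x : {for x, continuous Phi}.
  apply: differentiable_continuous; apply/derivable1_diffP.
  by case: (dPhi x).
rewrite (@continuous_FTC2 _ phi Phi)//.
- exact: continuous_subspaceT.
- split.
  + by move=> x _; case: (dPhi x).
  + by apply: cvg_at_right_filter; exact: cPhi.
  + by apply: cvg_at_left_filter; exact: cPhi.
- by move=> x _; rewrite derive1E; case: (dPhi x).
Qed.

End primitives.

Section avg.
Context {R : realType}.
Implicit Types g P : R -> R[i].

Definition avg g : R[i] :=
  ravg (fun t => complex.Re (g t)) +i* ravg (fun t => complex.Im (g t)).

Definition pcont g : Prop := continuous (fun t => complex.Re (g t)) /\
  continuous (fun t => complex.Im (g t)).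

Definition primitive g P : Prop := forall t : R,
  is_derive t 1 (fun t => complex.Re (P t)) (complex.Re (g t)) /\
  is_derive t 1 (fun t => complex.Im (P t)) (complex.Im (g t)).

Lemma pcont_primitive g : pcont g -> exists P, primitive g P.
Proof.
move=> [/primitive_exists[P1 dP1] /primitive_exists[P2 dP2]].
by exists (fun t => P1 t +i* P2 t) => t; split; [exact: dP1|exact: dP2].
Qed.

Lemma avgE g P : pcont g -> primitive g P -> avg g = P 1 - P 0.
Proof.
move=> [cr ci] gP; rewrite /avg.
have -> : ravg (fun t => complex.Re (g t)) = complex.Re (P 1) - complex.Re (P 0).
  by apply: (ravgE (Phi := fun t => complex.Re (P t))) => // t; case: (gP t).
have -> : ravg (fun t => complex.Im (g t)) = complex.Im (P 1) - complex.Im (P 0).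
  by apply: (ravgE (Phi := fun t => complex.Im (P t))) => // t; case: (gP t).
by case: (P 1) => a b; case: (P 0).
Qed.

Lemma pcontZ c g : pcont g -> pcont (fun t => c * g t).
Proof.
move=> [cr ci]; split.
- rewrite (_ : (fun _ => _) = (fun t => complex.Re c * complex.Re (g t) - complex.Im c * complex.Im (g t))).
    move=> t; apply: cvgB; apply: cvgM; try exact: cvg_cst; [exact: cr|exact: ci].
  by apply/funext => t; case: c (g t) => [? ?] [? ?].
- rewrite (_ : (fun _ => _) = (fun t => complex.Re c * complex.Im (g t) + complex.Im c * complex.Re (g t))).
    move=> t; apply: cvgD; apply: cvgM; try exact: cvg_cst; [exact: ci|exact: cr].
  by apply/funext => t; case: c (g t) => [? ?] [? ?].
Qed.

Lemma pcontD g1 g2 : pcont g1 -> pcont g2 -> pcont (fun t => g1 t + g2 t).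
Proof.
move=> [cr ci] [cr' ci']; split.
- rewrite (_ : (fun _ => _) = (fun t => complex.Re (g1 t) + complex.Re (g2 t))).
    move=> t; apply: cvgD; [exact: cr|exact: cr'].
  by apply/funext => t; case: (g1 t) (g2 t) => [? ?] [? ?].
- rewrite (_ : (fun _ => _) = (fun t => complex.Im (g1 t) + complex.Im (g2 t))).
    move=> t; apply: cvgD; [exact: ci|exact: ci'].
  by apply/funext => t; case: (g1 t) (g2 t) => [? ?] [? ?].
Qed.

Lemma primitiveZ c g P : primitive g P -> primitive (fun t => c * g t) (fun t => c * P t).
Proof.
move=> gP t; have [dr di] := gP t; split.
- rewrite (_ : (fun _ => _) = (fun t => complex.Re c * complex.Re (P t) - complex.Im c * complex.Im (P t))).
    rewrite (_ : complex.Re (c * g t) = complex.Re c * complex.Re (g t) - complex.Im c * complex.Im (g t)).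
      apply: is_deriveB; exact: is_deriveZ.
    by case: c (g t) => [? ?] [? ?].
  by apply/funext => s; case: c (P s) => [? ?] [? ?].
- rewrite (_ : (fun _ => _) = (fun t => complex.Re c * complex.Im (P t) + complex.Im c * complex.Re (P t))).
    rewrite (_ : complex.Im (c * g t) = complex.Re c * complex.Im (g t) + complex.Im c * complex.Re (g t)).
      apply: is_deriveD; exact: is_deriveZ.
    by case: c (g t) => [? ?] [? ?].
  by apply/funext => s; case: c (P s) => [? ?] [? ?].
Qed.

Lemma primitiveD g1 g2 P1 P2 : primitive g1 P1 -> primitive g2 P2 ->
  primitive (fun t => g1 t + g2 t) (fun t => P1 t + P2 t).
Proof.
move=> gP1 gP2 t; have [dr di] := gP1 t; have [dr' di'] := gP2 t; split.
- rewrite (_ : (fun _ => _) = (fun t => complex.Re (P1 t) + complex.Re (P2 t))).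
    rewrite (_ : complex.Re (g1 t + g2 t) = complex.Re (g1 t) + complex.Re (g2 t)).
      exact: is_deriveD.
    by case: (g1 t) (g2 t) => [? ?] [? ?].
  by apply/funext => s; case: (P1 s) (P2 s) => [? ?] [? ?].
- rewrite (_ : (fun _ => _) = (fun t => complex.Im (P1 t) + complex.Im (P2 t))).
    rewrite (_ : complex.Im (g1 t + g2 t) = complex.Im (g1 t) + complex.Im (g2 t)).
      exact: is_deriveD.
    by case: (g1 t) (g2 t) => [? ?] [? ?].
  by apply/funext => s; case: (P1 s) (P2 s) => [? ?] [? ?].
Qed.

Lemma is_derive_affine (F : R -> R) (s k t d : R) :
  is_derive (s + t * k) 1 F d -> is_derive t 1 (fun t => F (s + t * k)) (k * d).
Proof.
move=> dF; rewrite -[k * d]/(k *: d).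
rewrite /GRing.scale /= mulrC; apply: (@is_derive1_comp _ F (fun t => s + t * k) t) => //.
have : is_derive t 1 (cst s + k *: (@id R)) (0 + k *: 1).
  by apply: is_deriveD; apply: is_deriveZ.
rewrite add0r /GRing.scale /= mulr1 => h.
rewrite (_ : (fun t => s + t * k) = cst s + k *: (@id R))//.
by apply/funext => u; rewrite /GRing.scale /= mulrC.
Qed.

Lemma primitive_affine g P (s k : R) : primitive g P ->
  primitive (fun t => k%:C * g (s + t * k)) (fun t => P (s + t * k)).
Proof.
move=> gP t; have [dr di] := gP (s + t * k).
have -> : complex.Re (k%:C * g (s + t * k)) = k * complex.Re (g (s + t * k)).
  by case: (g _) => a b /=; rewrite mul0r subr0.
have -> : complex.Im (k%:C * g (s + t * k)) = k * complex.Im (g (s + t * k)).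
  by case: (g _) => a b /=; rewrite mul0r addr0.
by split; [exact: (@is_derive_affine (fun t => complex.Re (P t)))|
  exact: (@is_derive_affine (fun t => complex.Im (P t)))].
Qed.

Lemma pcont_affine g (s k : R) : pcont g -> pcont (fun t => g (s + t * k)).
Proof.
have ca : continuous (fun t : R => s + t * k).
  by move=> t; apply: cvgD; [exact: cvg_cst|apply: cvgM; [exact: cvg_id|exact: cvg_cst]].
move=> [cr ci]; split => t.
- exact: (continuous_comp (ca t) (cr _)).
- exact: (continuous_comp (ca t) (ci _)).
Qed.

Lemma avgD g1 g2 : pcont g1 -> pcont g2 ->
  avg (fun t => g1 t + g2 t) = avg g1 + avg g2.
Proof.
move=> c1 c2; have [P1 p1] := pcont_primitive c1; have [P2 p2] := pcont_primitive c2.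
rewrite (avgE (pcontD c1 c2) (primitiveD p1 p2)) (avgE c1 p1) (avgE c2 p2).
by rewrite opprD addrACA.
Qed.

Lemma avgZ c g : pcont g -> avg (fun t => c * g t) = c * avg g.
Proof.
move=> c1; have [P1 p1] := pcont_primitive c1.
by rewrite (avgE (pcontZ c c1) (primitiveZ c p1)) (avgE c1 p1) mulrBr.
Qed.

Lemma is_derive_segment_bound (F dF : R -> R) (M : R) :
  (forall t : R, is_derive t 1 F (dF t)) ->
  (forall t, 0 <= t <= 1 -> `|dF t| <= M) -> `|F 1 - F 0| <= M.
Proof.
move=> dFF dFM; have [|c] := @MVT_segment _ F dF 0 1 ler01.
- apply: continuous_subspaceT => z.
  by apply: differentiable_continuous; apply/derivable1_diffP; case: (dFF z).
- by move=> /itvP c01 ->; rewrite subr0 mulr1 dFM// !c01.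
Qed.

(** The mean value theorem holds for each component but not for a complex-valued path: hence the
    factor 2, inherited by later estimates. *)
Lemma primitive_bound g P M : primitive g P ->
  (forall t, 0 <= t <= 1 -> normc (g t) <= M) -> normc (P 1 - P 0) <= 2 * M.
Proof.
move=> gP gM; apply: (le_trans (normc_le_ReIm _)).
rewrite [leRHS]mulr_natl mulr2n; apply: lerD.
- have := @is_derive_segment_bound (fun t => complex.Re (P t)) (fun t => complex.Re (g t)) M.
  case: (P 1) (P 0) => [a b] [c d] /=; apply.
  + by move=> t; case: (gP t).
  + by move=> t t01; rewrite (le_trans (normc_Re _))// gM.
- have := @is_derive_segment_bound (fun t => complex.Im (P t)) (fun t => complex.Im (g t)) M.
  case: (P 1) (P 0) => [a b] [c d] /=; apply.
  + by move=> t; case: (gP t).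
  + by move=> t t01; rewrite (le_trans (normc_Im _))// gM.
Qed.

Lemma avg_bound g M : pcont g ->
  (forall t, 0 <= t <= 1 -> normc (g t) <= M) -> normc (avg g) <= 2 * M.
Proof.
move=> cg gM; have [P gP] := pcont_primitive cg.
by rewrite (avgE cg gP); exact: primitive_bound gP gM.
Qed.

End avg.

Section complex_continuity.
Context {R : realType}.
Implicit Types f g : R[i] -> R[i].

Definition ccont_at g z := forall e : R, 0 < e -> exists2 r : R, 0 < r &
  forall h, normc h < r -> normc (g (z + h) - g z) <= e.

Definition hol_at g z := exists d, has_cderiv g z d.

Lemma hol_at_ccont g z : hol_at g z -> ccont_at g z.
Proof.
move=> [d gd] e e0; have [r r0 rP] := gd _ ltr01.
have d1 : 0 < normc d + 1 by rewrite ltr_wpDl ?normc_ge0.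
exists (Num.min r (e / (normc d + 1))); first by rewrite lt_min r0 divr_gt0.
move=> h; rewrite lt_min => /andP[/rP hr he].
rewrite -(subrK (d * h) (g (z + h) - g z)) (le_trans (le_normcD _ _))//.
rewrite normcM; move: hr; rewrite -(lerD2r (normc d * normc h)) => hr.
rewrite (le_trans hr)// -mulrDl addrC -ler_pdivlMl// mulrC ltW//.
Qed.

Lemma ccont_at_cst c z : ccont_at (cst c) z.
Proof. by move=> e e0; exists 1 => // h _; rewrite subrr normc0E ltW. Qed.

Lemma ccont_at_id z : ccont_at id z.
Proof. by move=> e e0; exists e => // h; rewrite addrAC subrr add0r => /ltW. Qed.

Lemma ccont_atD f g z : ccont_at f z -> ccont_at g z -> ccont_at (fun z => f z + g z) z.
Proof.
move=> cf cg e e0.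
have e20 : 0 < e / 2 by rewrite divr_gt0.
have [r r0 rP] := cf _ e20; have [s s0 sP] := cg _ e20.
exists (Num.min r s); first by rewrite lt_min r0.
move=> h; rewrite lt_min => /andP[/rP hr /sP hs].
by rewrite opprD addrACA (le_trans (le_normcD _ _))// [leRHS]splitr lerD.
Qed.

Lemma ccont_atM f g z : ccont_at f z -> ccont_at g z -> ccont_at (fun z => f z * g z) z.
Proof.
move=> cf cg e e0.
pose A := normc (f z) + 1; pose B := normc (g z).
have A0 : 0 < A by rewrite ltr_wpDl ?normc_ge0.
have B0 : 0 < B + 1 by rewrite ltr_wpDl ?normc_ge0.
have [r r0 rP] := cf (Num.min 1 (e / 2 / (B + 1))) ltac:(by rewrite lt_min ltr01 !divr_gt0).
have [s s0 sP] := cg (e / 2 / A) ltac:(by rewrite !divr_gt0).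
exists (Num.min r s); first by rewrite lt_min r0.
move=> h; rewrite lt_min => /andP[/rP + /sP hs]; rewrite le_min => /andP[hr1 hr2].
have -> : f (z + h) * g (z + h) - f z * g z =
  f (z + h) * (g (z + h) - g z) + (f (z + h) - f z) * g z by ring.
rewrite (le_trans (le_normcD _ _))// [leRHS]splitr !normcM lerD//.
- rewrite (@le_trans _ _ (A * (e / 2 / A)))//.
    rewrite ler_pM ?normc_ge0// -(subrK (f z) (f (z + h))) (le_trans (le_normcD _ _))//.
    by rewrite addrC lerD.
  by rewrite mulrC divfK// gt_eqF.
- rewrite (@le_trans _ _ (e / 2 / (B + 1) * (B + 1)))//.
    by rewrite ler_pM ?normc_ge0// lerDl.
  by rewrite divfK// gt_eqF.
Qed.

Lemma ccont_at_near f g z (r : R) : 0 < r -> (forall h, normc h < r -> f (z + h) = g (z + h)) ->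
  ccont_at f z -> ccont_at g z.
Proof.
move=> r0 fg cf e e0; have [s s0 sP] := cf _ e0.
exists (Num.min r s); first by rewrite lt_min r0.
move=> h; rewrite lt_min => /andP[/fg fgh /sP].
by have := fg 0; rewrite normc0E addr0 => /(_ r0) <-; rewrite fgh.
Qed.

Lemma hol_at_near f g z (r : R) : 0 < r -> (forall h, normc h < r -> f (z + h) = g (z + h)) ->
  hol_at f z -> hol_at g z.
Proof.
move=> r0 fg [d cf]; exists d => e e0; have [s s0 sP] := cf _ e0.
exists (Num.min r s); first by rewrite lt_min r0.
move=> h; rewrite lt_min => /andP[/fg fgh /sP].
by have := fg 0; rewrite normc0E addr0 => /(_ r0) <-; rewrite fgh.
Qed.

Lemma ccont_line g (a d : R[i]) : (forall t : R, ccont_at g (a + t%:C * d)) ->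
  pcont (fun t => g (a + t%:C * d)).
Proof.
move=> cg.
suff H (t e : R) : 0 < e -> \forall s \near t, normc (g (a + t%:C * d) - g (a + s%:C * d)) <= e.
  split=> t; apply/cvgrPdist_le => e e0; apply: filterS (H t e e0) => s; apply: le_trans.
  - by rewrite -(raddfB (@complex.Re R)) normc_Re.
  - by rewrite -(raddfB (@complex.Im R)) normc_Im.
move=> e0; have [r r0 rP] := cg t _ e0.
have d1 : 0 < normc d + 1 by rewrite ltr_wpDl ?normc_ge0.
apply/nbhs_ballP; exists (r / (normc d + 1)); first by rewrite /= divr_gt0.
move=> s; rewrite /ball /= ltr_pdivlMr// => ts.
rewrite normcBC (_ : a + s%:C * d = a + t%:C * d + (s - t)%:C * d).
  apply: rP; rewrite normcM normc_real distrC (le_lt_trans _ ts)//.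
  by rewrite ler_wpM2l// lerDl.
by rewrite rmorphB/=; ring.
Qed.

End complex_continuity.

Section segment_integral.
Context {R : realType}.
Implicit Types f g : R[i] -> R[i].

(** The integral of [g z dz] along the segment from [a] to [b]. *)
Definition Seg g (a b : R[i]) : R[i] :=
  (b - a) * avg (fun t : R => g (a + t%:C * (b - a))).

(** A single primitive along the whole line computes the integral over each of its segments;
    additivity and change of orientation then become algebra. *)
Lemma SegE g (a d : R[i]) (P : R -> R[i]) (s t : R) :
  pcont (fun t => g (a + t%:C * d)) ->
  primitive (fun t => g (a + t%:C * d)) P ->
  Seg g (a + s%:C * d) (a + t%:C * d) = d * (P t - P s).
Proof.
move=> cg gP; rewrite /Seg.
have -> : a + t%:C * d - (a + s%:C * d) = d * (t - s)%:C by rewrite rmorphB/=; ring.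
rewrite -mulrA; congr (_ * _).
have -> : (fun t0 : R => g (a + s%:C * d + t0%:C * (d * (t - s)%:C))) =
   (fun t0 : R => (fun t => g (a + t%:C * d)) (s + t0 * (t - s))).
  apply/funext => x; congr g.
  by rewrite (rmorphD _ s) (rmorphM _ x)/=; ring.
rewrite -avgZ; last exact: (pcont_affine s (t - s) cg).
rewrite (avgE _ (primitive_affine s (t - s) gP)); last exact: (pcontZ _ (pcont_affine s (t - s) cg)).
by rewrite mul0r mul1r addr0 subrKC.
Qed.

Lemma Seg_collinear g (a d : R[i]) (s t u : R) :
  (forall t : R, ccont_at g (a + t%:C * d)) ->
  Seg g (a + s%:C * d) (a + t%:C * d) + Seg g (a + t%:C * d) (a + u%:C * d) =
  Seg g (a + s%:C * d) (a + u%:C * d).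
Proof.
move=> /ccont_line cg; have [P gP] := pcont_primitive cg.
by rewrite !(SegE _ _ cg gP) -mulrDr; congr (_ * _); ring.
Qed.

Lemma Segxx g a : Seg g a a = 0.
Proof. by rewrite /Seg subrr mul0r. Qed.

Lemma Seg_opp g a b : (forall t : R, ccont_at g (a + t%:C * (b - a))) ->
  Seg g b a = - Seg g a b.
Proof.
move=> cg; apply/eqP; rewrite -addr_eq0 addrC; apply/eqP.
have := Seg_collinear 0 1 0 cg.
by rewrite mul0r addr0 mul1r subrKC Segxx.
Qed.

Lemma Seg_mid g a b m : (forall t : R, ccont_at g (a + t%:C * (b - a))) ->
  m = (a + b) / 2 -> Seg g a m + Seg g m b = Seg g a b.
Proof.
move=> cg ->; have := Seg_collinear 0 (2^-1) 1 cg.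
rewrite mul0r addr0 mul1r subrKC.
have -> // : a + (2^-1)%:C * (b - a) = (a + b) / 2.
have -> : (2^-1)%:C = 2^-1 :> R[i] by rewrite fmorphV rmorph_nat.
by field.
Qed.

Lemma Seg_bound g a b (M : R) : (forall t : R, ccont_at g (a + t%:C * (b - a))) ->
  (forall t : R, 0 <= t <= 1 -> normc (g (a + t%:C * (b - a))) <= M) ->
  normc (Seg g a b) <= 2 * M * normc (b - a).
Proof.
move=> /ccont_line cg gM; rewrite normcM mulrC ler_wpM2r ?normc_ge0//.
exact: avg_bound.
Qed.

Lemma SegD f g a b : (forall t : R, ccont_at f (a + t%:C * (b - a))) ->
  (forall t : R, ccont_at g (a + t%:C * (b - a))) ->
  Seg (fun z => f z + g z) a b = Seg f a b + Seg g a b.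
Proof.
by move=> /ccont_line cf /ccont_line cg; rewrite /Seg avgD// mulrDr.
Qed.

Lemma SegZ c g a b : (forall t : R, ccont_at g (a + t%:C * (b - a))) ->
  Seg (fun z => c * g z) a b = c * Seg g a b.
Proof. by move=> /ccont_line cg; rewrite /Seg avgZ// mulrCA. Qed.

Lemma primitive_id : primitive (fun t : R => t%:C) (fun t : R => (t ^+ 2 / 2)%:C).
Proof.
move=> t; split => /=; last exact: is_derive_cst.
rewrite (_ : (fun t => _) = (2^-1 : R) *: (fun t : R => t ^+ 2)); last first.
  by apply/funext => x; rewrite /GRing.scale /= mulrC.
by apply: is_derive_eq; rewrite /GRing.scale /=; field.
Qed.

Lemma primitive_cst : primitive (fun _ : R => 1) (fun t : R => t%:C).
Proof. by move=> t; split => /=; [exact: is_derive_id|exact: is_derive_cst]. Qed.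

(** The value is a difference of values of a primitive, so it cancels around a triangle: this is why
    Goursat's argument may subtract the tangent map. *)
Lemma Seg_affine (k0 k1 a b : R[i]) :
  Seg (fun z => k0 + k1 * z) a b = k0 * (b - a) + k1 * (b ^+ 2 - a ^+ 2) / 2.
Proof.
have c z : ccont_at (fun z => k0 + k1 * z) z.
  by apply: ccont_atD; [exact: ccont_at_cst|apply: ccont_atM; [exact: ccont_at_cst|exact: ccont_at_id]].
rewrite /Seg.
rewrite (@avgE _ _ (fun t => (k0 + k1 * a) * t%:C + (k1 * (b - a)) * (t ^+ 2 / 2)%:C)).
- rewrite expr1n expr0n mul0r mul1r rmorph0 rmorph1.
  have -> : (2^-1)%:C = 2^-1 :> R[i] by rewrite fmorphV rmorph_nat.
  by field.
- by apply: (@ccont_line _ (fun z => k0 + k1 * z) a (b - a)) => t.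
- rewrite (_ : (fun _ => _) = (fun t => (k0 + k1 * a) * 1 + (k1 * (b - a)) * t%:C)); last first.
    by apply/funext => t; ring.
  apply: primitiveD; apply: primitiveZ; [exact: primitive_cst|exact: primitive_id].
Qed.

End segment_integral.

(** * The Cauchy-Goursat theorem on triangles *)

Section goursat.
Context {R : realType}.
Implicit Types g : R[i] -> R[i].

Definition Tri g (a b c : R[i]) := Seg g a b + Seg g b c + Seg g c a.

(** Each inner side is run twice, in opposite directions. The vertices are ordered so that each
    piece is homothetic to the whole triangle, the last one with ratio -1/2. *)
Lemma Tri_mid g a b c p q r : (forall z, ccont_at g z) ->
  p = (a + b) / 2 -> q = (b + c) / 2 -> r = (a + c) / 2 ->
  Tri g a b c = Tri g a p r + Tri g p b q + Tri g r q c + Tri g q r p.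
Proof.
move=> cg pE qE rE; rewrite /Tri.
rewrite -(Seg_mid _ pE)// -(Seg_mid _ qE)//.
have -> : Seg g c a = Seg g c r + Seg g r a by rewrite (Seg_mid _ _)// addrC.
rewrite (Seg_opp (a := p) (b := r))// (Seg_opp (a := p) (b := q))//.
rewrite (Seg_opp (a := r) (b := q))//.
move: (Seg g a p) (Seg g p b) (Seg g b q) (Seg g q c) (Seg g c r) (Seg g r a).
move: (Seg g p r) (Seg g p q) (Seg g r q) => x1 x2 x3 x4 x5 x6 x7 x8 x9.
by ring.
Qed.

(** The limit is the supremum of the lower ends of the nested intervals
    [[x n - 2^-n, x n + 2^-n]]. *)
Lemma nested_dyadic (x : nat -> R) :
  (forall n, `|x n.+1 - x n| <= 2^-1 ^+ n.+1) ->
  exists l, forall n, `|x n - l| <= 2^-1 ^+ n.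
Proof.
move=> dx; pose lo n := x n - 2^-1 ^+ n; pose hi n := x n + 2^-1 ^+ n.
have stepE n : (2^-1 : R) ^+ n = 2^-1 ^+ n.+1 + 2^-1 ^+ n.+1.
  by rewrite exprS; field.
have ndlo n m : (n <= m)%N -> lo n <= lo m.
  elim: m => [|m ih]; first by rewrite leqn0 => /eqP->.
  rewrite leq_eqVlt => /predU1P[->//|/ih/le_trans]; apply.
  by have := dx m; rewrite /lo (stepE m) ler_norml => /andP[]; lra.
have nihi n m : (n <= m)%N -> hi m <= hi n.
  elim: m => [|m ih]; first by rewrite leqn0 => /eqP->.
  rewrite leq_eqVlt => /predU1P[->//|/ih]; apply: le_trans.
  by have := dx m; rewrite /hi (stepE m) ler_norml => /andP[]; lra.
have lohi n m : lo n <= hi m.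
  have e0 k : 0 <= (2^-1 : R) ^+ k by rewrite exprn_ge0.
  have [nm|/ltnW mn] := leqP n m.
    by apply: (le_trans (ndlo _ _ nm)); rewrite /lo /hi; have := e0 m; lra.
  by apply: (le_trans _ (nihi _ _ mn)); rewrite /lo /hi; have := e0 n; lra.
have hs : has_sup (range lo).
  by split; [exists (lo 0%N), 0%N|exists (hi 0%N) => _ [n _ <-]].
exists (sup (range lo)) => n; rewrite ler_norml; apply/andP; split.
- have : sup (range lo) <= hi n 
    by apply: ge_sup; [exists (lo 0%N), 0%N|move=> _ [k _ <-]].
  by rewrite /hi; lra.
- have : lo n <= sup (range lo) 
    by apply: ub_le_sup; [case: hs|exists n].
  by rewrite /lo; lra.
Qed.

Lemma half_exp_small (e : R) : 0 < e -> exists n : nat, 2^-1 ^+ n < e.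
Proof.
move=> e0; have : (fun n => 2^-1 ^+ n : R) @ \oo --> 0.
  by apply: cvg_expr; rewrite ger0_norm ?invf_lt1 ?ltr1n.
move=> /cvgrPdist_lt/(_ _ e0)[n _ /(_ n (leqnn n))] /=.
by rewrite sub0r normrN ger0_norm ?exprn_ge0// => ?; exists n.
Qed.

Lemma le_half_exp (x y : R) : (forall n : nat, x - 2^-1 ^+ n <= y) -> x <= y.
Proof.
move=> h; apply/ler_addgt0Pr => e /half_exp_small[n ne].
by have := h n; lra.
Qed.

Lemma le_four_max (s a b c d : R) : s <= a + b + c + d ->
  s <= 4 * a \/ s <= 4 * b \/ s <= 4 * c \/ s <= 4 * d.
Proof.
move=> h; have [|h1] := leP s (4 * a); first by left.
have [|h2] := leP s (4 * b); first by right; left.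
have [|h3] := leP s (4 * c); first by right; right; left.
by right; right; right; lra.
Qed.

Lemma eq_le_normc (a b : R[i]) : a = b -> normc a <= normc b.
Proof. by move=> ->. Qed.

Lemma normcD4 (a b c d : R[i]) :
  normc (a + b + c + d) <= normc a + normc b + normc c + normc d.
Proof.
apply: (le_trans (le_normcD _ _)); rewrite lerD2r.
by apply: (le_trans (le_normcD _ _)); rewrite lerD2r le_normcD.
Qed.

(* In the frame [(a, u, v)], a triangle homothetic to [a, a + u, a + v] is given by
   a corner [(x, y)] and a signed ratio [k]: bisection stays within these. *)
Definition in_frame (x y k : R) := [/\ 0 <= x, 0 <= y, x + y <= 1,
  (0 <= x + k /\ 0 <= y + k) & x + k + y <= 1].

Lemma in_frame_sub1 x y k : in_frame x y k -> in_frame x y (k / 2).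
Proof. by case=> ? ? ? [? ?] ?; do ?split; lra. Qed.

Lemma in_frame_sub2 x y k : in_frame x y k -> in_frame (x + k / 2) y (k / 2).
Proof. by case=> ? ? ? [? ?] ?; do ?split; lra. Qed.

Lemma in_frame_sub3 x y k : in_frame x y k -> in_frame x (y + k / 2) (k / 2).
Proof. by case=> ? ? ? [? ?] ?; do ?split; lra. Qed.

Lemma in_frame_sub4 x y k : in_frame x y k -> in_frame (x + k / 2) (y + k / 2) (- (k / 2)).
Proof. by case=> ? ? ? [? ?] ?; do ?split; lra. Qed.

Section bisection.
Variables (g : R[i] -> R[i]) (a u v : R[i]).
Hypothesis cg : forall z, ccont_at g z.

Definition frame_pt (x y : R) : R[i] := a + x%:C * u + y%:C * v.
Definition frame_tri (x y k : R) :=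
  Tri g (frame_pt x y) (frame_pt (x + k) y) (frame_pt x (y + k)).
Notation pt := frame_pt.
Notation F := frame_tri.
Notation inD := in_frame.

Lemma frame_tri_bisect x y k : F x y k = F x y (k / 2) + F (x + k / 2) y (k / 2) +
  F x (y + k / 2) (k / 2) + F (x + k / 2) (y + k / 2) (- (k / 2)).
Proof.
rewrite /frame_tri !addrK -!(addrA _ (k / 2)) -splitr.
have hC : (k / 2)%:C = k%:C / 2 by rewrite rmorphM fmorphV rmorph_nat.
by apply: Tri_mid => //; rewrite /frame_pt ?(rmorphD _ x) ?(rmorphD _ y) /= ?hC; field.
Qed.

Notation L := (normc u + normc v).

Lemma frame_pt_diff x y x' y' (r : R) : `|x - x'| <= r -> `|y - y'| <= r ->
  normc (pt x y - pt x' y') <= r * L.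
Proof.
move=> hx hy.
have -> : pt x y - pt x' y' = (x - x')%:C * u + (y - y')%:C * v.
  by rewrite /frame_pt !rmorphB/=; ring.
rewrite (le_trans (le_normcD _ _))// !normcM !normc_real mulrDr.
by rewrite lerD// ler_wpM2r ?normc_ge0.
Qed.

(** Subtracting the tangent map leaves the triangle integral unchanged and makes the integrand at
    most [e * (2 * s * L)]. Each side has length at most [s * L], so it contributes at most
    [4 * e * s^2 * L^2]. *)
Lemma frame_tri_small x y k xs ys (s e : R) d : 0 <= e -> `|k| <= s -> `|x - xs| <= s -> `|y - ys| <= s ->
  (forall h, normc h <= 2 * s * L ->
    normc (g (pt xs ys + h) - g (pt xs ys) - d * h) <= e * normc h) ->
  normc (F x y k) <= 12 * e * s ^+ 2 * L ^+ 2.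
Proof.
move=> e0 ks hx hy gd; set p := pt xs ys in gd *.
have L0 : 0 <= L by rewrite addr_ge0// normc_ge0.
have s0 : 0 <= s by rewrite (le_trans _ ks).
(* [A] is minus the tangent map [g p + d * (z - p)]. *)
pose A z := (d * p - g p) + (- d) * z.
pose rem z := g z + A z.
have cA z : ccont_at A z.
  apply: ccont_atD; first exact: ccont_at_cst.
  by apply: ccont_atM; [exact: ccont_at_cst|exact: ccont_at_id].
have crem z : ccont_at rem z by exact: ccont_atD.
have TriE b c f : Tri rem b c f = Tri g b c f.
  have SA b' c' : Seg rem b' c' = Seg g b' c' +
      ((d * p - g p) * (c' - b') + (- d) * (c' ^+ 2 - b' ^+ 2) / 2).
    by rewrite -Seg_affine; apply: SegD.
  by rewrite /Tri !SA; field.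
rewrite /frame_tri -TriE.
have side x1 y1 x2 y2 : `|x1 - x| <= s -> `|y1 - y| <= s -> `|x2 - x| <= s -> `|y2 - y| <= s ->
    `|x1 - x2| <= s -> `|y1 - y2| <= s ->
    normc (Seg rem (pt x1 y1) (pt x2 y2)) <= 2 * (e * (2 * s * L)) * (s * L).
  move=> h1 h2 h3 h4 h5 h6.
  apply: (@le_trans _ _ (2 * (e * (2 * s * L)) * normc (pt x2 y2 - pt x1 y1))).
    apply: Seg_bound => // t /andP[t0 t1].
    have -> : pt x1 y1 + t%:C * (pt x2 y2 - pt x1 y1) = pt (x1 + t * (x2 - x1)) (y1 + t * (y2 - y1)).
      by rewrite /frame_pt !(rmorphD, rmorphM, rmorphN)/=; ring.
    set w := pt _ _.
    have wp : normc (w - p) <= 2 * s * L.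
      have conv (z1 z2 z zs : R) : `|z1 - z| <= s -> `|z2 - z| <= s -> `|z - zs| <= s ->
          `|z1 + t * (z2 - z1) - zs| <= 2 * s.
        rewrite !ler_norml => /andP[? ?] /andP[? ?] /andP[? ?]; apply/andP; split; nra.
      by apply: frame_pt_diff; [exact: conv h1 h3 hx|exact: conv h2 h4 hy].
    have -> : rem w = g (p + (w - p)) - g p - d * (w - p).
      by rewrite subrKC /rem /A; ring.
    by rewrite (le_trans (gd _ wp))// ler_wpM2l.
  rewrite ler_wpM2l// ?mulr_ge0// normcBC.
  exact: frame_pt_diff.
have k1 (z : R) : `|z + k - z| <= s by rewrite addrAC subrr add0r.
have k2 (z : R) : `|z - (z + k)| <= s by rewrite distrC.
have k0 (z : R) : `|z - z| <= s by rewrite subrr normr0.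
rewrite /Tri (le_trans (le_normcD _ _))// (@le_trans _ _ (2 * (e * (2 * s * L)) * (s * L) + 2 * (e * (2 * s * L)) * (s * L) + 2 * (e * (2 * s * L)) * (s * L)))//.
  rewrite lerD//; last exact: side.
  by rewrite (le_trans (le_normcD _ _))// lerD// side.
by rewrite le_eqVlt; apply/orP; left; apply/eqP; ring.
Qed.

Hypothesis hg : forall x y : R, 0 <= x -> 0 <= y -> x + y <= 1 ->
  hol_at g (a + x%:C * u + y%:C * v).

Lemma goursat_frame : Tri g a (a + u) (a + v) = 0.
Proof.
pose sub (st st' : R * R * R) := let: (x, y, k) := st in let: (x', y', k') := st' in
    [/\ `|k'| = `|k| / 2, `|x' - x| <= `|k| / 2, `|y' - y| <= `|k| / 2,
      normc (F x y k) <= 4 * normc (F x' y' k') & inD x y k -> inD x' y' k'].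
have step st : exists st', sub st st'.
  rewrite /sub; case: st => [[x y] k].
  have k2 : `|k / 2| = `|k| / 2 by rewrite normrM (ger0_norm (_ : 0 <= 2^-1)).
  have := le_four_max (le_trans (eq_le_normc (frame_tri_bisect x y k)) (normcD4 _ _ _ _)).
  move=> Hle; case: Hle => [Hle|[Hle|[Hle|Hle]]].
  - exists (x, y, k / 2); split; rewrite ?subrr ?normr0 ?divr_ge0//.
    exact: in_frame_sub1.
  - exists (x + k / 2, y, k / 2); split; rewrite ?subrr ?normr0 ?divr_ge0//.
      by rewrite addrAC subrr add0r k2.
    exact: in_frame_sub2.
  - exists (x, y + k / 2, k / 2); split; rewrite ?subrr ?normr0 ?divr_ge0//.
      by rewrite addrAC subrr add0r k2.
    exact: in_frame_sub3.
  - exists (x + k / 2, y + k / 2, - (k / 2)); split; rewrite ?normrN//.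
    + by rewrite addrAC subrr add0r k2.
    + by rewrite addrAC subrr add0r k2.
    + exact: in_frame_sub4.
have [next nextP] := choice step.
pose st n := iter n next (0, 0, 1).
pose X n := (st n).1.1; pose Y n := (st n).1.2; pose K n := (st n).2.
have stS n : [/\ `|K n.+1| = `|K n| / 2, `|X n.+1 - X n| <= `|K n| / 2,
    `|Y n.+1 - Y n| <= `|K n| / 2,
    normc (F (X n) (Y n) (K n)) <= 4 * normc (F (X n.+1) (Y n.+1) (K n.+1)) &
    inD (X n) (Y n) (K n) -> inD (X n.+1) (Y n.+1) (K n.+1)].
  have := nextP (st n); rewrite /sub /K /X /Y /st iterS.
  case: (iter n next _) => [[x y] k] /=.
  by case: (next _) => [[x' y'] k'].
have KE n : `|K n| = 2^-1 ^+ n.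
  elim: n => [|n ih]; first by rewrite /K /= expr0 normr1.
  by have [-> _ _ _ _] := stS n; rewrite ih exprSr.
have inDn n : inD (X n) (Y n) (K n).
  elim: n => [|n ih]; first by rewrite /in_frame /X /Y /K /=; do ?split; lra.
  by have [_ _ _ _ /(_ ih)] := stS n.
have Fn n : normc (F 0 0 1) <= 4 ^+ n * normc (F (X n) (Y n) (K n)).
  elim: n => [|n ih]; first by rewrite expr0 mul1r.
  have [_ _ _ h _] := stS n.
  by apply: (le_trans ih); rewrite exprSr -mulrA; apply: ler_wpM2l; [exact: exprn_ge0|exact: h].
have dX n : `|X n.+1 - X n| <= 2^-1 ^+ n.+1.
  by have [_ + _ _ _] := stS n; rewrite KE exprSr.
have dY n : `|Y n.+1 - Y n| <= 2^-1 ^+ n.+1.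
  by have [_ _ + _ _] := stS n; rewrite KE exprSr.
have [xs xsP] := nested_dyadic dX; have [ys ysP] := nested_dyadic dY.
have xs0 : 0 <= xs.
  apply: le_half_exp => n; have [? _ _ _ _] := inDn n.
  by have := xsP n; rewrite ler_norml => /andP[]; lra.
have ys0 : 0 <= ys.
  apply: le_half_exp => n; have [_ ? _ _ _] := inDn n.
  by have := ysP n; rewrite ler_norml => /andP[]; lra.
(* The errors on [xs] and [ys] add up; the index [n.+1] makes each of them half of the allowed
   [2^-n]. *)
have xys1 : xs + ys <= 1.
  apply: le_half_exp => n; have [_ _ + _ _] := inDn n.+1.
  have := ysP n.+1; have := xsP n.+1; rewrite !ler_norml exprS.
  by move=> /andP[? ?] /andP[? ?] ?; lra.
have [d dP] := hg xs0 ys0 xys1.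
have F0E : F 0 0 1 = Tri g a (a + u) (a + v).
  by rewrite /frame_tri /frame_pt !add0r rmorph0 rmorph1 !mul0r !mul1r !addr0.
apply: eq0_normc; apply/eqP; rewrite eq_le normc_ge0 andbT -F0E.
have L0 : 0 <= L by rewrite addr_ge0// normc_ge0.
have L1 : 0 < L ^+ 2 * 12 + 1 by rewrite ltr_wpDl// mulr_ge0// sqr_ge0.
apply/ler_addgt0Pr => e e0; rewrite add0r.
(* [12 * L^2] is the constant of [frame_tri_small]: the [n]-th triangle has ratio [2^-n], and the
   factor [4^n] lost by bisection cancels its square. Adding 1 keeps the denominator positive when
   [u = v = 0]. *)
pose e' := e / (L ^+ 2 * 12 + 1).
have e'0 : 0 < e' by rewrite divr_gt0.
have [r r0 rP] := dP _ e'0.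
have [n nr] : exists n : nat, 2^-1 ^+ n < r / (2 * L + 1).
  by apply: half_exp_small; rewrite divr_gt0// ltr_wpDl// mulr_ge0.
rewrite ltr_pdivlMr in nr; last by rewrite ltr_wpDl// mulr_ge0.
apply: (le_trans (Fn n)).
have s0 : 0 < (2^-1 : R) ^+ n by rewrite exprn_gt0.
have hF : normc (F (X n) (Y n) (K n)) <= 12 * e' * (2^-1 ^+ n) ^+ 2 * L ^+ 2.
  apply: (@frame_tri_small _ _ _ xs ys (2^-1 ^+ n) e' d) => //.
  - exact: ltW.
  - by rewrite KE.
  - move=> h hh; apply: rP; apply: (le_lt_trans hh); apply: le_lt_trans nr.
    by nra.
apply: (@le_trans _ _ (4 ^+ n * (12 * e' * (2^-1 ^+ n) ^+ 2 * L ^+ 2))).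
  by rewrite ler_wpM2l ?exprn_ge0.
have -> : 4 ^+ n * (12 * e' * (2^-1 ^+ n) ^+ 2 * L ^+ 2) = e' * (L ^+ 2 * 12) :> R.
  have h4 : 4 ^+ n * (2^-1 ^+ n) ^+ 2 = 1 :> R.
    rewrite -exprM mulnC exprM -exprMn (_ : 4 * 2^-1 ^+ 2 = 1) ?expr1n//.
    by field.
  transitivity ((4 ^+ n * (2^-1 ^+ n) ^+ 2) * (e' * (L ^+ 2 * 12))); first by ring.
  by rewrite h4 mul1r.
rewrite (@le_trans _ _ (e' * (L ^+ 2 * 12 + 1)))//.
  by rewrite ler_wpM2l// ?lerDl// ltW.
by rewrite /e' divfK// gt_eqF.
Qed.

End bisection.
End goursat.

(** * Goursat's theorem with finitely many exceptional points *)

Section exceptional_points.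
Context {R : realType}.
Implicit Types (g : R[i] -> R[i]) (E : seq R[i]).

Lemma Tri_collinear g (a d : R[i]) (s t u : R) : (forall z, ccont_at g z) ->
  Tri g (a + s%:C * d) (a + t%:C * d) (a + u%:C * d) = 0.
Proof.
move=> cg; rewrite /Tri Seg_collinear//.
by rewrite (Seg_collinear s u s (fun t => cg _)) Segxx.
Qed.

Definition hull_hol g E (a u v : R[i]) := forall x y : R,
  0 <= x -> 0 <= y -> x + y <= 1 ->
  hol_at g (a + x%:C * u + y%:C * v) \/ a + x%:C * u + y%:C * v \in E.

Lemma complex_half (k : R) : (k / 2)%:C = k%:C / 2 :> R[i].
Proof. by rewrite rmorphM fmorphV rmorph_nat. Qed.

(* Cut off the exceptional vertex by a triangle of ratio [k] and let [k] tend to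
   [0]: continuity suffices there. *)
Lemma Tri_vertex_exceptional g E w u v : (forall z, ccont_at g z) ->
  (forall a u v, hull_hol g E a u v -> Tri g a (a + u) (a + v) = 0) ->
  hull_hol g (w :: E) w u v -> Tri g w (w + u) (w + v) = 0.
Proof.
move=> cg IH gH.
have [->|u0] := eqVneq u 0.
  have := @Tri_collinear g w v 0 0 1 cg.
  by rewrite rmorph0 rmorph1 mul0r mul1r !addr0.
have [[t ->]|nt] := pselect (exists t : R, v = t%:C * u).
  have := @Tri_collinear g w u 0 1 t cg.
  by rewrite rmorph0 rmorph1 mul0r mul1r !addr0.
have indep x y : x%:C * u + y%:C * v = 0 -> x = 0 /\ y = 0.
  have [->|y0] := eqVneq y 0.
    rewrite rmorph0 mul0r addr0 => /eqP; rewrite mulf_eq0 (negbTE u0) orbF.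
    by move=> /eqP[->].
  move=> xy0; exfalso; apply: nt; exists (- (x / y)).
  have yC : y%:C != 0 :> R[i] by apply: contra y0 => /eqP[->].
  have yv : y%:C * v = - (x%:C * u) by apply/eqP; rewrite -addr_eq0 addrC xy0.
  rewrite rmorphN rmorphM fmorphV/= -[LHS](mulKf yC) yv.
  by rewrite mulrN mulrA [_^-1 * _]mulrC mulNr.
(* Of the four midpoint triangles only the corner one contains [w], since [u] and [v] are
   independent over the reals; the other three fall under the induction hypothesis. *)
have halve (k : R) : 0 < k <= 1 ->
    Tri g w (w + k%:C * u) (w + k%:C * v) =
    Tri g w (w + (k / 2)%:C * u) (w + (k / 2)%:C * v).
  move=> /andP[k0 k1]; set b := w + k%:C * u; set c := w + k%:C * v.
  pose p := w + (k / 2)%:C * u; pose r := w + (k / 2)%:C * v.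
  pose q := w + (k / 2)%:C * u + (k / 2)%:C * v.
  rewrite (@Tri_mid _ g w b c p q r cg); last 3 first.
  - by rewrite /p /b complex_half; field.
  - by rewrite /q /b /c complex_half; field.
  - by rewrite /r /c complex_half; field.
  have sub (A B : R) (z : R[i]) : 0 <= A -> 0 <= B -> A + B <= 1 -> 0 < A + B ->
      z = w + A%:C * u + B%:C * v -> hol_at g z \/ z \in E.
    move=> A0 B0 AB1 AB0 ->; have [|] := gH A B A0 B0 AB1; first by left.
    rewrite inE => /orP[/eqP|]; last by right.
    rewrite -addrA => /eqP; rewrite -subr_eq0 addrAC subrr add0r => /eqP/indep[A00 B00].
    by move: AB0; rewrite A00 B00 addr0 ltxx.
  have T1 : Tri g p b q = 0.
    rewrite (_ : b = p + (k / 2)%:C * u); last by rewrite /b /p complex_half; field.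
    apply: IH => x y x0 y0 xy1.
    apply: (sub (k / 2 * (1 + x)) (k / 2 * y)); [nra|nra|nra|nra|].
    by rewrite /p !rmorphM rmorphD rmorph1/=; ring.
  have T2 : Tri g r q c = 0.
    rewrite (_ : q = r + (k / 2)%:C * u); last by rewrite /q /r; ring.
    rewrite (_ : c = r + (k / 2)%:C * v); last by rewrite /r /c complex_half; field.
    apply: IH => x y x0 y0 xy1.
    apply: (sub (k / 2 * x) (k / 2 * (1 + y))); [nra|nra|nra|nra|].
    by rewrite /r !rmorphM rmorphD rmorph1/=; ring.
  have T3 : Tri g q r p = 0.
    rewrite (_ : r = q + - (k / 2)%:C * u); last by rewrite /q /r; ring.
    rewrite (_ : p = q + - (k / 2)%:C * v); last by rewrite /q /p; ring.
    apply: IH => x y x0 y0 xy1.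
    apply: (sub (k / 2 * (1 - x)) (k / 2 * (1 - y))); [nra|nra|nra|nra|].
    by rewrite /q !rmorphM !rmorphB rmorph1/=; ring.
  by rewrite T1 T2 T3 !addr0.
have halves n : Tri g w (w + u) (w + v) =
    Tri g w (w + (2^-1 ^+ n)%:C * u) (w + (2^-1 ^+ n)%:C * v).
  elim: n => [|n ih]; first by rewrite expr0 rmorph1 !mul1r.
  rewrite ih exprSr; apply: halve; apply/andP; split; first by rewrite exprn_gt0.
  by rewrite exprn_ile1// invf_le1// ler1n.
have [r r0 rP] := cg w 1 ltr01.
pose M := normc (g w) + 1.
pose L := normc u + normc v.
have M0 : 0 <= M by rewrite addr_ge0// normc_ge0.
have L0 : 0 <= L by rewrite addr_ge0// normc_ge0.
apply: eq0_normc; apply/eqP; rewrite eq_le normc_ge0 andbT.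
(* [4 * M * L * k] bounds the three sides together, and the summand [L] keeps the small triangle in
   the disc where |g| is at most [M]. *)
have D1 : 0 < 4 * M * L + L + 1 by rewrite ltr_wpDl// addr_ge0// !mulr_ge0.
apply/ler_addgt0Pr => e e0; rewrite add0r.
have [n] : exists n : nat, 2^-1 ^+ n < Num.min r e / (4 * M * L + L + 1).
  by apply: half_exp_small; rewrite divr_gt0// lt_min r0.
rewrite ltr_pdivlMr// lt_min (halves n); set k := 2^-1 ^+ n => /andP[kr ke].
have k0 : 0 <= k by rewrite exprn_ge0.
have gM (s t : R) : `|s| + `|t| <= k ->
    normc (g (w + (s%:C * u + t%:C * v))) <= M.
  move=> stk; rewrite -[X in normc X](subrK (g w)) (le_trans (le_normcD _ _))// /M addrC lerD2l.
  apply: rP; rewrite (le_lt_trans (le_normcD _ _))// !normcM !normc_real.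
  apply: le_lt_trans kr; have := normc_ge0 u; have := normc_ge0 v; have := normr_ge0 s; have := normr_ge0 t.
  rewrite /L in L0 D1 * => *.
  have : (`|s| + `|t|) * (normc u + normc v) <= k * (normc u + normc v) by rewrite ler_wpM2r.
  have : 0 <= k * (4 * M * (normc u + normc v)) by rewrite !mulr_ge0.
  by nra.
have side (s1 t1 s2 t2 : R) : 0 <= s1 -> 0 <= t1 -> 0 <= s2 -> 0 <= t2 -> s1 + t1 <= k -> s2 + t2 <= k ->
   normc (Seg g (w + (s1%:C * u + t1%:C * v)) (w + (s2%:C * u + t2%:C * v)))
   <= 2 * M * normc ((s2 - s1)%:C * u + (t2 - t1)%:C * v).
  move=> s10 t10 s20 t20 k1 k2.
  have -> : (s2 - s1)%:C * u + (t2 - t1)%:C * v = 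
     (w + (s2%:C * u + t2%:C * v)) - (w + (s1%:C * u + t1%:C * v)).
    by rewrite !rmorphB/=; ring.
  apply: Seg_bound => // t /andP[t0 t1'].
  have -> : w + (s1%:C * u + t1%:C * v) +
   t%:C * (w + (s2%:C * u + t2%:C * v) - (w + (s1%:C * u + t1%:C * v))) =
   w + ((s1 + t * (s2 - s1))%:C * u + (t1 + t * (t2 - t1))%:C * v).
    by rewrite !(rmorphD, rmorphM, rmorphN)/=; ring.
  by apply: gM; rewrite !ger0_norm; nra.
have k00 : 0 + 0 <= k by rewrite addr0.
have kk0 : k + 0 <= k by rewrite addr0.
have k0k : 0 + k <= k by rewrite add0r.
have h1 : normc (Seg g w (w + k%:C * u)) <= 2 * M * (k * normc u).
  have := side 0 0 k 0 (lexx _) (lexx _) k0 (lexx _) k00 kk0.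
  by rewrite !(rmorph0, subr0, mul0r, addr0) (normcM k%:C u) normc_real (ger0_norm k0).
have h2 : normc (Seg g (w + k%:C * u) (w + k%:C * v)) <= 2 * M * (k * normc u + k * normc v).
  have := side k 0 0 k k0 (lexx _) (lexx _) k0 kk0 k0k.
  rewrite !(rmorph0, subr0, mul0r, addr0, add0r, sub0r) => /le_trans; apply.
  rewrite ler_wpM2l ?mulr_ge0// (le_trans (le_normcD _ _))//.
  by rewrite !normcM !normc_real normrN (ger0_norm k0).
have h3 : normc (Seg g (w + k%:C * v) w) <= 2 * M * (k * normc v).
  have := side 0 k 0 0 (lexx _) k0 (lexx _) (lexx _) k0k k00.
  by rewrite !(rmorph0, subr0, mul0r, addr0, add0r, sub0r) (normcM (- k)%:C v) normc_real normrN (ger0_norm k0).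
rewrite /Tri (le_trans (le_normcD _ _))//.
apply: (le_trans (lerD (le_normcD _ _) (lexx _))).
apply: (le_trans (lerD (lerD h1 h2) h3)).
apply: le_trans (ltW ke).
by rewrite -/L -/k; move: k0 L0; rewrite /L; clear; nra.
Qed.

(** Induction on [E]. If its first point [w] lies in the triangle, this is split into three
    triangles with vertex [w], possibly flat, to which [Tri_vertex_exceptional] applies. *)
Lemma goursat g E a u v : (forall z, ccont_at g z) ->
  hull_hol g E a u v -> Tri g a (a + u) (a + v) = 0.
Proof.
move=> cg; elim: E a u v => [|w E IH] a u v gH.
  by apply: goursat_frame => // x y x0 y0 xy1; case: (gH x y x0 y0 xy1).
have [[x0 [y0 [x00 y00 xy01 wE]]]|nw] := pselect (exists x y : R,
    [/\ 0 <= x, 0 <= y, x + y <= 1 & w = a + x%:C * u + y%:C * v]); last first.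
  apply: IH => x y x0 y0 xy1; have [|] := gH x y x0 y0 xy1; first by left.
  rewrite inE => /orP[/eqP wE|]; last by right.
  by exfalso; apply: nw; exists x, y.
have sub (x1 y1 x2 y2 : R) b c : 0 <= x1 -> 0 <= y1 -> x1 + y1 <= 1 ->
    0 <= x2 -> 0 <= y2 -> x2 + y2 <= 1 ->
    b = a + x1%:C * u + y1%:C * v -> c = a + x2%:C * u + y2%:C * v ->
    Tri g w b c = 0.
  move=> x10 y10 xy1 x20 y20 xy2 bE cE.
  have -> : Tri g w b c = Tri g w (w + (b - w)) (w + (c - w)) by rewrite !subrKC.
  apply: (@Tri_vertex_exceptional g E w (b - w) (c - w) cg IH) => s t s0 t0 st1.
  have -> : w + s%:C * (b - w) + t%:C * (c - w) =
    a + (x0 + s * (x1 - x0) + t * (x2 - x0))%:C * u + (y0 + s * (y1 - y0) + t * (y2 - y0))%:C * v.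
    by rewrite bE cE wE !(rmorphD, rmorphM, rmorphN)/=; ring.
  apply: gH.
  - have -> : x0 + s * (x1 - x0) + t * (x2 - x0) = (1 - s - t) * x0 + s * x1 + t * x2 by ring.
    by rewrite !addr_ge0// mulr_ge0//; lra.
  - have -> : y0 + s * (y1 - y0) + t * (y2 - y0) = (1 - s - t) * y0 + s * y1 + t * y2 by ring.
    by rewrite !addr_ge0// mulr_ge0//; lra.
  - rewrite -subr_ge0.
    have -> : 1 - (x0 + s * (x1 - x0) + t * (x2 - x0) + (y0 + s * (y1 - y0) + t * (y2 - y0))) =
      (1 - s - t) * (1 - (x0 + y0)) + s * (1 - (x1 + y1)) + t * (1 - (x2 + y2)) by ring.
    by rewrite !addr_ge0// mulr_ge0//; lra.
have e0 : a = a + 0%:C * u + 0%:C * v by rewrite rmorph0 !mul0r !addr0.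
have e1 : a + u = a + 1%:C * u + 0%:C * v by rewrite rmorph0 rmorph1 mul0r mul1r addr0.
have e2 : a + v = a + 0%:C * u + 1%:C * v by rewrite rmorph0 rmorph1 mul0r mul1r addr0.
have T1 : Tri g w a (a + u) = 0 by apply: (sub 0 0 1 0) => //; lra.
have T2 : Tri g w (a + u) (a + v) = 0 by apply: (sub 1 0 0 1) => //; lra.
have T3 : Tri g w (a + v) a = 0 by apply: (sub 0 1 0 0) => //; lra.
have : Tri g a (a + u) (a + v) = Tri g w a (a + u) + Tri g w (a + u) (a + v) + Tri g w (a + v) a.
  rewrite /Tri (Seg_opp (a := w) (b := a))// (Seg_opp (a := w) (b := a + u))//.
  by rewrite (Seg_opp (a := w) (b := a + v))//; ring.
by rewrite T1 T2 T3 !addr0.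
Qed.

Lemma goursat_off g E a b c : (forall z, ccont_at g z) ->
  (forall z, z \notin E -> hol_at g z) -> Tri g a b c = 0.
Proof.
move=> cg gE; rewrite -(subrKC a b) -(subrKC a c); apply: (@goursat _ E) => // x y _ _ _.
by have [|/gE] := boolP (_ \in E); [right|left].
Qed.

End exceptional_points.

(** * Cauchy's estimates *)

Section holomorphic_algebra.
Context {R : realType}.
Implicit Types f g : R[i] -> R[i].

Lemma hol_at_derivable g z : derivable (g : R[i]^o -> R[i]^o) z 1 <-> hol_at g z.
Proof. rewrite /hol_at; exact (derivable_has_cderiv g z). Qed.

Lemma hol_at_cst c z : hol_at (cst c : R[i] -> R[i]) z.
Proof. by apply/hol_at_derivable; exact: derivable_cst. Qed.

Lemma hol_at_id z : hol_at (id : R[i] -> R[i]) z.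
Proof. by apply/hol_at_derivable; exact: derivable_id. Qed.

Lemma hol_atD f g z : hol_at f z -> hol_at g z -> hol_at (fun z => f z + g z) z.
Proof.
by move=> /hol_at_derivable df /hol_at_derivable dg; apply/hol_at_derivable; exact: derivableD.
Qed.

Lemma hol_atN f z : hol_at f z -> hol_at (fun z => - f z) z.
Proof.
by move=> /hol_at_derivable df; apply/hol_at_derivable; exact: derivableN.
Qed.

Lemma hol_atM f g z : hol_at f z -> hol_at g z -> hol_at (fun z => f z * g z) z.
Proof.
move=> /hol_at_derivable df /hol_at_derivable dg; apply/hol_at_derivable.
exact (@derivableM _ _ (f : R[i]^o -> _) g z 1 df dg).
Qed.

Lemma hol_atV f z : f z != 0 -> hol_at f z -> hol_at (fun z => (f z)^-1) z.
Proof.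
move=> f0 /hol_at_derivable df; apply/hol_at_derivable.
exact (@derivableV _ _ (f : R[i]^o -> _) z 1 f0 df).
Qed.

End holomorphic_algebra.

Section cauchy_estimate.
Context {R : realType}.
Implicit Types g f : R[i] -> R[i].

(** With [d] the derivative of [g] at [w], it is holomorphic wherever [g] is, except perhaps at [w],
    where it is still continuous. The vanishing of its contour integral is Cauchy's formula for
    [g w]. *)
Definition divdiff g (w d z : R[i]) := if z == w then d else (g z - g w) / (z - w).

Lemma divdiff_hol g w d z : z != w -> hol_at g z -> hol_at (divdiff g w d) z.
Proof.
move=> zw gz.
apply: (@hol_at_near _ (fun z => (g z + - g w) * (z + - w)^-1) _ z (normc (z - w))).
- by rewrite normc_gt0 subr_eq0.
- move=> h hz; rewrite /divdiff ifN//; apply: contraTneq hz => zhw.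
  by rewrite -leNgt -zhw opprD addNKr normcN.
- apply: hol_atM; first exact: hol_atD gz (hol_at_cst _ _).
  apply: (@hol_atV _ (fun z => z + - w)); first by rewrite subr_eq0.
  exact: hol_atD (hol_at_id _) (hol_at_cst _ _).
Qed.

Lemma divdiff_ccont g w d : has_cderiv g w d -> ccont_at (divdiff g w d) w.
Proof.
move=> gd e e0; have [r r0 rP] := gd _ e0; exists r => // h hr.
rewrite {2}/divdiff eqxx /divdiff; case: ifPn => [_|]; first by rewrite subrr normc0E ltW.
rewrite addrAC subrr add0r => hw.
have h0 : h != 0 by apply: contra hw => /eqP->; rewrite addr0.
rewrite -(ler_pM2r (x := normc h)) ?normc_gt0// -normcM mulrBl divfK//.
exact: rP.
Qed.

Lemma Seg_eq f g a b : (forall t : R, f (a + t%:C * (b - a)) = g (a + t%:C * (b - a))) ->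
  Seg f a b = Seg g a b.
Proof. by move=> fg; rewrite /Seg; congr (_ * avg _); apply/funext. Qed.

Lemma avg_Re_ge (gam : R -> R[i]) (m : R) : pcont gam ->
  (forall t, 0 <= t <= 1 -> m <= complex.Re (gam t)) -> m <= complex.Re (avg gam).
Proof.
move=> cg gm; have [P gP] := pcont_primitive cg; rewrite (avgE cg gP).
have dP (t : R) : is_derive t 1 (fun t => complex.Re (P t)) (complex.Re (gam t)).
  by case: (gP t).
have [|c /itvP c01] := @MVT_segment _ (fun t => complex.Re (P t)) (fun t => complex.Re (gam t)) 0 1 ler01.
  apply: continuous_subspaceT => z.
  by apply: differentiable_continuous; apply/derivable1_diffP; case: (dP z).
rewrite subr0 mulr1 raddfB/= => ->; apply: gm.
by rewrite !c01.
Qed.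

Lemma iu_sqr : 'i%C * 'i%C = -1 :> R[i].
Proof. by apply/eqP; rewrite eq_complex /= !mulr0 !mul0r mulr1 sub0r addr0 oppr0 !eqxx. Qed.

(* The contour of Cauchy's formula is a square, whose sides are related by
   multiplication by ['i]; this is a quarter of its integral of [1 / z]. Only the
   lower bound [1] of its modulus is needed, not its value. *)
Definition side_integral : R[i] :=
  2 * 'i%C * avg (fun t : R => ((1 - 'i%C) + t%:C * (2 * 'i%C))^-1).

Lemma sideE (t : R) : (1 - 'i%C) + t%:C * (2 * 'i%C) = 1 +i* (2 * t - 1).
Proof.
apply/eqP; rewrite eq_complex; apply/andP; split => /=; apply/eqP; ring.
Qed.

Lemma side_neq0 (t : R) : (1 - 'i%C) + t%:C * (2 * 'i%C) != 0.
Proof. by rewrite sideE; apply/negP => /eqP[] /eqP; rewrite oner_eq0. Qed.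

Lemma hol_at_inv (z : R[i]) : z != 0 -> hol_at (fun z : R[i] => z^-1) z.
Proof. by move=> z0; exact: (@hol_atV _ id z z0 (hol_at_id z)). Qed.

Lemma side_pcont : pcont (fun t : R => ((1 - 'i%C) + t%:C * (2 * 'i%C))^-1).
Proof.
apply: (@ccont_line _ (fun z => z^-1)) => t.
by apply/hol_at_ccont/hol_at_inv/side_neq0.
Qed.

(** The integrand of [avg] has real part [1 / (1 + (2 t - 1)^2) >= 1/2], and the factor [2 * 'i]
    turns the real part into the imaginary one. *)
Lemma side_integral_lb : 1 <= normc side_integral.
Proof.
apply: le_trans (normc_Im _); apply: le_trans (ler_norm _).
have : 2^-1 <= complex.Re (avg (fun t : R => ((1 - 'i%C) + t%:C * (2 * 'i%C))^-1)).
  apply: avg_Re_ge; first exact: side_pcont.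
  move=> t t01; rewrite sideE/= mul1r lef_pV2 ?posrE; last 2 first.
  - by [].
  - by rewrite expr1n ltr_pwDl// sqr_ge0.
  by move: t01 => /andP[]; rewrite expr1n; nra.
rewrite /side_integral; case: (avg _) => a b /=.
by rewrite !(mulr0, mul0r, addr0, add0r, subr0, mulr1); lra.
Qed.

(** The scale and direction [c] cancel in [dz / (z - w)], so the four sides of any centered square
    give the same value. *)
Lemma side_inv (w c : R[i]) : c != 0 ->
  Seg (fun z => (z - w)^-1) (w + c * (1 - 'i%C)) (w + c * (1 + 'i%C)) = side_integral.
Proof.
move=> c0; rewrite /Seg /side_integral.
have -> : w + c * (1 + 'i%C) - (w + c * (1 - 'i%C)) = c * (2 * 'i%C) by ring.
have -> : (fun t : R => (w + c * (1 - 'i%C) + t%:C * (c * (2 * 'i%C)) - w)^-1) =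
   (fun t : R => c^-1 * ((1 - 'i%C) + t%:C * (2 * 'i%C))^-1).
  by apply/funext => t; rewrite -invfM; congr (_^-1); ring.
by rewrite avgZ; [rewrite mulrACA divff// mul1r|exact: side_pcont].
Qed.

Lemma normc_iu : normc ('i%C : R[i]) = 1.
Proof. by rewrite /= expr0n add0r expr1n sqrtr1. Qed.

Lemma side_norm (t : R) : 0 <= t <= 1 -> 1 <= normc ((1 - 'i%C) + t%:C * (2 * 'i%C)) <= 2.
Proof.
move=> /andP[t0 t1]; rewrite sideE; apply/andP; split.
  by have := normc_Re (1 +i* (2 * t - 1)); rewrite /= normr1.
rewrite (le_trans (normc_le_ReIm _))//= normr1 -lerBrDl ler_norml; apply/andP; split; lra.
Qed.

(** The sum on the left is the integral of [g z / (z - w)] over one side, of length [2 |c|] and at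
    distance at least |c| from [w]: [Seg_bound] gives [2 * (M / |c|) * (2 |c|)]. *)
Lemma side_bound g w d c (M : R) : (forall z, ccont_at g z) -> has_cderiv g w d -> c != 0 ->
  (forall z, normc c <= normc (z - w) <= 2 * normc c -> normc (g z) <= M) ->
  normc (Seg (divdiff g w d) (w + c * (1 - 'i%C)) (w + c * (1 + 'i%C)) + g w * side_integral)
    <= 4 * M.
Proof.
move=> cg gd c0 gM.
set a := w + c * (1 - 'i%C); set b := w + c * (1 + 'i%C).
have ba : b - a = c * (2 * 'i%C) by rewrite /b /a; ring.
have lineE (t : R) : a + t%:C * (b - a) - w = c * ((1 - 'i%C) + t%:C * (2 * 'i%C)).
  by rewrite ba /a; ring.
have line0 (t : R) : a + t%:C * (b - a) - w != 0.
  by rewrite lineE mulf_neq0// side_neq0.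
have cinv (t : R) : ccont_at (fun z => (z - w)^-1) (a + t%:C * (b - a)).
  apply/hol_at_ccont; apply: (@hol_atV _ (fun z => z + - w)) => //.
  exact: hol_atD (hol_at_id _) (hol_at_cst _ _).
have -> : Seg (divdiff g w d) a b = Seg (fun z => g z * (z - w)^-1 + (- g w) * (z - w)^-1) a b.
  by apply: Seg_eq => t; rewrite /divdiff -subr_eq0 (negbTE (line0 t)) mulrDl.
rewrite SegD; first last.
- by move=> t; apply: ccont_atM => //; exact: ccont_at_cst.
- by move=> t; exact: ccont_atM.
rewrite SegZ// /a /b side_inv// -addrA mulNr addNr addr0 -/a -/b.
apply: le_trans (_ : 2 * (M / normc c) * normc (b - a) <= _).
  apply: Seg_bound => [t|t t01]; first exact: ccont_atM.
  have /andP[t1 t2] := side_norm t01.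
  have nc : 0 < normc c by rewrite normc_gt0.
  have zE : normc (a + t%:C * (b - a) - w) = normc c * normc ((1 - 'i%C) + t%:C * (2 * 'i%C)).
    by rewrite lineE normcM.
  have h1 : normc c <= normc (a + t%:C * (b - a) - w) by rewrite zE ler_peMr// ltW.
  have h2 : normc (a + t%:C * (b - a) - w) <= 2 * normc c.
    by rewrite zE mulrC ler_wpM2r// ltW.
  rewrite normcM normcV ler_pM ?normc_ge0 ?invr_ge0 ?normc_ge0//.
    by apply: gM; rewrite h1 h2.
  by rewrite lef_pV2// posrE normc_gt0.
rewrite ba !normcM normc_iu mulr1.
have -> : normc (2 : R[i]) = 2 by rewrite -[2]/(2%:R) -(rmorph_nat (real_complex R)) normc_real ger0_norm.
have nc : normc c != 0 by rewrite gt_eqF// normc_gt0.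
by rewrite le_eqVlt; apply/orP; left; apply/eqP; field.
Qed.

Lemma divdiff_ccont_off g w d z : z != w -> ccont_at g z -> ccont_at (divdiff g w d) z.
Proof.
move=> zw gz.
apply: (@ccont_at_near _ (fun z => (g z + - g w) * (z + - w)^-1) _ z (normc (z - w))).
- by rewrite normc_gt0 subr_eq0.
- move=> h hz; rewrite /divdiff ifN//; apply: contraTneq hz => zhw.
  by rewrite -leNgt -zhw opprD addNKr normcN.
- apply: ccont_atM; first exact: ccont_atD gz (ccont_at_cst _ _).
  apply/hol_at_ccont; apply: (@hol_atV _ (fun z => z + - w)); first by rewrite subr_eq0.
  exact: hol_atD (hol_at_id _) (hol_at_cst _ _).
Qed.

Lemma divdiff_ccontT g w d : (forall z, ccont_at g z) -> has_cderiv g w d ->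
  forall z, ccont_at (divdiff g w d) z.
Proof.
move=> cg gd z; have [->|zw] := eqVneq z w; first exact: divdiff_ccont.
exact: divdiff_ccont_off.
Qed.

(** The square is made of two triangles sharing the diagonal from [v0] to [v2]; [e1] to [e4] match
    the end points of consecutive sides. *)
Lemma square_integral0 h (E : seq R[i]) w c : (forall z, ccont_at h z) ->
  (forall z, z \notin E -> hol_at h z) ->
  Seg h (w + c * (1 - 'i%C)) (w + c * (1 + 'i%C)) +
  Seg h (w + ('i%C * c) * (1 - 'i%C)) (w + ('i%C * c) * (1 + 'i%C)) +
  Seg h (w + (- c) * (1 - 'i%C)) (w + (- c) * (1 + 'i%C)) +
  Seg h (w + (- ('i%C * c)) * (1 - 'i%C)) (w + (- ('i%C * c)) * (1 + 'i%C)) = 0.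
Proof.
move=> ch hE.
pose v0 := w + c * (1 - 'i%C); pose v1 := w + c * (1 + 'i%C).
pose v2 := w + ('i%C * c) * (1 + 'i%C); pose v3 := w + (- c) * (1 + 'i%C).
have e1 : w + ('i%C * c) * (1 - 'i%C) = v1.
  rewrite /v1; congr (_ + _); transitivity ('i%C * c - ('i%C * 'i%C) * c); first by ring.
  by rewrite iu_sqr; ring.
have e2 : w + (- c) * (1 - 'i%C) = v2.
  rewrite /v2; congr (_ + _); transitivity (c * ('i%C - 1)); first by ring.
  transitivity (c * ('i%C + 'i%C * 'i%C)); first by rewrite iu_sqr.
  by ring.
have e3 : w + (- ('i%C * c)) * (1 - 'i%C) = v3.
  rewrite /v3; congr (_ + _); transitivity (- ('i%C * c) + ('i%C * 'i%C) * c); first by ring.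
  by rewrite iu_sqr; ring.
have e4 : w + (- ('i%C * c)) * (1 + 'i%C) = v0.
  rewrite /v0; congr (_ + _); transitivity (- ('i%C * c) - ('i%C * 'i%C) * c); first by ring.
  by rewrite iu_sqr; ring.
rewrite e1 e2 e3 e4 -/v0 -/v1 -/v2 -/v3.
have := @goursat_off _ h E v0 v1 v2 ch hE; have := @goursat_off _ h E v0 v2 v3 ch hE.
rewrite /Tri (Seg_opp (a := v0) (b := v2))// => T1 T2.
rewrite -[RHS](addr0 0) -{1}T1 -T2.
by move: (Seg h v0 v1) (Seg h v1 v2) (Seg h v2 v3) (Seg h v3 v0) (Seg h v0 v2) => x1 x2 x3 x4 x5; ring.
Qed.

(* [E] is a finite set of possible singularities off [w]: a divided difference is
   only known to be continuous at its base point. *)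
Lemma cauchy_bound g (E : seq R[i]) w (rho M : R) : (forall z, ccont_at g z) ->
  (forall z, z \notin E -> hol_at g z) -> w \notin E -> 0 < rho ->
  (forall z, rho <= normc (z - w) <= 2 * rho -> normc (g z) <= M) ->
  normc (g w) <= 4 * M.
Proof.
move=> cg gE wE rho0 gM.
have [d gd] := gE w wE.
have hE z : z \notin w :: E -> hol_at (divdiff g w d) z.
  by rewrite inE negb_or => /andP[zw zE]; apply: divdiff_hol => //; exact: gE.
have := square_integral0 w rho%:C (divdiff_ccontT cg gd) hE.
have c0 : rho%:C != 0 :> R[i].
  by rewrite -normc_gt0 normc_real normr_gt0 gt_eqF.
have nc : normc rho%:C = rho by rewrite normc_real gtr0_norm.
have nic : normc ('i%C * rho%:C) = rho by rewrite normcM normc_iu mul1r nc.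
have i0 : 'i%C * rho%:C != 0 by rewrite -normc_gt0 nic.
have := @side_bound g w d rho%:C M cg gd c0; rewrite nc => /(_ gM).
have := @side_bound g w d ('i%C * rho%:C) M cg gd i0; rewrite nic => /(_ gM).
have := @side_bound g w d (- rho%:C) M cg gd; rewrite oppr_eq0 normcN nc => /(_ c0 gM).
have := @side_bound g w d (- ('i%C * rho%:C)) M cg gd; rewrite oppr_eq0 normcN nic => /(_ i0 gM).
move: (Seg _ _ _) (Seg _ _ _) (Seg _ _ _) (Seg _ _ _) => x1 x2 x3 x4.
move=> h1 h2 h3 h4 s0.
have sE : 4 * (g w * side_integral) = x4 + g w * side_integral + (x2 + g w * side_integral) +
    (x3 + g w * side_integral) + (x1 + g w * side_integral).
  by rewrite -[LHS]add0r -s0; ring.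
have n4 : normc (4 : R[i]) = 4.
  by rewrite -[4]/(4%:R) -(rmorph_nat (real_complex R)) normc_real ger0_norm.
have : 4 * (normc (g w) * normc side_integral) <= 16 * M.
  rewrite -n4 -!normcM sE (le_trans (normcD4 _ _ _ _))//.
  have -> : 16 * M = 4 * M + 4 * M + 4 * M + 4 * M by ring.
  by rewrite !lerD.
have := side_integral_lb; have := normc_ge0 (g w).
by move: (normc (g w)) (normc side_integral) => x y; nra.
Qed.

(** [cauchy_bound] is applied at [z] to the divided difference of [f] at [w], with [w] as
    exceptional point. Points at distance between [3/2 * rho] and [3 * rho] from [z] are at distance
    between [rho / 2] and [4 * rho] from [w], where the quotient is at most [2 * M / (rho / 2)]. *)
Lemma entire_lip f w (rho M : R) : (forall z, hol_at f z) -> 0 < rho ->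
  (forall z, normc (z - w) <= 4 * rho -> normc (f z) <= M) ->
  forall z, normc (z - w) <= rho -> normc (f z - f w) <= 16 * M / rho * normc (z - w).
Proof.
move=> hf rho0 fM z zw.
have [->|zNw] := eqVneq z w; first by rewrite !subrr normc0E mulr0.
have [d fd] := hf w.
have cf y : ccont_at f y by exact: hol_at_ccont.
have hE y : y \notin [:: w] -> hol_at (divdiff f w d) y.
  by rewrite inE => yw; exact: divdiff_hol.
have zE : z \notin [:: w] by rewrite inE.
have rho1 : 0 < 3 / 2 * rho by rewrite mulr_gt0.
have M0 : 0 <= M.
  by apply: le_trans (fM w _); rewrite ?normc_ge0// subrr normc0E mulr_ge0// ltW.
have fw : normc (f w) <= M by apply: fM; rewrite subrr normc0E mulr_ge0// ltW.
have := @cauchy_bound _ [:: w] z (3 / 2 * rho) (4 * M / rho) (divdiff_ccontT cf fd) hE zE rho1.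
rewrite {2}/divdiff (negbTE zNw) => H.
have {H} : normc ((f z - f w) / (z - w)) <= 4 * (4 * M / rho).
  apply: H => y /andP[y1 y2].
  have yw1 : rho / 2 <= normc (y - w).
    have := le_normcD (y - w) (w - z); rewrite addrA subrK (normcBC w z).
    by move: zw y1; clear; move: (normc (y - z)) (normc (y - w)) (normc (z - w)) => *; lra.
  have yw2 : normc (y - w) <= 4 * rho.
    have := le_normcD (y - z) (z - w); rewrite addrA subrK.
    by move: zw y2; clear; move: (normc (y - z)) (normc (y - w)) (normc (z - w)) => *; lra.
  have yNw : y != w.
    by rewrite -subr_eq0 -normc_gt0 (lt_le_trans _ yw1)// divr_gt0.
  rewrite /divdiff (negbTE yNw) normcM normcV ler_pdivrMr; last first.
    by rewrite (lt_le_trans _ yw1)// divr_gt0.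
  apply: (@le_trans _ _ (2 * M)).
    have := le_normcD (f y) (- f w); rewrite normcN => /le_trans; apply.
    by rewrite mulr_natl mulr2n lerD// fM.
  apply: (@le_trans _ _ (4 * M / rho * (rho / 2))).
    by rewrite le_eqVlt; apply/orP; left; apply/eqP; field; rewrite gt_eqF.
  by rewrite ler_wpM2l// !mulr_ge0// invr_ge0 ltW.
rewrite normcM normcV ler_pdivrMr ?normc_gt0 ?subr_eq0//.
by rewrite !mulrA -natrM.
Qed.

Lemma is_derive_eps (F : R -> R) (t d : R) :
  (forall e : R, 0 < e -> exists2 r : R, 0 < r &
    forall h, `|h| < r -> `|F (t + h) - F t - d * h| <= e * `|h|) ->
  is_derive t 1 F d.
Proof.
move=> FH.
suff H : h^-1 *: ((F \o shift t) (h *: (1 : R)) - F t) @[h --> (0 : R)^'] --> d.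
  by apply: DeriveDef; [apply/cvg_ex; exists d|exact: cvg_lim H].
apply/cvgrPdist_le => e e0; have [r r0 rP] := FH e e0.
apply/nbhs_ballP; exists r => // h; rewrite /ball /= sub0r normrN => hr h0.
rewrite /GRing.scale /= mulr1 -normrN opprB.
rewrite -(ler_pM2r (x := `|h|)) ?normr_gt0// -normrM.
by rewrite mulrBl [_^-1 * _]mulrC divfK// [h + t]addrC rP.
Qed.

Lemma cderiv_line f (D : R -> R[i]) (a u : R[i]) :
  (forall t : R, has_cderiv f (a + t%:C * u) (D t)) ->
  primitive (fun t => D t * u) (fun t => f (a + t%:C * u)).
Proof.
move=> fD t.
have H e : 0 < e -> exists2 r : R, 0 < r & forall h : R, `|h| < r ->
    normc (f (a + (t + h)%:C * u) - f (a + t%:C * u) - D t * u * h%:C) <= e * `|h|.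
  move=> e0; have u1 : 0 < normc u + 1 by rewrite ltr_wpDl ?normc_ge0.
  have [r r0 rP] := fD t _ (divr_gt0 e0 u1).
  exists (r / (normc u + 1)); first by rewrite divr_gt0.
  move=> h; rewrite ltr_pdivlMr// => hr.
  have hu : normc (h%:C * u) <= `|h| * (normc u + 1).
    by rewrite normcM normc_real ler_wpM2l// lerDl.
  have := rP (h%:C * u) (le_lt_trans hu hr).
  have -> : a + t%:C * u + h%:C * u = a + (t + h)%:C * u by rewrite rmorphD/=; ring.
  have -> : D t * (h%:C * u) = D t * u * h%:C by ring.
  move=> /le_trans; apply; rewrite mulrAC ler_pdivrMr// -mulrA.
  by rewrite ler_wpM2l// ltW.
split; apply: is_derive_eps => e /H[r r0 rP]; exists r => // h /rP; apply: le_trans.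
- have := normc_Re (f (a + (t + h)%:C * u) - f (a + t%:C * u) - D t * u * h%:C).
  by case: (f _) (f _) (D t * u) => [x1 y1] [x2 y2] [x3 y3] /=; rewrite mulr0 subr0.
- have := normc_Im (f (a + (t + h)%:C * u) - f (a + t%:C * u) - D t * u * h%:C).
  by case: (f _) (f _) (D t * u) => [x1 y1] [x2 y2] [x3 y3] /=; rewrite mulr0 add0r.
Qed.

End cauchy_estimate.

Section derivative_estimates.
Context {R : realType}.
Implicit Types f : R[i] -> R[i].

Lemma cderiv_bound f w d (rho M : R) : (forall z, hol_at f z) -> 0 < rho ->
  (forall z, normc (z - w) <= 4 * rho -> normc (f z) <= M) ->
  has_cderiv f w d -> normc d <= 16 * M / rho.
Proof.
move=> hf rho0 fM fd; apply/ler_addgt0Pr => e e0.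
have [r r0 rP] := fd e e0.
pose x := Num.min r rho / 2.
have m0 : 0 < Num.min r rho by rewrite lt_min r0.
have x0 : 0 < x by rewrite divr_gt0.
have nx : normc (x%:C) = x by rewrite normc_real gtr0_norm.
have xm : x < Num.min r rho by rewrite /x; lra.
have xr : normc x%:C < r by rewrite nx (lt_le_trans xm)// ge_min lexx.
have xrho : normc (w + x%:C - w) <= rho.
  by rewrite addrAC subrr add0r nx (le_trans (ltW xm))// ge_min lexx orbT.
have h1 := rP _ xr.
have h2 := entire_lip hf rho0 fM xrho.
rewrite addrAC subrr add0r in h2.
have h3 : normc (d * x%:C) <= 16 * M / rho * x + e * x.
  have -> : d * x%:C = (f (w + x%:C) - f w) - (f (w + x%:C) - f w - d * x%:C) by ring.
  rewrite nx in h1 h2.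
  by rewrite (le_trans (le_normcD _ _))// normcN lerD.
by move: h3; rewrite normcM nx -mulrDl ler_pM2r.
Qed.

Lemma hol_at_shift f (c : R[i]) z : hol_at f (z + c) -> hol_at (fun z => f (z + c)) z.
Proof.
move=> [d fd]; exists d => e e0; have [r r0 rP] := fd e e0.
by exists r => // h /rP; rewrite (addrAC z h c).
Qed.

(** The difference quotient [q] with a small step [x] is entire, bounded by [entire_lip], and within
    [e / 2] of the derivative at both points. A second use of [entire_lip], on [q], gives a
    Lipschitz bound that passes to the derivative. *)
Lemma cderiv_lip f w z dw dz (rho M : R) : (forall z, hol_at f z) -> 0 < rho ->
  (forall z, normc (z - w) <= 8 * rho -> normc (f z) <= M) ->
  normc (z - w) <= rho -> has_cderiv f w dw -> has_cderiv f z dz ->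
  normc (dz - dw) <= 16 * (16 * M / rho) / rho * normc (z - w).
Proof.
move=> hf rho0 fM zw fdw fdz; apply/ler_addgt0Pr => e e0.
have e2 : 0 < e / 2 by rewrite divr_gt0.
have [r r0 rP] := fdw _ e2; have [s s0 sP] := fdz _ e2.
pose x := Num.min (Num.min r s) rho / 2.
have m0 : 0 < Num.min (Num.min r s) rho by rewrite !lt_min r0 s0.
have x0 : 0 < x by rewrite divr_gt0.
have nx : normc (x%:C) = x by rewrite normc_real gtr0_norm.
have xm : x < Num.min (Num.min r s) rho by rewrite /x; lra.
have xr : normc x%:C < r by rewrite nx (lt_le_trans xm)// !ge_min lexx.
have xs : normc x%:C < s by rewrite nx (lt_le_trans xm)// !ge_min lexx orbT.
have xrho : normc x%:C <= rho.
  by rewrite nx (le_trans (ltW xm))// ge_min lexx orbT.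
pose q y := x%:C^-1 * (f (y + x%:C) + - f y).
have xC0 : x%:C != 0 :> R[i] by rewrite -normc_gt0 nx.
have hq y : hol_at q y.
  apply: hol_atM; first exact: hol_at_cst.
  apply: hol_atD; first exact: hol_at_shift.
  exact: hol_atN.
have qM y : normc (y - w) <= 4 * rho -> normc (q y) <= 16 * M / rho.
  move=> yw.
  have fMy u : normc (u - y) <= 4 * rho -> normc (f u) <= M.
    move=> uy; apply: fM; have := le_normcD (u - y) (y - w); rewrite addrA subrK.
    by move: uy yw; clear; move: (normc _) (normc _) (normc _) => *; lra.
  have xy : normc (y + x%:C - y) <= rho by rewrite addrAC subrr add0r.
  have := entire_lip hf rho0 fMy xy.
  rewrite addrAC subrr add0r nx => h.
  by rewrite /q normcM normcV nx mulrC ler_pdivrMr.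
have h1 := entire_lip hq rho0 qM zw.
have dq y d (t : R) : normc (f (y + x%:C) - f y - d * x%:C) <= t * normc x%:C -> normc (q y - d) <= t.
  rewrite nx -ler_pdivrMr// => qle; apply: le_trans qle.
  have -> : q y - d = x%:C^-1 * (f (y + x%:C) - f y - d * x%:C).
    by rewrite mulrBr mulrCA mulVf// mulr1.
  by rewrite normcM normcV nx mulrC.
have h2 := dq _ _ _ (rP _ xr); have h3 := dq _ _ _ (sP _ xs).
have -> : dz - dw = (q z - q w) - (q z - dz) + (q w - dw) by ring.
rewrite (le_trans (le_normcD _ _))// [X in _ <= _ + X]splitr addrA lerD//.
by rewrite (le_trans (le_normcD _ _))// normcN lerD.
Qed.

(** The path [f (w + t h) - t dw h] has a velocity controlled by [cderiv_lip], and [primitive_bound]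
    applies. The constant depends only on [M] and [rho], which lets the inequality pass to limits
    and to integrals. *)
Lemma taylor2 f w dw h (rho M : R) : (forall z, hol_at f z) -> 0 < rho ->
  (forall z, normc (z - w) <= 8 * rho -> normc (f z) <= M) ->
  normc h <= rho -> has_cderiv f w dw ->
  normc (f (w + h) - f w - dw * h) <= 2 * (16 * (16 * M / rho) / rho * normc h ^+ 2).
Proof.
move=> hf rho0 fM hrho fdw.
have [D fD] := choice hf.
have fDt (t : R) : has_cderiv f (w + t%:C * h) (D (w + t%:C * h)) by exact: fD.
have := primitiveD (cderiv_line fDt) (primitiveZ (- (dw * h)) primitive_cst).
set g := fun t => _; set P := fun t => _ => gP.
have -> : f (w + h) - f w - dw * h = P 1 - P 0.
  by rewrite /P rmorph0 rmorph1 mul0r mul1r addr0; ring.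
rewrite expr2 (mulrA _ (normc h)).
apply: primitive_bound gP _ => t /andP[t0 t1].
rewrite /g mulr1 -mulrBl normcM ler_wpM2r ?normc_ge0//.
have th : normc (w + t%:C * h - w) <= normc h.
  by rewrite addrAC subrr add0r normcM normc_real ger0_norm// ler_piMl// normc_ge0.
have M0 : 0 <= M.
  by apply: le_trans (fM w _); rewrite ?normc_ge0// subrr normc0E mulr_ge0// ltW.
apply: le_trans (cderiv_lip hf rho0 fM (le_trans th hrho) fdw (fDt t)) _.
apply: ler_wpM2l th; apply: divr_ge0; last exact: ltW.
by apply: mulr_ge0 => //; apply: divr_ge0; [exact: mulr_ge0|exact: ltW].
Qed.

Lemma taylor2_has_cderiv f z d (C : R) :
  (forall h, normc h <= 1 -> normc (f (z + h) - f z - d * h) <= C * normc h ^+ 2) ->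
  has_cderiv f z d.
Proof.
move=> fC e e0.
have C1 : 0 < `|C| + 1 by rewrite ltr_wpDl.
exists (Num.min 1 (e / (`|C| + 1))); first by rewrite lt_min ltr01 divr_gt0.
move=> h; rewrite lt_min => /andP[/ltW h1]; rewrite ltr_pdivlMr// => he.
rewrite (le_trans (fC _ h1))// expr2 mulrA ler_wpM2r ?normc_ge0//.
apply: le_trans (ltW he); rewrite mulrC ler_wpM2l ?normc_ge0//.
by rewrite (le_trans (ler_norm _))// lerDl.
Qed.

End derivative_estimates.

(** * Continuous functions on the plane: boundedness and measurability *)

Section plane.
Context {R : realType}.
Implicit Types f : R[i] -> R[i].

Lemma nbhs_pair (w : R * R) (r : R) : 0 < r ->
  \forall v \near w, normc ((v.1 +i* v.2) - (w.1 +i* w.2)) < r.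
Proof.
move=> r0; have r2 : 0 < r / 2 by rewrite divr_gt0.
exists (ball w.1 (r / 2), ball w.2 (r / 2)) => /=.
  by split; exact: nbhsx_ballx.
move=> v [h1 h2]; change (normc ((v.1 +i* v.2) - (w.1 +i* w.2)) < r).
apply: (le_lt_trans (normc_le_ReIm _)).
rewrite /= [ltRHS]splitr ltrD//.
- by rewrite distrC.
- by rewrite distrC.
Qed.

Lemma ccont_plane f : (forall z, ccont_at f z) ->
  continuous (fun w : R * R => normc (f (w.1 +i* w.2))).
Proof.
move=> cf w; apply/cvgrPdist_le => e e0.
have [r r0 rP] := cf (w.1 +i* w.2) e e0.
apply: filterS (nbhs_pair w r0) => v /rP; rewrite subrKC.
apply: le_trans; rewrite ler_norml; apply/andP; split.
- by rewrite lerNl opprB le_normcB.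
- by rewrite normcBC le_normcB.
Qed.

Lemma compact_square (r : R) : compact (`[- r, r]%classic `*` `[- r, r]%classic : set (R * R)).
Proof. by apply: compact_setX; exact: segment_compact. Qed.

Lemma ccont_bounded f (r : R) : (forall z, ccont_at f z) ->
  exists M, 0 <= M /\ forall z, normc z <= r -> normc (f z) <= M.
Proof.
move=> /ccont_plane cf.
have : compact ((fun w : R * R => normc (f (w.1 +i* w.2))) @` (`[- r, r]%classic `*` `[- r, r]%classic)).
  by apply: continuous_compact; [exact: continuous_subspaceT|exact: compact_square].
move=> /compact_bounded[M [_ /(_ (`|M| + 1))]] => fM.
exists (`|M| + 1); split; first by rewrite addr_ge0.
move=> z zr; apply: le_trans (ler_norm _) _; apply: fM.
  by rewrite (le_lt_trans (ler_norm _))// ltrDl.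
exists (complex.Re z, complex.Im z); last by case: z {zr}.
split; rewrite /= in_itv/= -ler_norml.
- exact: le_trans (normc_Re z) zr.
- exact: le_trans (normc_Im z) zr.
Qed.

(** The countably many rational boxes contained in [O] cover it: with half-side [s] between [r / 4]
    and [r / 2] and center within [r / 4] of [w], a box contains [w] and stays in the ball of radius
    [r]. *)
Lemma open_plane_measurable (O : set (R * R)) : open O ->
  measurable (O : set (measurableTypeR R * measurableTypeR R)).
Proof.
move=> oO.
pose box (q : rat * rat * rat) : set (R * R) :=
  (`](ratr q.1.1 - ratr q.2), (ratr q.1.1 + ratr q.2)[%classic) `*`
  (`](ratr q.1.2 - ratr q.2), (ratr q.1.2 + ratr q.2)[%classic).
pose F q := if pselect (box q `<=` O) then box q else set0.
have -> : O = \bigcup_q F q.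
  rewrite eqEsubset; split; last first.
    by move=> w [q _]; rewrite /F; case: pselect => // h /h.
  move=> w Ow.
  have /nbhs_ballP[r /= r0 rO] : nbhs w O by exact: open_nbhs_nbhs.
  have /rat_in_itvoo[s] : r / 4 < r / 2 by lra.
  rewrite in_itv/= => /andP[s1 s2].
  have /rat_in_itvoo[p] : w.1 - r / 4 < w.1 + r / 4 by lra.
  rewrite in_itv/= => /andP[p1 p2].
  have /rat_in_itvoo[q] : w.2 - r / 4 < w.2 + r / 4 by lra.
  rewrite in_itv/= => /andP[q1 q2].
  exists (p, q, s) => //; rewrite /F.
  have wbox : box (p, q, s) w by split => /=; rewrite in_itv/=; apply/andP; split; lra.
  case: pselect => // -[]; move=> v [/=]; rewrite !in_itv/= => /andP[v1 v2] /andP[v3 v4].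
  apply: rO; split; rewrite /ball /= ltr_norml; apply/andP; split; lra.
apply: countable_bigcupT_measurable => // q; rewrite /F; case: pselect => [?|?]; last exact: measurable0.
by apply: measurableX; exact: measurable_itv.
Qed.

Lemma continuous_plane_measurable (F : R * R -> R) : continuous F ->
  measurable_fun setT (F : measurableTypeR R * measurableTypeR R -> R).
Proof.
move=> /continuousP cF; apply: (measurability _ (measurable_realfun.RGenOpens.measurableE R)).
move=> _ [_ [a [b ->] <-]]; rewrite setTI; apply: open_plane_measurable.
by apply: cF; exact: interval_open.
Qed.

End plane.

(** * The complex exponential *)

Section complex_exponential.
Context {R : realType}.
Implicit Types z w : R[i].

Definition cexp z : R[i] :=
  (expR (complex.Re z))%:C * (cos (complex.Im z) +i* sin (complex.Im z)).

Lemma normc_cis (t : R) : normc (cos t +i* sin t) = 1.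
Proof. by rewrite /= cos2Dsin2 sqrtr1. Qed.

Lemma normc_cexp z : normc (cexp z) = expR (complex.Re z).
Proof. by rewrite normcM normc_cis mulr1 normc_real ger0_norm// expR_ge0. Qed.

Lemma cexpD z w : cexp (z + w) = cexp z * cexp w.
Proof.
case: z w => [a b] [c d]; rewrite /cexp /= expRD cosD sinD rmorphM/=.
rewrite mulrACA; congr (_ * _).
by apply/eqP; rewrite eq_complex /= eqxx /= addrC.
Qed.

Lemma is_derive_epsP (F : R -> R) (t d : R) : is_derive t 1 F d ->
  forall e : R, 0 < e -> exists2 r : R, 0 < r &
    forall h, `|h| < r -> `|F (t + h) - F t - d * h| <= e * `|h|.
Proof.
move=> dF e e0; have [/cvg_ex[l Fl] dE] := dF.
have {dE}ld : l = d by rewrite -dE; apply/esym/cvg_lim.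
move: Fl; rewrite ld => /cvgrPdist_le/(_ e e0)/nbhs_ballP[r /= r0 rP].
exists r => // h hr; have [->|h0] := eqVneq h 0.
  by rewrite addr0 mulr0 subrr subr0 normr0 mulr0.
have := rP h; rewrite /ball /= sub0r normrN => /(_ hr h0).
rewrite /GRing.scale /= mulr1 -normrN opprB.
rewrite -(ler_pM2r (x := `|h|)) ?normr_gt0// -normrM.
by rewrite mulrBl [_^-1 * _]mulrC divfK// [h + t]addrC.
Qed.

Lemma cexp_deriv0 : has_cderiv cexp 0 1.
Proof.
(* The three terms of the remainder contribute [4 * e'], [e'] and [e'] times |h|. *)
move=> e e0; pose e' := e / 6.
have e'0 : 0 < e' by rewrite divr_gt0.
pose e1 := Num.min 1 e'.
have e10 : 0 < e1 by rewrite lt_min ltr01.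
have [r1 r10 r1P] := is_derive_epsP (is_derive_expR 0) e10.
have [r2 r20 r2P] := is_derive_epsP (is_derive_cos 0) e'0.
have [r3 r30 r3P] := is_derive_epsP (is_derive_sin 0) e'0.
pose r := Num.min (Num.min r1 r2) (Num.min r3 (e1 / 2)).
exists r; first by rewrite !lt_min r10 r20 r30 divr_gt0.
move=> h; rewrite !lt_min => /andP[/andP[h1 h2] /andP[h3 h4]].
case: h h1 h2 h3 h4 => a b; set n := normc _ => h1 h2 h3 h4.
have an : `|a| <= n by exact: (normc_Re (a +i* b)).
have bn : `|b| <= n by exact: (normc_Im (a +i* b)).
have E := r1P a (le_lt_trans an h1).
have Co := r2P b (le_lt_trans bn h2).
have Si := r3P b (le_lt_trans bn h3).
rewrite !add0r expR0 cos0 sin0 oppr0 mul0r subr0 in E Co Si.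
rewrite mul1r addr0 in Si; rewrite mul1r in E.
have n0 : 0 <= n by exact: normc_ge0.
have e1e : e1 <= e' by rewrite ge_min lexx orbT.
have e11 : e1 <= 1 by rewrite ge_min lexx.
have ea1 : `|expR a - 1| <= e'.
  have := ler_normD (expR a - 1 - a) a; rewrite subrK => /le_trans; apply.
  have : e1 * `|a| <= `|a| by rewrite ler_piMl.
  by move: E an h4 e1e; move: (`|expR a - 1 - a|) (`|a|) => *; lra.
have ea2 : expR a <= 2.
  have := ler_norm (expR a - 1).
  have := ler_normD (expR a - 1 - a) a; rewrite subrK.
  have : e1 * `|a| <= `|a| by rewrite ler_piMl.
  by move: E an h4 e11; move: (`|expR a - 1 - a|) (`|a|) => *; lra.
rewrite add0r mul1r.
have -> : cexp (a +i* b) - cexp 0 - (a +i* b) =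
  (expR a)%:C * ((cos b - 1) +i* (sin b - b)) + ((expR a - 1) * b)%:C * 'i%C + (expR a - 1 - a)%:C.
  rewrite /cexp /= expR0 cos0 sin0; apply/eqP; rewrite eq_complex /=.
  by apply/andP; split; apply/eqP; ring.
rewrite (le_trans (le_normcD _ _))// normc_real.
have H1 : normc ((expR a)%:C * ((cos b - 1) +i* (sin b - b))) <= 2 * (e' * n + e' * n).
  rewrite normcM normc_real ger0_norm ?expR_ge0// ler_pM ?expR_ge0 ?normc_ge0//.
  rewrite (le_trans (normc_le_ReIm _))//= lerD//.
    by rewrite (le_trans Co)// ler_wpM2l// ltW.
  by rewrite (le_trans Si)// ler_wpM2l// ltW.
have H2 : normc (((expR a - 1) * b)%:C * 'i%C) <= e' * n.
  rewrite normcM normc_iu mulr1 normc_real normrM.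
  by rewrite ler_pM.
have H3 : `|expR a - 1 - a| <= e' * n.
  rewrite (le_trans E)// ler_pM ?(ltW e10)//.
apply: (le_trans (lerD (le_normcD _ _) (lexx _))).
apply: (le_trans (lerD (lerD H1 H2) H3)).
by rewrite /e'; move: n {an bn h1 h2 h3 h4 n0 H1 H2 H3} => n; lra.
Qed.

(** The functional equation carries the derivative at 0 to the point [c * z]. *)
Lemma cexp_lin_hol (c z : R[i]) : hol_at (fun z => cexp (c * z)) z.
Proof.
exists (cexp (c * z) * c) => e e0.
have A0 : 0 < normc (cexp (c * z)) + 1 by rewrite ltr_wpDl ?normc_ge0.
have B0 : 0 < normc c + 1 by rewrite ltr_wpDl ?normc_ge0.
have e'0 : 0 < e / (normc (cexp (c * z)) + 1) / (normc c + 1) by rewrite !divr_gt0.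
have [r r0 rP] := cexp_deriv0 e'0.
exists (r / (normc c + 1)); first by rewrite divr_gt0.
move=> h; rewrite ltr_pdivlMr// => hr.
have chr : normc (c * h) <= normc h * (normc c + 1).
  by rewrite normcM mulrC ler_wpM2l ?normc_ge0// lerDl.
have := rP (c * h) (le_lt_trans chr hr).
have c00 : cexp 0 = 1 by rewrite /cexp /= expR0 cos0 sin0 mul1r.
rewrite c00 add0r mul1r mulrDr cexpD => H.
have -> : cexp (c * z) * cexp (c * h) - cexp (c * z) - cexp (c * z) * c * h =
  cexp (c * z) * (cexp (c * h) - 1 - c * h) by ring.
rewrite normcM; apply: le_trans (_ : (normc (cexp (c * z)) + 1) * (e / (normc (cexp (c * z)) + 1) / (normc c + 1) * (normc h * (normc c + 1))) <= _).
  apply: ler_pM; rewrite ?normc_ge0// ?lerDl//.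
  by apply: (le_trans H); apply: ler_wpM2l => //; exact: ltW.
rewrite le_eqVlt; apply/orP; left; apply/eqP; field.
by rewrite !gt_eqF.
Qed.

End complex_exponential.

(** * Pointwise bounds by local means *)

Section local_Lp.
Context {R : realType}.
Implicit Types f : R[i] -> R[i].
Notation mu2 := ((@lebesgue_measure R) \x (@lebesgue_measure R))%E.
Notation plane := (measurableTypeR R * measurableTypeR R)%type.
Notation cx w := (w.1 +i* w.2).

Definition disc (z0 : R[i]) : set plane := [set w | normc (cx w - z0) < 1].

Lemma disc_measurable z0 : measurable (disc z0).
Proof.
have cd : continuous (fun w : R * R => normc (cx w - z0)).
  apply: (@ccont_plane _ (fun z => z + - z0)) => z.
  exact: ccont_atD (ccont_at_id _) (ccont_at_cst _ _).
rewrite (_ : disc z0 = (fun w : R * R => normc (cx w - z0)) @^-1` `]-oo, 1[%classic); last first.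
  by apply/seteqP; split=> w; rewrite /disc /= in_itv.
apply: open_plane_measurable; move/continuousP : cd; apply.
exact: interval_open.
Qed.

Lemma normc_powR_measurable f (p : R) : (forall z, ccont_at f z) ->
  measurable_fun setT (fun w : plane => normc (f (cx w)) `^ p).
Proof.
move=> cf; apply: (@measurableT_comp _ _ _ _ _ _ (fun x : R => x `^ p)).
  exact: measurable_realfun.measurable_powR.
exact: (continuous_plane_measurable (ccont_plane cf)).
Qed.

Lemma square_measure (w : R[i]) (r : R) : 0 < r ->
  mu2 (`[complex.Re w - r, complex.Re w + r]%classic `*`
       `[complex.Im w - r, complex.Im w + r]%classic) = ((2 * r) ^+ 2)%:E.
Proof.
move=> r0; rewrite product_measure1E//; try exact: measurable_itv.
have E (a : R) : lebesgue_measure (`[a - r, a + r]%classic : set R) = (2 * r)%:E.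
  rewrite lebesgue_measure_itv /= lte_fin ifT; last by lra.
  by rewrite -EFinB; congr EFin; ring.
by transitivity ((2 * r)%:E * (2 * r)%:E)%E; first by congr (_ * _)%E; exact: E.
Qed.

(** The weight vanishes on the boundary circle, which keeps an almost maximal point [w] inside, with
    room [1 - |w - z0|] around it. *)
Lemma weighted_sup f z0 (q : R) : 0 < q -> (forall z, ccont_at f z) -> f z0 != 0 ->
  exists N w, [/\ normc (f z0) <= N, normc (w - z0) < 1,
    N / 2 < (1 - normc (w - z0)) `^ q * normc (f w) &
    forall z, normc (z - z0) < 1 -> (1 - normc (z - z0)) `^ q * normc (f z) <= N].
Proof.
move=> q0 cf fz0.
pose S := [set (1 - normc (z - z0)) `^ q * normc (f z) | z in [set z | normc (z - z0) < 1]].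
have [M [M0 fM]] := ccont_bounded (normc z0 + 1) cf.
have S1 : S (normc (f z0)).
  by exists z0; rewrite /= subrr normc0E ?ltr01// subr0 powR1 mul1r.
have Sub : ubound S M.
  move=> _ [z /= zz0 <-]; have d0 : 0 <= 1 - normc (z - z0) by rewrite subr_ge0 ltW.
  have d1 : (1 - normc (z - z0)) `^ q <= 1.
    apply: (@le_trans _ _ (1 `^ q)); last by rewrite powR1.
    by rewrite ge0_ler_powR ?nnegrE ?(ltW q0)// gerBl normc_ge0.
  rewrite (le_trans (ler_piMl (normc_ge0 _) d1))// fM//.
  rewrite -(subrK z0 z) (le_trans (le_normcD _ _))// addrC lerD2l ltW//.
have hS : has_sup S by split; [exists (normc (f z0))|exists M].
have N0 : normc (f z0) <= sup S by apply: ub_le_sup S1; case: hS.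
have Npos : 0 < sup S by rewrite (lt_le_trans _ N0)// normc_gt0.
have N2 : 0 < sup S / 2 by rewrite divr_gt0.
have [_ [w ww <-] hw] := sup_adherent N2 hS.
exists (sup S), w; split => //.
  by move: hw; lra.
by move=> z zz; apply: ub_le_sup; [case: hS|exists z].
Qed.

(** Ratio of the side of the square to the distance [r] to the boundary. Within [r / 2] of [w], |f|
    is at most [2^(2/p) * A] with [A = N * r^(-2/p)], so within [r / 8] of [w], whence the [1 / 8],
    increments from [w] grow at most at the rate [128 * 2^(2/p) * A / r]. The denominator 512 limits
    the variation to [A / 4]. *)
Definition lpc (p : R) : R := Num.min (1 / 8) (2 `^ (- (2 / p)) / 512).

Lemma lpc_gt0 p : 0 < lpc p.
Proof.
have twoV0 : 0 < 2 `^ (- (2 / p)) :> R by exact: powR_gt0.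
by rewrite lt_min; move: twoV0; move: (2 `^ _) => y; lra.
Qed.

(* Near a point almost maximizing [(1 - |z - z0|) ^ (2 / p) * |f z|], Cauchy's
   estimate keeps [|f|] above half its value, on a disc of radius comparable to
   the distance to the boundary: this covers every exponent [p > 0] at once. *)
Lemma large_on_square f z0 (p : R) : 0 < p -> (forall z, hol_at f z) -> f z0 != 0 ->
  exists N w r, [/\ normc (f z0) <= N, 0 < r &
    forall z, `|complex.Re z - complex.Re w| <= lpc p * r / 2 ->
              `|complex.Im z - complex.Im w| <= lpc p * r / 2 ->
      normc (z - z0) < 1 /\ N * r `^ (- (2 / p)) / 4 <= normc (f z)].
Proof.
move=> p0 hf fz0.
have q0 : 0 < 2 / p by rewrite divr_gt0.
set q := 2 / p in q0 *.
have [N [w [Nf wz0 wN zN]]] := weighted_sup q0 (fun z => hol_at_ccont (hf z)) fz0.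
set r := 1 - normc (w - z0) in wN *.
have r0 : 0 < r by rewrite subr_gt0.
exists N, w, r; split => // z zr zi.
have N0 : 0 < N by rewrite (lt_le_trans _ Nf)// normc_gt0.
have rq : 0 < r `^ q by rewrite powR_gt0.
set A := N * r `^ (- q).
have A0 : 0 < A by rewrite mulr_gt0// powR_gt0.
have fw : A / 2 < normc (f w).
  rewrite /A powRN -(ltr_pM2l rq) [ltLHS](_ : _ = N / 2)//.
  by field; rewrite gt_eqF.
pose k : R := 2 `^ (- q).
have k0 : 0 < k by rewrite powR_gt0.
have c0 : 0 < lpc p := lpc_gt0 p.
have c1 : lpc p <= 1 / 8 by rewrite ge_min lexx.
have c2 : lpc p <= k / 512 by rewrite ge_min lexx orbT.
set c := lpc p in zr zi c0 c1 c2.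
have zw : normc (z - w) <= c * r.
  rewrite (le_trans (normc_le_ReIm _))// !raddfB/= [leRHS]splitr.
  exact: lerD.
have cr : c * r <= r / 8.
  by rewrite [leRHS]mulrC -[8^-1]mul1r ler_wpM2r// ltW.
(* Points within [r / 2] of [w] are still at distance at least [r / 2] from the boundary of the
   disc. *)
have fM y : normc (y - w) <= 4 * (r / 8) -> normc (f y) <= A / k.
  move=> yw.
  have yz0 : normc (y - z0) <= 1 - r / 2.
    have := le_normcD (y - w) (w - z0); rewrite addrA subrK.
    by move: yw; rewrite /r; move: (normc _) (normc _) (normc _) => *; lra.
  have y1 : normc (y - z0) < 1 by move: yz0 r0; move: (normc _) => *; lra.
  have := zN y y1.
  have : (r / 2) `^ q <= (1 - normc (y - z0)) `^ q.
    rewrite ge0_ler_powR ?nnegrE ?(ltW q0)//.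
    - by rewrite divr_ge0// ltW.
    - by rewrite subr_ge0 ltW.
    - by move: yz0; move: (normc _) => *; lra.
  have rk : (r / 2) `^ q = r `^ q * k.
    by rewrite powRM ?invr_ge0// ?(ltW r0)// -powR_inv1// -powRrM mulN1r.
  move=> h1 h2.
  have -> : A / k = N / (r `^ q * k) by rewrite /A powRN; field; rewrite !gt_eqF.
  rewrite ler_pdivlMr ?mulr_gt0// -rk mulrC.
  by apply: le_trans h2; rewrite ler_wpM2r ?normc_ge0.
have zr8 : normc (z - w) <= r / 8 by exact: le_trans zw cr.
have r8 : 0 < r / 8 by rewrite divr_gt0.
have h := entire_lip hf r8 fM zr8.
split.
  have := le_normcD (z - w) (w - z0); rewrite addrA subrK.
  by move: zr8 r0; rewrite /r; move: (normc _) (normc _) (normc _) => *; lra.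
have h' : normc (f z - f w) <= A / 4.
  apply: (le_trans h); apply: (@le_trans _ _ (16 * (A / k) / (r / 8) * (k / 512 * r))).
    apply: ler_wpM2l.
      by apply: divr_ge0; [apply: mulr_ge0 => //; apply: divr_ge0; exact: ltW|rewrite divr_ge0// ltW].
    by apply: (le_trans zw); rewrite ler_wpM2r// ltW.
  rewrite le_eqVlt; apply/orP; left; apply/eqP.
  have aux (a b x : R) : 0 < b -> 0 < x -> 16 * (a / b) / (x / 8) * (b / 512 * x) = a / 4.
    by clear; move=> b0 x0; field; rewrite !gt_eqF.
  exact: aux.
rewrite -/A; have := le_normcB (f w) (f z); rewrite normcBC.
by move: fw h'; move: (normc _) (normc _) (normc _) => *; lra.
Qed.

(** The exponent [2 / p] makes the [p]-th power of the lower bound scale as [r^-2], which cancels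
    the area [(lpc p * r)^2] of the square: the constant depends on [p] alone. *)
Lemma local_Lp f z0 (p : R) : 0 < p -> (forall z, hol_at f z) ->
  ((normc (f z0) `^ p)%:E <= (4 `^ p / lpc p ^+ 2)%:E *
    \int[mu2]_(w in disc z0) (normc (f (cx w)) `^ p)%:E)%E.
Proof.
move=> p0 hf; have c0 := lpc_gt0 p.
have C0 : 0 <= 4 `^ p / lpc p ^+ 2 by rewrite divr_ge0 ?powR_ge0 ?sqr_ge0.
have I0 : (0 <= \int[mu2]_(w in disc z0) (normc (f (cx w)) `^ p)%:E)%E.
  by apply: integral_ge0 => w _; rewrite lee_fin powR_ge0.
have [->|fz0] := eqVneq (f z0) 0.
  by rewrite normc0E powR0 ?gt_eqF// mule_ge0// lee_fin.
have [N [w [r [Nf r0 sq]]]] := large_on_square p0 hf fz0.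
have N0 : 0 < N by rewrite (lt_le_trans _ Nf)// normc_gt0.
set q := 2 / p in sq *.
pose s := lpc p * r / 2; have s0 : 0 < s by rewrite !mulr_gt0.
pose Q : set plane := `[complex.Re w - s, complex.Re w + s]%classic `*`
       `[complex.Im w - s, complex.Im w + s]%classic.
have mQ : measurable Q by apply: measurableX; exact: measurable_itv.
have QP v : Q v -> normc (cx v - z0) < 1 /\ N * r `^ (- q) / 4 <= normc (f (cx v)).
  case=> /=; rewrite !in_itv/= => /andP[v1 v2] /andP[v3 v4].
  by apply: sq => /=; rewrite -/s ler_norml; apply/andP; split; lra.
have mf := normc_powR_measurable p (fun z => hol_at_ccont (hf z)).
have h1 : (\int[mu2]_(v in Q) (((N * r `^ (- q) / 4) `^ p)%:E) <=
    \int[mu2]_(w in disc z0) (normc (f (cx w)) `^ p)%:E)%E.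
  apply: (@le_trans _ _ (\int[mu2]_(w in Q) (normc (f (cx w)) `^ p)%:E)%E).
    apply: ge0_le_integral => //.
    - by move=> v _; rewrite lee_fin powR_ge0.
    - by apply/measurable_EFinP; exact: measurable_funTS.
    - move=> v /QP[_ h]; rewrite lee_fin ge0_ler_powR ?nnegrE ?(ltW p0) ?normc_ge0//.
      by rewrite !mulr_ge0 ?powR_ge0// ltW.
  apply: ge0_subset_integral => //; first exact: disc_measurable.
  - by apply/measurable_EFinP; exact: measurable_funTS.
  - by move=> v _; rewrite lee_fin powR_ge0.
  - by move=> v /QP[].
have iQ (c : R) : (\int[mu2]_(v in Q) c%:E)%E = (c * (2 * s) ^+ 2)%:E.
  by rewrite integral_cst// EFinM -(square_measure w s0).
rewrite iQ in h1.
apply: (@le_trans _ _ ((4 `^ p / lpc p ^+ 2)%:E * ((N * r `^ (- q) / 4) `^ p * (2 * s) ^+ 2)%:E)%E); last first.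
  by rewrite lee_wpmul2l// lee_fin.
rewrite -EFinM lee_fin.
have -> : (N * r `^ (- q) / 4) `^ p = N `^ p * r ^- 2 * (4 `^ p)^-1.
  rewrite !powRM ?mulr_ge0 ?powR_ge0 ?invr_ge0// ?(ltW N0)//.
  rewrite -powRrM mulNr /q divfK ?gt_eqF// powRN powR_mulrn ?(ltW r0)//.
  by rewrite -(powR_inv1 (_ : 0 <= 4))// -powRrM mulN1r powRN.
have -> : 4 `^ p / lpc p ^+ 2 * (N `^ p * r ^- 2 * (4 `^ p)^-1 * (2 * s) ^+ 2) = N `^ p.
  have aux (P T c x : R) : 0 < P -> 0 < c -> 0 < x ->
      P / c ^+ 2 * (T * x ^- 2 * P^-1 * (2 * (c * x / 2)) ^+ 2) = T.
    by clear; move=> P0 c0 x0; field; rewrite !gt_eqF.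
  by apply: aux => //; rewrite powR_gt0.
by rewrite ge0_ler_powR ?nnegrE ?(ltW p0) ?(ltW N0) ?normc_ge0.
Qed.

End local_Lp.

Section real_integrand.
Local Open Scope ereal_scope.
Context d (T : measurableType d) (R : realType) (m : {measure set T -> \bar R}).
Context (D : set T) (mD : measurable D).

Lemma ge0_integralZ_real (c : R) (f : T -> R) : (0 <= c)%R -> measurable_fun D f ->
  (forall x, D x -> (0 <= f x)%R) ->
  \int[m]_(x in D) (c * f x)%:E = c%:E * \int[m]_(x in D) (f x)%:E.
Proof.
move=> c0 mf f0; under eq_integral => x _ do rewrite EFinM.
apply: (@ge0_integralZl _ _ _ m D mD (fun x => (f x)%:E)).
- exact/measurable_EFinP.
- by move=> x Dx; rewrite lee_fin f0.
- by rewrite lee_fin.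
Qed.

Lemma ge0_le_integral_real (f g : T -> R) :
  (forall x, D x -> (0 <= f x)%R) -> measurable_fun D f -> measurable_fun D g ->
  (forall x, D x -> (f x <= g x)%R) ->
  \int[m]_(x in D) (f x)%:E <= \int[m]_(x in D) (g x)%:E.
Proof.
move=> f0 mf mg fg; apply: ge0_le_integral => //.
- exact/measurable_EFinP.
- exact/measurable_EFinP.
Qed.

End real_integrand.

(** * Tonelli's theorem and Gaussian averages on the plane *)

Section area_measure.
Context {R : realType}.
Notation plane := (measurableTypeR R * measurableTypeR R)%type.
Notation mu := (@lebesgue_measure R).
Notation mu2 := (mu \x mu)%E.
(* The library only provides a sigma-finiteness instance of the product measure
   for probabilities, hence this alias of the product Lebesgue measure. *)
Definition area : set plane -> \bar R := mu2.
HB.instance Definition _ := Measure.copy area mu2.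
Lemma area_sigma_finite : sigma_finite [set: plane] area.
Proof.
have /sigma_finiteP[F [TF ndF Foo]] := sigma_finiteT mu.
exists (fun n => F n `*` F n).
  rewrite -setXTT TF predeqE => -[x y]; split.
    move=> [/= [n _ Fnx] [k _ Gky]]; exists (maxn n k) => //; split.
    - by move: x Fnx; exact/subsetPset/ndF/leq_maxl.
    - by move: y Gky; exact/subsetPset/ndF/leq_maxr.
  by move=> [n _ []/= ? ?]; split; exists n.
move=> k; have [? ?] := Foo k.
split; first exact: measurableX.
by rewrite /area product_measure1E// lte_mul_pinfty// ge0_fin_numE.
Qed.
HB.instance Definition _ := Measure_isSigmaFinite.Build _ _ _ area area_sigma_finite.
Lemma area_tonelli (f : plane * plane -> \bar R) : measurable_fun setT f ->
  (forall x, (0 <= f x)%E) ->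
  (\int[mu2]_z \int[mu2]_w f (z,w) = \int[mu2]_w \int[mu2]_z f (z,w))%E.
Proof. exact: (@fubini_tonelli _ _ plane plane R area area f). Qed.

End area_measure.

Section gaussian_kernel.
Context {R : realType}.
Notation mu := (@lebesgue_measure R).
Notation mu2 := ((@lebesgue_measure R) \x (@lebesgue_measure R))%E.
Notation plane := (measurableTypeR R * measurableTypeR R)%type.

Lemma gauss_measurable (k a : R) : measurable_fun setT (fun x : R => expR (- k * (a - x) ^+ 2)).
Proof.
apply: measurableT_comp => //; apply: measurable_funM => //; apply: measurable_funX.
exact: measurable_funB.
Qed.

(** The integrand is a multiple of the normal density of mean [a] and variance [1 / (2 k)]; the
    point is that [g] does not depend on [a]. *)
Lemma gauss_shift_integral (k : R) : 0 < k -> exists g : R, 0 < g /\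
  forall a : R, (\int[mu]_x (expR (- k * (a - x) ^+ 2))%:E = g%:E)%E.
Proof.
move=> k0; pose s : R := Num.sqrt ((2 * k)^-1).
have s2 : s ^+ 2 = (2 * k)^-1 by rewrite sqr_sqrtr// invr_ge0 mulr_ge0// ltW.
have s0 : 0 < s by rewrite sqrtr_gt0 invr_gt0 mulr_gt0.
have pk0 : 0 < normal_peak s by rewrite normal_peak_gt0// gt_eqF.
exists ((normal_peak s)^-1); split; first by rewrite invr_gt0.
move=> a; have := integral_normal_pdf a s.
under eq_integral => x _.
  rewrite normal_pdfE ?gt_eqF// (_ : normal_fun a s x = expR (- k * (a - x) ^+ 2)); last first.
    congr expR; rewrite -mulr_natr s2 invfM invrK -mulrA [X in - _ * X](_ : _ = k); last by field.
    by rewrite mulrC mulrN mulNr -sqrrN opprB.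
  over.
rewrite ge0_integralZ_real ?(ltW pk0)//; last exact: gauss_measurable.
set I := integral _ _ _ => h.
have : ((normal_peak s)^-1%:E * ((normal_peak s)%:E * I) = (normal_peak s)^-1%:E * 1)%E.
  by rewrite h.
by rewrite muleA -EFinM mulVf ?gt_eqF// mul1e mule1.
Qed.

Definition gkernel (k : R) (z w : plane) : R :=
  expR (- k * ((w.1 - z.1) ^+ 2 + (w.2 - z.2) ^+ 2)).

Lemma gkernelE k z w : gkernel k z w =
  expR (- k * (w.1 - z.1) ^+ 2) * expR (- k * (w.2 - z.2) ^+ 2).
Proof. by rewrite /gkernel mulrDr expRD. Qed.

Lemma gkernel_ge0 k z w : 0 <= gkernel k z w.
Proof. exact: expR_ge0. Qed.

Lemma gkernel_measurable k : measurable_fun setT (fun zw : plane * plane => gkernel k zw.1 zw.2).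
Proof.
apply: measurableT_comp => //; apply: measurable_funM => //.
apply: measurable_funD; apply: measurable_funX; apply: measurable_funB.
- exact: (measurableT_comp measurable_fst measurable_snd).
- exact: (measurableT_comp measurable_fst measurable_fst).
- exact: (measurableT_comp measurable_snd measurable_snd).
- exact: (measurableT_comp measurable_snd measurable_fst).
Qed.

Lemma gkernel_measurable1 k w : measurable_fun setT (fun z : plane => gkernel k z w).
Proof.
apply: (@measurableT_comp _ _ _ _ _ _ (fun zw : plane * plane => gkernel k zw.1 zw.2) _ (fun z : plane => (z, w))).
  exact: gkernel_measurable.
exact: measurable_fun_pair.
Qed.

Lemma gkernel_measurable2 k z : measurable_fun setT (fun w : plane => gkernel k z w).
Proof.
apply: (@measurableT_comp _ _ _ _ _ _ (fun zw : plane * plane => gkernel k zw.1 zw.2) _ (fun w : plane => (z, w))).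
  exact: gkernel_measurable.
exact: measurable_fun_pair.
Qed.

Lemma gkernel_integral (k : R) : 0 < k -> exists K : R, 0 < K /\
  forall w : plane, (\int[mu2]_z (gkernel k z w)%:E = K%:E)%E.
Proof.
move=> k0; have [g [g0 gE]] := gauss_shift_integral k0.
exists (g * g); split; first by rewrite mulr_gt0.
move=> w; rewrite fubini_tonelli1//; last 2 first.
- by apply/measurable_EFinP; exact: gkernel_measurable1.
- by move=> z; rewrite lee_fin gkernel_ge0.
rewrite /fubini_F /=; under eq_integral => x _.
  under eq_integral => y _ do rewrite gkernelE /=.
  rewrite ge0_integralZ_real ?expR_ge0//; last exact: gauss_measurable.
  rewrite gE muleC -EFinM.
  over.
rewrite /= ge0_integralZ_real ?(ltW g0)//; last exact: gauss_measurable.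
by rewrite gE.
Qed.

(** Gaussian averaging keeps the total mass of [Phi] up to the constant [K]. Taking a [p]-th power
    for [Phi] reduces every finite exponent to this L^1 statement. *)
Lemma gkernel_tonelli (k : R) : 0 < k -> exists K : R, 0 < K /\
  forall Phi : plane -> R, measurable_fun setT Phi -> (forall w, 0 <= Phi w) ->
    (\int[mu2]_z \int[mu2]_w (gkernel k z w * Phi w)%:E = K%:E * \int[mu2]_w (Phi w)%:E)%E.
Proof.
move=> k0; have [K [K0 KE]] := gkernel_integral k0; exists K; split => // Phi mPhi Phi0.
transitivity (\int[mu2]_w \int[mu2]_z (gkernel k z w * Phi w)%:E)%E.
  apply: (area_tonelli (f := fun zw : plane * plane => (gkernel k zw.1 zw.2 * Phi zw.2)%:E)).
    apply/measurable_EFinP; apply: measurable_funM; first exact: gkernel_measurable.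
    exact: (measurableT_comp mPhi measurable_snd).
  by move=> zw; rewrite lee_fin mulr_ge0// gkernel_ge0.
rewrite -ge0_integralZ_real ?(ltW K0)//; apply: eq_integral => w _.
under eq_integral => z _ do rewrite mulrC.
rewrite ge0_integralZ_real//; last 2 first.
- exact: gkernel_measurable1.
- by move=> z _; rewrite gkernel_ge0.
by rewrite KE mulrC EFinM.
Qed.

End gaussian_kernel.

Lemma powR_le_cancel {R : realType} (p a b : R) : 0 < p -> 0 <= a -> 0 <= b ->
  a `^ p <= b `^ p -> a <= b.
Proof.
move=> p0 a0 b0; rewrite !leNgt; apply: contra => ba.
by apply: gt0_ltr_powR; rewrite ?nnegrE.
Qed.

Section weighted_bounds.
Context {R : realType} (alpha : R).
Hypothesis alpha0 : 0 < alpha.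
Implicit Types f : R[i] -> R[i].
Notation mu2 := ((@lebesgue_measure R) \x (@lebesgue_measure R))%E.
Notation plane := (measurableTypeR R * measurableTypeR R)%type.
Notation cx w := (w.1 +i* w.2).

Lemma fock_weighted_ge0 f z : 0 <= fock_weighted alpha f z.
Proof. by rewrite mulr_ge0 ?normc_ge0 ?expR_ge0. Qed.

Definition Fock_density (p : R) f (w : plane) : R := fock_weighted alpha f (cx w) `^ p.

Lemma Fock_density_ge0 p f w : 0 <= Fock_density p f w.
Proof. exact: powR_ge0. Qed.

Lemma Fock_density_measurable p f : (forall z, ccont_at f z) ->
  measurable_fun setT (Fock_density p f).
Proof.
move=> cf; apply: (@measurableT_comp _ _ _ _ _ _ (fun x : R => x `^ p)).
  exact: measurable_realfun.measurable_powR.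
apply: measurable_funM; first exact: (continuous_plane_measurable (ccont_plane cf)).
apply: measurableT_comp => //; apply: measurable_funM => //; apply: measurable_funX.
exact: (continuous_plane_measurable (ccont_plane (@ccont_at_id R))).
Qed.

(* |exp (tilt z0 * z)| = exp (- alpha * Re (z * conj z0)), so this factor turns the
   Fock weight at [z] into a weight in [|z - z0|], bounded on the unit disc. *)
Definition tilt (z0 : R[i]) : R[i] := (- alpha * complex.Re z0) +i* (alpha * complex.Im z0).

Lemma normc_tilted f z0 z : normc (f z * cexp (tilt z0 * z)) =
  fock_weighted alpha f z *
    expR (alpha / 2 * normc (z - z0) ^+ 2 - alpha / 2 * normc z0 ^+ 2).
Proof.
rewrite normcM normc_cexp /fock_weighted -[RHS]mulrA -expRD; congr (_ * expR _).
rewrite !normc_sqr /tilt; case: z z0 => [x y] [a b] /=.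
by field.
Qed.

Definition wlC (p : R) : R := 4 `^ p / lpc p ^+ 2 * expR (alpha / 2) `^ p.

Lemma wlC_ge0 p : 0 <= wlC p.
Proof. by rewrite mulr_ge0 ?powR_ge0// divr_ge0 ?powR_ge0 ?sqr_ge0. Qed.

Lemma weighted_local_Lp f z0 (p : R) : 0 < p -> (forall z, hol_at f z) ->
  ((fock_weighted alpha f z0 `^ p)%:E <=
    (wlC p)%:E * \int[mu2]_(w in disc z0) (Fock_density p f w)%:E)%E.
Proof.
move=> p0 hf.
have hF z : hol_at (fun z => f z * cexp (tilt z0 * z)) z.
  by apply: hol_atM => //; exact: cexp_lin_hol.
have := local_Lp z0 p0 hF.
(* [E] collects the factor of [normc_tilted] that does not depend on [z]; it appears on both sides
   and is cancelled at the end. *)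
set E := expR (- (alpha / 2 * normc z0 ^+ 2)) `^ p.
have E0 : 0 < E by apply: powR_gt0; exact: expR_gt0.
have hf' z := hol_at_ccont (hf z).
have -> : normc (f z0 * cexp (tilt z0 * z0)) `^ p = fock_weighted alpha f z0 `^ p * E.
  rewrite normc_tilted subrr normc0E expr0n mulr0 sub0r powRM ?expR_ge0//.
  exact: fock_weighted_ge0.
have h : (\int[mu2]_(w in disc z0) (normc (f (cx w) * cexp (tilt z0 * cx w)) `^ p)%:E <=
   (expR (alpha / 2) `^ p * E)%:E * \int[mu2]_(w in disc z0) (Fock_density p f w)%:E)%E.
  have md := disc_measurable z0.
  rewrite -ge0_integralZ_real//; first last.
  - by move=> w _; exact: Fock_density_ge0.
  - exact: measurable_funTS (Fock_density_measurable p hf').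
  - by rewrite mulr_ge0 ?powR_ge0.
  apply: ge0_le_integral_real => //.
  - by move=> w _; exact: powR_ge0.
  - exact: measurable_funTS (normc_powR_measurable p (fun z => hol_at_ccont (hF z))).
  - apply: measurable_funM => //.
    exact: measurable_funTS (Fock_density_measurable p hf').
  - move=> w dw; rewrite normc_tilted powRM ?fock_weighted_ge0 ?expR_ge0// mulrC.
    rewrite ler_wpM2r ?powR_ge0// /E -powRM ?expR_ge0//.
    apply: ge0_ler_powR; rewrite ?nnegrE ?(ltW p0) ?mulr_ge0 ?expR_ge0//.
    rewrite -expRD ler_expR lerD2r// ler_piMr ?divr_ge0 ?(ltW alpha0)//.
    by rewrite expr_le1 ?normc_ge0//; exact: ltW.
move=> /le_trans/(_ (lee_wpmul2l _ h)) H.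
have {H} := H ltac:(by rewrite lee_fin divr_ge0 ?powR_ge0 ?sqr_ge0).
have I0 : (0 <= \int[mu2]_(w in disc z0) (Fock_density p f w)%:E)%E.
  by apply: integral_ge0 => w _; rewrite lee_fin Fock_density_ge0.
have aux (a b c : R) (I : \bar R) : (a%:E * ((b * c)%:E * I) = c%:E * ((a * b)%:E * I))%E.
  by rewrite !muleA -!EFinM mulrA mulrC.
have cancel (x e : R) (Y : \bar R) : 0 < e -> ((x * e)%:E <= e%:E * Y)%E -> (x%:E <= Y)%E.
  by move=> e0; rewrite EFinM muleC lee_pmul2l.
by rewrite aux -/(wlC p); exact: cancel E0.
Qed.

(* Half of the available decay [p * alpha / 2] is kept for [eps] below; the rest is
   halved again by [(1 + x)^2 <= 2 + 2 * x^2] in [gkernel_disc]. *)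
Definition kap (p : R) : R := p * alpha / 8.

Lemma kap_gt0 p : 0 < p -> 0 < kap p.
Proof. by move=> p0; rewrite !mulr_gt0. Qed.

Definition gavg (p : R) f (z : plane) : \bar R :=
  (\int[mu2]_w (gkernel (kap p) z w * Fock_density p f w)%:E)%E.

Lemma gavg_ge0 p f z : (0 <= gavg p f z)%E.
Proof.
by apply: integral_ge0 => w _; rewrite lee_fin mulr_ge0 ?gkernel_ge0 ?Fock_density_ge0.
Qed.

(** The point [w] is within 1 of [s z], hence within [1 + (1 - s) |z|] of [z], and
    [(1 - s)^2 <= 1 - s^2]: the decay factor pays for recentering the Gaussian at [z]. *)
Lemma gkernel_disc p (s : R) (z w : plane) : 0 < p -> 0 <= s <= 1 -> disc (s%:C * cx z) w ->
  expR (- (2 * kap p) * ((1 - s ^+ 2) * normc (cx z) ^+ 2)) <=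
  expR (2 * kap p) * gkernel (kap p) z w.
Proof.
move=> p0 /andP[s0 s1] dw; have k0 := kap_gt0 p0.
rewrite /gkernel -expRD ler_expR.
have -> : (w.1 - z.1) ^+ 2 + (w.2 - z.2) ^+ 2 = normc (cx w - cx z) ^+ 2 by rewrite normc_sqr.
have h1 : normc (cx w - cx z) <= 1 + (1 - s) * normc (cx z).
  have -> : cx w - cx z = (cx w - s%:C * cx z) + (s - 1)%:C * cx z by rewrite rmorphB/=; ring.
  rewrite (le_trans (le_normcD _ _))// lerD//; first exact: ltW.
  by rewrite normcM normc_real distrC ger0_norm// subr_ge0.
have n0 := normc_ge0 (cx w - cx z); have m0 := normc_ge0 (cx z).
move: h1 n0 m0; move: (normc (cx w - cx z)) (normc (cx z)) => n m h1 n0 m0.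
have h2 : n ^+ 2 <= 2 + 2 * ((1 - s ^+ 2) * m ^+ 2).
  have t0 : 0 <= (1 - s) * m by rewrite mulr_ge0// subr_ge0.
  have h3 : n ^+ 2 <= (1 + (1 - s) * m) ^+ 2 by rewrite lerXn2r// nnegrE// addr_ge0.
  apply: (le_trans h3); have h4 : ((1 - s) * m) ^+ 2 <= (1 - s ^+ 2) * m ^+ 2.
    by rewrite exprMn ler_wpM2r ?sqr_ge0//; nra.
  apply: (@le_trans _ _ (2 + 2 * ((1 - s) * m) ^+ 2)); last by rewrite lerD2l ler_wpM2l.
  by move: ((1 - s) * m) t0 => t t0; have := sqr_ge0 (1 - t); rewrite !expr2; nra.
move: (kap p) k0 (n ^+ 2) ((1 - s ^+ 2) * m ^+ 2) h2; clear => k k0 a b h2.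
by nra.
Qed.

(** The right-hand side is free of [s]: one average at [z] controls [f] on the whole segment from 0
    to [z]. *)
Lemma weighted_kernel_bound f p (s : R) (z : plane) : 0 < p -> (forall z, hol_at f z) ->
  0 <= s <= 1 ->
  ((fock_weighted alpha f (s%:C * cx z) `^ p *
     expR (- (2 * kap p) * ((1 - s ^+ 2) * normc (cx z) ^+ 2)))%:E <=
   (wlC p * expR (2 * kap p))%:E * gavg p f z)%E.
Proof.
move=> p0 hf s01; have mf := Fock_density_measurable p (fun z => hol_at_ccont (hf z)).
have md := disc_measurable (s%:C * cx z).
set Dz := disc (s%:C * cx z) in md *.
set e := expR (- (2 * kap p) * _).
have e0 : 0 <= e by exact: expR_ge0.
have h1 := weighted_local_Lp (s%:C * cx z) p0 hf.
have h2 : (e%:E * \int[mu2]_(w in Dz) (Fock_density p f w)%:E <=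
    (expR (2 * kap p))%:E * gavg p f z)%E.
  rewrite -ge0_integralZ_real//; last 2 first.
  - exact: measurable_funTS mf.
  - by move=> w _; exact: Fock_density_ge0.
  rewrite /gavg -ge0_integralZ_real ?expR_ge0//; last 2 first.
  - by apply: measurable_funM => //; exact: gkernel_measurable2.
  - by move=> w _; rewrite mulr_ge0 ?gkernel_ge0 ?Fock_density_ge0.
  apply: (@le_trans _ _ (\int[mu2]_(w in Dz)
      (expR (2 * kap p) * (gkernel (kap p) z w * Fock_density p f w))%:E)%E).
    apply: ge0_le_integral_real => //.
    - by move=> w _; rewrite mulr_ge0 ?Fock_density_ge0.
    - by apply: measurable_funM => //; exact: measurable_funTS mf.
    - apply: measurable_funM => //; apply: measurable_funM; apply: measurable_funTS => //.
      exact: gkernel_measurable2.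
    - move=> w dw; rewrite mulrA ler_wpM2r ?Fock_density_ge0//.
      exact: gkernel_disc.
  apply: ge0_subset_integral => //.
  - apply/measurable_EFinP; apply: measurable_funM => //; apply: measurable_funM => //.
    exact: gkernel_measurable2.
  - by move=> w _; rewrite lee_fin !mulr_ge0 ?expR_ge0 ?gkernel_ge0 ?Fock_density_ge0.
rewrite mulrC EFinM; apply: le_trans (lee_wpmul2l _ h1) _; first by rewrite lee_fin.
have w0 : (0 <= (wlC p)%:E)%E by rewrite lee_fin wlC_ge0.
by rewrite muleCA (EFinM (wlC p)) -muleA; exact: (lee_wpmul2l w0 h2).
Qed.

(** The interface between the norms and the operator: [m] is a global bound of the weighted modulus
    when [p] is infinite, and [radial_max] otherwise. The weight on the left is that of [z], not of
    [s z]; the exponent [alpha / 4] on the right is the half of the decay left for [eps]. *)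
Definition radial_dominated f z (m : R) := forall s : R, 0 <= s <= 1 ->
  normc (f (s%:C * z)) * expR (- (alpha / 2) * normc z ^+ 2) <=
  expR (- (alpha / 4) * ((1 - s ^+ 2) * normc z ^+ 2)) * m.

Lemma fock_weighted_dilate f (s : R) z :
  normc (f (s%:C * z)) * expR (- (alpha / 2) * normc z ^+ 2) =
  fock_weighted alpha f (s%:C * z) * expR (- (alpha / 2) * ((1 - s ^+ 2) * normc z ^+ 2)).
Proof.
rewrite /fock_weighted -mulrA -expRD; congr (_ * expR _).
by rewrite normcM normc_real exprMn real_normK ?num_real//; ring.
Qed.

Lemma radial_dominated_sup f z B : (forall w, fock_weighted alpha f w <= B) ->
  radial_dominated f z B.
Proof.
move=> fB s /andP[s0 s1]; rewrite fock_weighted_dilate mulrC.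
have B0 : 0 <= B by apply: le_trans (fB 0); exact: fock_weighted_ge0.
apply: ler_pM; rewrite ?expR_ge0 ?fock_weighted_ge0//.
rewrite ler_expR ler_wpM2r//.
  by rewrite mulr_ge0 ?sqr_ge0// subr_ge0 expr_le1.
by move: alpha0; lra.
Qed.

(** [fine] sends an infinite average to 0, so this is a meaningful majorant only where [gavg] is
    finite. *)
Definition radial_max p f (z : plane) : R :=
  (wlC p * expR (2 * kap p) * fine (gavg p f z)) `^ p^-1.

Lemma radial_max_ge0 p f z : 0 <= radial_max p f z.
Proof. exact: powR_ge0. Qed.

Lemma radial_max_powR p f z : 0 < p ->
  radial_max p f z `^ p = wlC p * expR (2 * kap p) * fine (gavg p f z).
Proof.
move=> p0; rewrite -powRrM mulVf ?gt_eqF// powRr1//.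
by rewrite mulr_ge0 ?fine_ge0 ?gavg_ge0// mulr_ge0 ?expR_ge0 ?wlC_ge0.
Qed.

Lemma radial_dominated_max p f z : 0 < p -> (forall z, hol_at f z) ->
  (gavg p f z < +oo)%E -> radial_dominated f (cx z) (radial_max p f z).
Proof.
move=> p0 hf goo s s01; have := weighted_kernel_bound z p0 hf s01.
have gfin : gavg p f z \is a fin_num by rewrite ge0_fin_numE// gavg_ge0.
rewrite -(fineK gfin) -EFinM lee_fin -radial_max_powR// => h.
rewrite fock_weighted_dilate.
set b := (1 - s ^+ 2) * normc (cx z) ^+ 2 in h *.
have {}h : (fock_weighted alpha f (s%:C * cx z) * expR (- (alpha / 4) * b)) `^ p <=
    radial_max p f z `^ p.
  rewrite powRM ?fock_weighted_ge0 ?expR_ge0//.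
  have -> : expR (- (alpha / 4) * b) `^ p = expR (- (2 * kap p) * b).
    by rewrite -expRM; congr expR; rewrite /kap; field.
  exact: h.
have -> : expR (- (alpha / 2) * b) = expR (- (alpha / 4) * b) * expR (- (alpha / 4) * b).
  by rewrite -expRD; congr expR; field.
rewrite mulrA mulrC ler_wpM2l ?expR_ge0//.
apply: (powR_le_cancel p0) h; last exact: radial_max_ge0.
by rewrite mulr_ge0 ?fock_weighted_ge0 ?expR_ge0.
Qed.

End weighted_bounds.

(** * The Hausdorff operator of a measure carried by ]1, +oo[ *)

Section hausdorff_estimates.
Context {R : realType} (mu : {measure set (measurableTypeR R) -> \bar R}).
Hypothesis hmu : (\int[mu]_(t in `]0%R, +oo[%classic) (t^-1)%:E = 1)%E.
Hypothesis mu01 : mu `]0%R, 1%R]%classic = 0%E.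
Implicit Types f G : R[i] -> R[i].
Notation D := (`]0%R, +oo[%classic : set (measurableTypeR R)).
Notation N01 := (`]0%R, 1%R]%classic : set (measurableTypeR R)).
Notation D1 := (`]1%R, +oo[%classic : set (measurableTypeR R)).

Lemma measurable_D : measurable D. Proof. exact: measurable_itv. Qed.
Lemma measurable_D1 : measurable D1. Proof. exact: measurable_itv. Qed.
Local Hint Resolve measurable_D measurable_D1 : core.

Lemma D_setD : D `\` N01 = D1.
Proof.
apply/seteqP; split => t /=; rewrite !in_itv/= !andbT.
- by move=> [t0 /negP]; rewrite t0/= -ltNge.
- by move=> t1; split; [rewrite (lt_trans _ t1)|apply/negP; rewrite negb_and -!ltNge t1 orbT].
Qed.

Lemma integrable_D (g : R -> R) : measurable_fun D g ->
  mu.-integrable D (EFin \o g) <-> mu.-integrable D1 (EFin \o g).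
Proof.
move=> mg; rewrite -D_setD; apply: negligible_integrable => //.
exact/measurable_EFinP.
Qed.

Lemma Rintegral_D (g : R -> R) : mu.-integrable D (EFin \o g) ->
  \int[mu]_(t in D) g t = \int[mu]_(t in D1) g t.
Proof.
move=> ig; rewrite /Rintegral -D_setD (@negligible_integral _ _ _ mu D N01)//.
Qed.

(** The integrands to come are uncontrolled near [t = 0], where [z / t] leaves every disc; the bound
    is imposed only off the null set. *)
Lemma null_dominated (g h : R -> R) : measurable_fun D g ->
  mu.-integrable D1 (EFin \o h) -> (forall t, 1 < t -> `|g t| <= h t) ->
  mu.-integrable D (EFin \o g) /\ `|\int[mu]_(t in D) g t| <= \int[mu]_(t in D1) h t.
Proof.
move=> mg ih gh.
have D1P t : D1 t -> 1 < t by rewrite /= in_itv/= andbT.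
have ig1 : mu.-integrable D1 (EFin \o g).
  apply: le_integrable ih => //.
  - apply/measurable_EFinP; apply: measurable_funS mg => //.
    by rewrite -D_setD; exact: subDsetl.
  - move=> t /D1P t1; rewrite /= lee_fin (le_trans (gh _ t1))//.
    exact: ler_norm.
have ig := (integrable_D mg).2 ig1; split => //.
rewrite (Rintegral_D ig) (le_trans (le_normr_Rintegral measurable_D1 ig1))//.
apply: le_Rintegral => //.
- exact: (integrable_norm ig1).
- by move=> t /D1P; exact: gh.
Qed.

Lemma inv_measurable : measurable_fun D (fun t : R => t^-1).
Proof.
apply: open_continuous_measurable_fun; first exact: interval_open.
by move=> t; rewrite inE /= in_itv /= andbT => t0; apply: inv_continuous; rewrite gt_eqF.
Qed.

Lemma comp_inv_measurable (psi : R -> R) : continuous psi -> measurable_fun D (fun t => psi t^-1).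
Proof.
move=> cpsi; apply: (@measurableT_comp _ _ _ _ _ _ psi).
  exact: continuous_measurable_fun.
exact: inv_measurable.
Qed.

Lemma inv_integrable : mu.-integrable D (EFin \o (fun t => t^-1)).
Proof.
apply/integrableP; split.
  by apply/measurable_EFinP; exact: inv_measurable.
suff -> : (\int[mu]_(t in D) `|(t^-1)%:E| = 1)%E by rewrite ltry.
apply: etrans hmu; apply: eq_integral => t; rewrite inE /= in_itv /= andbT => t0.
by rewrite /= ger0_norm// invr_ge0 ltW.
Qed.

Lemma inv_integrable1 (B : R) : mu.-integrable D1 (EFin \o (fun t => B * t^-1)).
Proof.
rewrite (_ : EFin \o _ = (fun t => B%:E * (t^-1)%:E)%E).
  by apply: integrableZl => //; apply/(integrable_D inv_measurable); exact: inv_integrable.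
by apply/funext => t /=; rewrite EFinM.
Qed.

Lemma Rintegral_inv (B : R) : \int[mu]_(t in D1) (B * t^-1) = B.
Proof.
rewrite RintegralZl//.
  rewrite -(Rintegral_D inv_integrable) /Rintegral hmu mulr1//.
exact/(integrable_D inv_measurable)/inv_integrable.
Qed.

Lemma comp_inv_bound (psi : R -> R) (B : R) : continuous psi ->
  (forall s, 0 < s < 1 -> `|psi s| <= B * s) ->
  mu.-integrable D (EFin \o (fun t => psi t^-1)) /\
  `|\int[mu]_(t in D) psi t^-1| <= B.
Proof.
move=> cpsi psiB; rewrite -[X in _ /\ _ <= X](Rintegral_inv B).
apply: null_dominated.
- exact: comp_inv_measurable.
- exact: inv_integrable1.
- move=> t t1; apply: psiB; have t0 : 0 < t by rewrite (lt_trans _ t1).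
  by rewrite invr_gt0 t0 invf_lt1.
Qed.

(* [G] is evaluated at [s = 1 / t]; only [0 < s < 1] matters when [mu] does not
   charge ]0, 1]. *)
Definition cI G : R[i] := cintegral mu D (fun t => G (t^-1)%:C).

(** The factor [s] is the [1/t] whose integral is 1; [mu] itself may have infinite mass. *)
Definition bounded01 G := exists B, forall s : R, 0 < s < 1 -> normc (G s%:C) <= B * s.

Lemma real_line_pcont G : (forall z, ccont_at G z) -> pcont (fun s : R => G s%:C).
Proof.
move=> cG; have := @ccont_line _ G 0 1 (fun t => cG _).
by under eq_fun do rewrite add0r mulr1.
Qed.

Lemma cI_integrable G : (forall z, ccont_at G z) -> bounded01 G ->
  cintegrable mu D (fun t => G (t^-1)%:C).
Proof.
move=> /real_line_pcont[cr ci] [B GB]; split.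
- apply: (@comp_inv_bound (fun s => complex.Re (G s%:C)) B cr _).1 => s /GB.
  exact/le_trans/normc_Re.
- apply: (@comp_inv_bound (fun s => complex.Im (G s%:C)) B ci _).1 => s /GB.
  exact/le_trans/normc_Im.
Qed.

Lemma cI_bound G B : (forall z, ccont_at G z) ->
  (forall s : R, 0 < s < 1 -> normc (G s%:C) <= B * s) -> normc (cI G) <= 2 * B.
Proof.
move=> /real_line_pcont[cr ci] GB.
rewrite (le_trans (normc_le_ReIm _))// mulr_natl mulr2n lerD//=.
- apply: (@comp_inv_bound (fun s => complex.Re (G s%:C)) B cr _).2 => s /GB.
  exact/le_trans/normc_Re.
- apply: (@comp_inv_bound (fun s => complex.Im (G s%:C)) B ci _).2 => s /GB.
  exact/le_trans/normc_Im.
Qed.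

Lemma cID G1 G2 : (forall z, ccont_at G1 z) -> bounded01 G1 ->
  (forall z, ccont_at G2 z) -> bounded01 G2 ->
  cI (fun z => G1 z + G2 z) = cI G1 + cI G2.
Proof.
move=> c1 b1 c2 b2; have [r1 i1] := cI_integrable c1 b1; have [r2 i2] := cI_integrable c2 b2.
rewrite /cI /cintegral; apply/eqP; rewrite eq_complex /=; apply/andP; split; apply/eqP.
- rewrite -RintegralD//; apply: eq_Rintegral => t _.
  by case: (G1 _) (G2 _) => [? ?] [? ?].
- rewrite -RintegralD//; apply: eq_Rintegral => t _.
  by case: (G1 _) (G2 _) => [? ?] [? ?].
Qed.

Lemma cIZ c G : (forall z, ccont_at G z) -> bounded01 G ->
  cI (fun z => c * G z) = c * cI G.
Proof.
move=> c1 b1; have [r1 i1] := cI_integrable c1 b1.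
rewrite /cI /cintegral; apply/eqP; rewrite eq_complex; case: c => a b /=.
apply/andP; split; apply/eqP.
- rewrite -!RintegralZl// -RintegralB//; last 2 first.
  + exact: integrableZl r1.
  + exact: integrableZl i1.
  by apply: eq_Rintegral => t _; case: (G _).
- rewrite -!RintegralZl// -RintegralD//; last 2 first.
  + exact: integrableZl i1.
  + exact: integrableZl r1.
  by apply: eq_Rintegral => t _; case: (G _).
Qed.

(** The integrand after the substitution [u = 1/t], with [u] complex so that the results on
    functions of a complex variable apply. *)
Definition hG f z (u : R[i]) : R[i] := f (u * z) * u.

Lemma hausdorff_opE f z : hausdorff_op mu f z = cI (hG f z).
Proof.
rewrite /hausdorff_op /cI; congr (cintegral mu D _); apply/funext => t.
by rewrite /hausdorff_integrand /hG fmorphV/= mulrC mulrC [z / _]mulrC mulrC.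
Qed.

End hausdorff_estimates.

Section hausdorff_bounds.
Context {R : realType} (mu : {measure set (measurableTypeR R) -> \bar R}).
Hypothesis hmu : (\int[mu]_(t in `]0%R, +oo[%classic) (t^-1)%:E = 1)%E.
Hypothesis mu01 : mu `]0%R, 1%R]%classic = 0%E.
Context (alpha : R).
Hypothesis alpha0 : 0 < alpha.
Implicit Types f : R[i] -> R[i].
Notation D := (`]0%R, +oo[%classic : set (measurableTypeR R)).
Notation D1 := (`]1%R, +oo[%classic : set (measurableTypeR R)).
Notation H := (hausdorff_op mu).

Lemma ccont_at_dilate f z u : ccont_at f (u * z) -> ccont_at (fun u => f (u * z)) u.
Proof.
move=> cf e e0; have [r r0 rP] := cf e e0.
have z1 : 0 < normc z + 1 by rewrite ltr_wpDl ?normc_ge0.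
exists (r / (normc z + 1)); first by rewrite divr_gt0.
move=> h; rewrite ltr_pdivlMr// => hr; rewrite mulrDl; apply: rP.
by rewrite normcM (le_lt_trans _ hr)// ler_wpM2l ?normc_ge0// lerDl.
Qed.

Lemma hG_ccont f z u : (forall z, ccont_at f z) -> ccont_at (hG f z) u.
Proof.
by move=> cf; apply: ccont_atM; [exact: ccont_at_dilate|exact: ccont_at_id].
Qed.

Lemma cderiv_ccont f d : (forall z, hol_at f z) -> (forall z, has_cderiv f z (d z)) ->
  forall z, ccont_at d z.
Proof.
move=> hf fd z e e0.
have [M [M0 fM]] := ccont_bounded (normc z + 8) (fun z => hol_at_ccont (hf z)).
have fM8 y : normc (y - z) <= 8 * 1 -> normc (f y) <= M.
  move=> yz; apply: fM; rewrite -(subrK z y) (le_trans (le_normcD _ _))// addrC.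
  by rewrite lerD2l -[leRHS]mulr1.
pose K := 16 * (16 * M / 1) / 1.
have K1 : 0 < `|K| + 1 by rewrite ltr_wpDl.
exists (Num.min 1 (e / (`|K| + 1))); first by rewrite lt_min ltr01 divr_gt0.
move=> h; rewrite lt_min => /andP[/ltW h1]; rewrite ltr_pdivlMr// => he.
have zh : normc (z + h - z) <= 1 by rewrite addrAC subrr add0r.
have := cderiv_lip hf ltr01 fM8 zh (fd z) (fd (z + h)).
rewrite -/K addrAC subrr add0r => /le_trans; apply; apply: le_trans (ltW he).
by rewrite mulrC ler_wpM2l ?normc_ge0// (le_trans (ler_norm _))// lerDl.
Qed.

Lemma hG_bound f z B : (forall s : R, 0 <= s <= 1 -> normc (f (s%:C * z)) <= B) ->
  forall s : R, 0 < s < 1 -> normc (hG f z s%:C) <= B * s.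
Proof.
move=> fB s /andP[s0 s1]; rewrite normcM normc_real gtr0_norm// ler_wpM2r ?(ltW s0)//.
by rewrite fB// (ltW s0) (ltW s1).
Qed.

Lemma radial_bound f z : (forall z, ccont_at f z) ->
  exists B, forall s : R, 0 <= s <= 1 -> normc (f (s%:C * z)) <= B.
Proof.
move=> /(ccont_bounded (normc z))[M [M0 fM]]; exists M => s /andP[s0 s1]; apply: fM.
by rewrite normcM normc_real ger0_norm// ler_piMl ?normc_ge0.
Qed.

Lemma hG_bounded01 f z : (forall z, ccont_at f z) -> bounded01 (hG f z).
Proof. by move=> /(radial_bound z)[B fB]; exists B; exact: hG_bound. Qed.

Lemma hausdorff_integrable f z : (forall z, ccont_at f z) ->
  cintegrable mu D (hausdorff_integrand f z).
Proof.
move=> cf; have [] := cI_integrable hmu mu01 (fun u => hG_ccont z u cf) (hG_bounded01 z cf).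
have E : (fun t : R => hG f z (t^-1)%:C) = hausdorff_integrand f z.
  apply/funext => t; rewrite /hausdorff_integrand /hG fmorphV/=.
  by rewrite [_^-1 * z]mulrC.
by rewrite -E.
Qed.

Lemma hausdorff_sup f z B : (forall z, ccont_at f z) ->
  (forall s : R, 0 <= s <= 1 -> normc (f (s%:C * z)) <= B) -> normc (H f z) <= 2 * B.
Proof.
move=> cf fB; rewrite hausdorff_opE; apply: cI_bound => //.
- by move=> u; exact: hG_ccont.
- exact: hG_bound.
Qed.

(** The candidate derivative is the integral of the derivative of the integrand, [s^2 d (s z)]. The
    Taylor remainder is uniform in [0 < s < 1], since [s z] stays in a fixed disc, and [cI_bound]
    integrates it. *)
Lemma hausdorff_hol f z : (forall z, hol_at f z) -> hol_at (H f) z.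
Proof.
move=> hf; have [d fd] := choice hf.
have cf y : ccont_at f y by exact: hol_at_ccont.
have cd := cderiv_ccont hf fd.
pose G' u := u * hG d z u.
have cG' u : ccont_at G' u by apply: ccont_atM; [exact: ccont_at_id|exact: hG_ccont].
have bG' : bounded01 G'.
  have [B dB] := radial_bound z cd; exists B => s s01.
  have := hG_bound dB s01; apply: le_trans; rewrite normcM normc_real.
  move: s01 => /andP[s0 s1].
  by rewrite gtr0_norm// ler_piMl ?normc_ge0// ltW.
exists (cI mu G').
have [M [M0 fM]] := ccont_bounded (normc z + 8) cf.
pose K := 2 * (16 * (16 * M / 1) / 1).
have K0 : 0 <= K.
  do 2 (apply: mulr_ge0 => //; apply: divr_ge0 => //).
  exact: mulr_ge0.
apply: (@taylor2_has_cderiv _ _ _ _ (2 * K)) => h h1.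
have -> : H f (z + h) - H f z - cI mu G' * h =
    cI mu (fun u => (hG f (z + h) u + (- 1) * hG f z u) + (- h) * G' u).
  have b1 : bounded01 (fun u => hG f (z + h) u + (- 1) * hG f z u).
    have [B1 B1P] := hG_bounded01 (z + h) cf; have [B2 B2P] := hG_bounded01 z cf.
    exists (B1 + B2) => s s01; rewrite (le_trans (le_normcD _ _))// mulrDl lerD ?B1P//.
    by rewrite mulN1r normcN B2P.
  have b2 : bounded01 (fun u => - h * G' u).
    have [B BP] := bG'; exists (normc h * B) => s s01.
    by rewrite normcM normcN -mulrA ler_wpM2l ?normc_ge0// BP.
  have b3 : bounded01 (fun u => - 1 * hG f z u).
    have [B BP] := hG_bounded01 z cf; exists B => s s01.
    by rewrite mulN1r normcN BP.
  have c3 u : ccont_at (fun u => - 1 * hG f z u) u.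
    by apply: ccont_atM; [exact: ccont_at_cst|exact: hG_ccont].
  have c2 u : ccont_at (fun u => - h * G' u) u.
    by apply: ccont_atM; [exact: ccont_at_cst|exact: cG'].
  have c1 u : ccont_at (fun u => hG f (z + h) u + (- 1) * hG f z u) u.
    by apply: ccont_atD; [exact: hG_ccont|exact: c3].
  rewrite cID// cID//; last 2 first.
  - by move=> u; exact: hG_ccont.
  - exact: hG_bounded01.
  rewrite (cIZ hmu mu01 (- h) cG' bG') (cIZ hmu mu01 (- 1)); last 2 first.
  - by move=> u; exact: hG_ccont.
  - exact: hG_bounded01.
  by rewrite !hausdorff_opE mulN1r mulNr [h * _]mulrC.
rewrite -mulrA; apply: cI_bound => //.
  move=> u; apply: ccont_atD; last by apply: ccont_atM; [exact: ccont_at_cst|exact: cG'].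
  apply: ccont_atD; first exact: hG_ccont.
  by apply: ccont_atM; [exact: ccont_at_cst|exact: hG_ccont].
move=> s /andP[s0 s1].
have -> : hG f (z + h) s%:C + (- 1) * hG f z s%:C + (- h) * G' s%:C =
   (f (s%:C * z + s%:C * h) - f (s%:C * z) - d (s%:C * z) * (s%:C * h)) * s%:C.
  by rewrite /G' /hG mulrDr; ring.
rewrite normcM normc_real (gtr0_norm s0) ler_wpM2r ?(ltW s0)//.
have sh : normc (s%:C * h) <= normc h.
  by rewrite normcM normc_real gtr0_norm// ler_piMl ?normc_ge0// ltW.
have fM8 y : normc (y - s%:C * z) <= 8 * 1 -> normc (f y) <= M.
  move=> yz; apply: fM; rewrite -(subrK (s%:C * z) y) (le_trans (le_normcD _ _))// addrC.
  rewrite lerD//; last by rewrite -[leRHS]mulr1.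
  by rewrite normcM normc_real gtr0_norm// ler_piMl ?normc_ge0// ltW.
apply: (le_trans (taylor2 hf ltr01 fM8 (le_trans sh h1) (fd _))).
by rewrite [leLHS]mulrA -/K; apply: ler_wpM2l => //; rewrite lerXn2r ?nnegrE ?normc_ge0.
Qed.

(** The average over [s = 1/t] of the half of the decay left by [radial_dominated]: up to a factor
    2, the gain of the operator at radius [r]. *)
Definition eps (r : R) : R :=
  \int[mu]_(t in D1) (expR (- (alpha / 4) * ((1 - t^-1 ^+ 2) * r ^+ 2)) * t^-1).

Lemma eps_continuous (r : R) :
  continuous (fun s : R => expR (- (alpha / 4) * ((1 - s ^+ 2) * r ^+ 2)) * s).
Proof.
move=> s; apply: cvgM; last exact: cvg_id.
apply: (@continuous_comp _ _ _ (fun s : R => - (alpha / 4) * ((1 - s ^+ 2) * r ^+ 2)) expR).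
  apply: cvgM; first exact: cvg_cst.
  apply: cvgM; last exact: cvg_cst.
  by apply: cvgB; [exact: cvg_cst|exact: exprn_continuous].
exact: continuous_expR.
Qed.

Lemma eps_integrand_le (r s : R) : 0 < s < 1 ->
  0 <= expR (- (alpha / 4) * ((1 - s ^+ 2) * r ^+ 2)) * s <= s.
Proof.
move=> /andP[s0 s1]; rewrite mulr_ge0 ?expR_ge0 ?(ltW s0)//= ler_piMl ?(ltW s0)//.
rewrite -[leRHS]expR0 ler_expR mulNr oppr_le0 mulr_ge0 ?divr_ge0 ?(ltW alpha0)//.
by rewrite mulr_ge0 ?sqr_ge0// subr_ge0 expr_le1// ltW.
Qed.

Lemma inv_01 (t : R) : 1 < t -> 0 < t^-1 < 1.
Proof. by move=> t1; have t0 := lt_trans ltr01 t1; rewrite invr_gt0 t0 invf_lt1. Qed.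

Lemma eps_integrable (r : R) : mu.-integrable D1
  (EFin \o (fun t => expR (- (alpha / 4) * ((1 - t^-1 ^+ 2) * r ^+ 2)) * t^-1)).
Proof.
apply/(integrable_D mu01 (comp_inv_measurable (eps_continuous (r := r)))).
apply: (comp_inv_bound hmu mu01 (B := 1) (eps_continuous (r := r)) _).1 => s s01.
by have /andP[h1 h2] := eps_integrand_le r s01; rewrite ger0_norm// mul1r.
Qed.

Lemma D1P t : D1 t -> 1 < t.
Proof. by rewrite /= in_itv/= andbT. Qed.

Lemma eps_ge0 r : 0 <= eps r.
Proof.
apply: Rintegral_ge0 => t /D1P/inv_01 h.
by have /andP[] := eps_integrand_le r h.
Qed.

Lemma eps_le1 r : eps r <= 1.
Proof.
rewrite -(Rintegral_inv hmu mu01 1); apply: le_Rintegral.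
- exact: measurable_itv.
- exact: eps_integrable.
- exact: inv_integrable1.
- by move=> t /D1P/inv_01 h; rewrite mul1r; have /andP[] := eps_integrand_le r h.
Qed.

Lemma eps_mono r r' : 0 <= r -> r <= r' -> eps r' <= eps r.
Proof.
move=> r0 rr; apply: le_Rintegral.
- exact: measurable_itv.
- exact: eps_integrable.
- exact: eps_integrable.
- move=> t /D1P/inv_01/andP[h1 h2]; rewrite ler_wpM2r ?(ltW h1)// ler_expR !mulNr lerN2.
  rewrite ler_wpM2l ?divr_ge0 ?(ltW alpha0)// ler_wpM2l//.
    by rewrite subr_ge0 expr_le1// ltW.
  by rewrite lerXn2r ?nnegrE// (le_trans r0).
Qed.

Lemma hausdorff_weighted f z m : (forall z, ccont_at f z) -> 0 <= m ->
  radial_dominated alpha f z m ->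
  fock_weighted alpha (H f) z <= 2 * (eps (normc z) * m).
Proof.
move=> cf m0 dom.
pose E := expR (- (alpha / 2) * normc z ^+ 2).
have E0 : 0 < E by exact: expR_gt0.
pose c := m / E.
have c0 : 0 <= c by rewrite divr_ge0// ltW.
have ih : mu.-integrable D1 (EFin \o (fun t => c *
    (expR (- (alpha / 4) * ((1 - t^-1 ^+ 2) * normc z ^+ 2)) * t^-1))).
  exact: (integrableZl measurable_D1 c (eps_integrable (normc z))).
have hE : \int[mu]_(t in D1) (c *
    (expR (- (alpha / 4) * ((1 - t^-1 ^+ 2) * normc z ^+ 2)) * t^-1)) = c * eps (normc z).
  by rewrite RintegralZl//; exact: eps_integrable.
have bnd t : 1 < t -> normc (hG f z (t^-1)%:C) <=
    c * (expR (- (alpha / 4) * ((1 - t^-1 ^+ 2) * normc z ^+ 2)) * t^-1).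
  move=> /inv_01/andP[h1 h2].
  rewrite normcM normc_real (gtr0_norm h1) mulrA ler_wpM2r ?(ltW h1)//.
  have := dom t^-1; rewrite (ltW h1) (ltW h2) => /(_ isT).
  rewrite -/E -ler_pdivlMr// => /le_trans; apply.
  by rewrite -mulrA [leRHS]mulrC.
have [cr ci] := real_line_pcont (fun u => hG_ccont z u cf).
have h1 : `|complex.Re (H f z)| <= c * eps (normc z).
  rewrite hausdorff_opE -hE; apply: (null_dominated mu01 _ ih _).2.
  - exact: (comp_inv_measurable cr).
  - by move=> t /bnd; exact/le_trans/normc_Re.
have h2 : `|complex.Im (H f z)| <= c * eps (normc z).
  rewrite hausdorff_opE -hE; apply: (null_dominated mu01 _ ih _).2.
  - exact: (comp_inv_measurable ci).
  - by move=> t /bnd; exact/le_trans/normc_Im.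
rewrite /fock_weighted -/E -ler_pdivlMr//.
apply: (le_trans (normc_le_ReIm _)); apply: (le_trans (lerD h1 h2)).
rewrite le_eqVlt; apply/orP; left; apply/eqP; rewrite /c.
by field; rewrite gt_eqF.
Qed.

(** For each [t > 1] the number [1 - 1/t^2] is positive, so the integrand tends to 0, though not
    uniformly near 1; it is dominated by [1/t]. *)
Lemma eps_small (e : R) : 0 < e -> exists2 r, 0 <= r & eps r <= e.
Proof.
move=> e0.
pose F (n : nat) (t : R) := (expR (- (alpha / 4) * ((1 - t^-1 ^+ 2) * n%:R ^+ 2)) * t^-1)%:E.
have := @dominated_convergence _ _ _ mu D1 measurable_D1 F (cst 0%E) (fun t => (1 * t^-1)%:E).
case.
- by move=> n; exact: (measurable_int _ (eps_integrable n%:R)).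
- exact: measurable_cst.
- apply: aeW => t /D1P t1; have /andP[s0 s1] := inv_01 t1.
  apply: cvg_EFin; first by apply: nearW.
  set q := alpha / 4 * (1 - t^-1 ^+ 2).
  have q0 : 0 < q by rewrite mulr_gt0 ?divr_gt0// subr_gt0 expr_lt1// ltW.
  have z1 : `|expR (- q)| < 1.
    by rewrite ger0_norm ?expR_ge0// -expR0 ltr_expR oppr_lt0.
  apply: squeeze_cvgr (cvg_cst _) (cvg_expr z1).
  apply: nearW => n /=; rewrite mulr_ge0 ?expR_ge0 ?(ltW s0)//=.
  apply: (@le_trans _ _ (expR (- (alpha / 4) * ((1 - t^-1 ^+ 2) * n%:R ^+ 2)))).
    by rewrite ler_piMr ?expR_ge0// ltW.
  rewrite -expRM_natr ler_expR !mulNr lerN2 /q -(mulrA (alpha / 4)).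
  rewrite ler_wpM2l ?divr_ge0 ?(ltW alpha0)// ler_wpM2l//.
    by rewrite subr_ge0 expr_le1// ltW.
  by rewrite -natrX ler_nat; case: n => // n; rewrite expnS leq_pmulr.
- exact: inv_integrable1.
- apply: aeW => t n /D1P/inv_01 h; rewrite lee_fin mul1r.
  by have /andP[h1 h2] := eps_integrand_le n%:R h; rewrite ger0_norm.
move=> _ _; rewrite integral0 => /fine_cvgP[_].
move=> /cvgrPdist_le/(_ _ e0)[n _ /(_ n (leqnn n))] /=.
rewrite sub0r normrN => h; exists n%:R => //.
by apply: le_trans h; rewrite ler_norm.
Qed.

End hausdorff_bounds.

(** * Fock norms *)

Section fock_norms.
Context {R : realType} (alpha : R).
Hypothesis alpha0 : 0 < alpha.
Implicit Types f : R[i] -> R[i].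
Notation mu2 := ((@lebesgue_measure R) \x (@lebesgue_measure R))%E.
Notation Norm := (fock_norm alpha).

Definition Fock_integral (r : R) f : \bar R := (\int[mu2]_w (Fock_density alpha r f w)%:E)%E.

Lemma Fock_integral_ge0 r f : (0 <= Fock_integral r f)%E.
Proof. by apply: integral_ge0 => w _; rewrite lee_fin Fock_density_ge0. Qed.

Definition normC (r : R) : R := alpha * r / (2 * pi).

Lemma normC_gt0 r : 0 < r -> 0 < normC r.
Proof. by move=> r0; rewrite divr_gt0 ?mulr_gt0 ?pi_gt0. Qed.

Lemma fock_normE r f : Norm r%:E f = (((normC r)%:E * Fock_integral r f) `^ r^-1)%E.
Proof. by []. Qed.

Lemma fock_norm_ge0 p f : (0 <= Norm p f)%E.
Proof.
case: p => [r||] /=; [exact: poweR_ge0| |by []].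
apply: le_trans (_ : (fock_weighted alpha f 0)%:E <= _)%E; first by rewrite lee_fin fock_weighted_ge0.
by apply: ereal_sup_ubound; exists 0.
Qed.

Lemma fock_norm_fin r f : 0 < r -> (Norm r%:E f < +oo)%E -> (Fock_integral r f < +oo)%E.
Proof.
move=> r0; rewrite fock_normE => /lty_poweRy h.
have {h} : ((normC r)%:E * Fock_integral r f < +oo)%E by apply: h; rewrite invr_eq0 gt_eqF.
by apply: contraTT; rewrite -!leNgt !leye_eq => /eqP ->; rewrite gt0_muley ?lte_fin ?normC_gt0.
Qed.

Lemma fock_norm_le r f (B : R) : 0 < r -> 0 <= B ->
  (Norm r%:E f <= B%:E)%E = (Fock_integral r f <= (B `^ r / normC r)%:E)%E.
Proof.
move=> r0 B0; have c0 := normC_gt0 r0.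
have ri0 : 0 < r^-1 by rewrite invr_gt0.
rewrite fock_normE; have := Fock_integral_ge0 r f.
case: (Fock_integral r f) => [x||] x0.
- rewrite -EFinM poweR_EFin !lee_fin ler_pdivlMr// [x * _]mulrC.
  have cx0 : 0 <= normC r * x by rewrite mulr_ge0 ?(ltW c0).
  apply/idP/idP => h.
    have := @ge0_ler_powR _ r (ltW r0) _ _ _ _ h; rewrite !nnegrE powR_ge0 => /(_ isT B0).
    by rewrite -powRrM mulVf ?gt_eqF// powRr1.
  have := @ge0_ler_powR _ r^-1 (ltW ri0) _ _ _ _ h; rewrite !nnegrE powR_ge0 => /(_ cx0 isT).
  by rewrite -powRrM divff ?gt_eqF// powRr1.
- by rewrite gt0_muley ?lte_fin// poweRyr ?gt_eqF// !leye_eq.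
- by rewrite leeNy_eq in x0.
Qed.

Lemma fock_norm_lty r f : 0 < r -> (Fock_integral r f < +oo)%E -> (Norm r%:E f < +oo)%E.
Proof.
move=> r0 h; rewrite fock_normE; apply: poweR_lty.
by rewrite lte_mul_pinfty// lee_fin ltW// normC_gt0.
Qed.

Lemma fock_norm_inf f (B : R) :
  (Norm +oo f <= B%:E)%E <-> forall z, fock_weighted alpha f z <= B.
Proof.
split => [h z|h] /=.
  rewrite -lee_fin; apply: le_trans h.
  by apply: ereal_sup_ubound; exists z.
by apply: ge_ereal_sup => _ [z _ <-]; rewrite lee_fin.
Qed.

(** The summand 1 makes the constant positive, as [sup_ball_open] divides by it. *)
Definition evalC (p : \bar R) : R := if p is r%:E then (wlC alpha r / normC r) `^ r^-1 + 1 else 1.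

Lemma evalC_gt0 p : 0 < evalC p.
Proof. by case: p => [r||] //=; rewrite ltr_wpDl// powR_ge0. Qed.

Lemma point_evaluation p f (B : R) : (0 < p)%E -> (forall z, hol_at f z) -> 0 <= B ->
  (Norm p f <= B%:E)%E -> forall z, fock_weighted alpha f z <= evalC p * B.
Proof.
case: p => [r||] //; last first.
  by move=> _ _ B0 /fock_norm_inf h z; rewrite mul1r.
rewrite lte_fin => r0 hf B0; rewrite fock_norm_le// => h z.
have c0 := normC_gt0 r0.
have h1 : ((fock_weighted alpha f z `^ r)%:E <= (wlC alpha r * (B `^ r / normC r))%:E)%E.
  have h0 : (\int[mu2]_(w in disc z) (Fock_density alpha r f w)%:E <= (B `^ r / normC r)%:E)%E.
    apply: le_trans h; apply: ge0_subset_integral => //.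
    - exact: disc_measurable.
    - apply/measurable_EFinP; apply: Fock_density_measurable => y; exact: hol_at_ccont.
    - by move=> w _; rewrite lee_fin Fock_density_ge0.
  have w0 : (0 <= (wlC alpha r)%:E)%E by rewrite lee_fin wlC_ge0.
  apply: (le_trans (weighted_local_Lp alpha0 z r0 hf)).
  by rewrite (EFinM (wlC alpha r)); exact: (lee_wpmul2l w0 h0).
rewrite lee_fin in h1.
have w0 : 0 <= wlC alpha r / normC r by rewrite divr_ge0 ?wlC_ge0 ?ltW.
apply: (@le_trans _ _ ((wlC alpha r / normC r) `^ r^-1 * B)); last first.
  by rewrite ler_wpM2r// lerDl.
apply: (powR_le_cancel r0); rewrite ?fock_weighted_ge0 ?mulr_ge0 ?powR_ge0//.
rewrite powRM ?powR_ge0// -powRrM mulVf ?gt_eqF// powRr1//.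
by move: h1; rewrite mulrCA mulrC.
Qed.

(** For [p < 1] the metric is the [p]-th power of the norm; with [norm_dist], this translates
    neighborhoods into norm estimates for all exponents alike. *)
Lemma dist_norm (p : \bar R) (d : R) : (0 < p)%E -> 0 < d -> exists2 e : R, 0 < e &
  forall f g : fock alpha p, (fock_dist f g < e%:E)%E ->
    (Norm p (fun z => (val f z - val g z)%R) <= d%:E)%E.
Proof.
move=> p0 d0; have [p1|/negbTE p1] := boolP (p < 1)%E; last first.
  by exists d => // f g; rewrite /fock_dist p1 => /ltW.
case: p p0 p1 => [r||]//; rewrite lte_fin => r0 r1.
exists (d `^ r); first exact: powR_gt0.
move=> f g; rewrite /fock_dist r1 /fine.
have := fock_norm_ge0 r%:E (fun z => val f z - val g z).
case: (fock_norm _ _ _) => [x||]; [|by rewrite poweRyr ?gt_eqF//|by []].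
rewrite poweR_EFin !lee_fin lte_fin => x0 /ltW.
exact: (powR_le_cancel r0 x0 (ltW d0)).
Qed.

Lemma norm_dist (p : \bar R) (e : R) : (0 < p)%E -> 0 < e -> exists2 d : R, 0 < d &
  forall f g : fock alpha p, (Norm p (fun z => (val f z - val g z)%R) <= d%:E)%E ->
    (fock_dist f g < e%:E)%E.
Proof.
move=> p0 e0; have [p1|/negbTE p1] := boolP (p < 1)%E; last first.
  exists (e / 2); first by rewrite divr_gt0.
  move=> f g; rewrite /fock_dist p1 => /le_lt_trans; apply.
  by rewrite lte_fin; lra.
case: p p0 p1 => [r||]//; rewrite lte_fin => r0 r1.
exists ((e / 2) `^ r^-1); first by rewrite powR_gt0// divr_gt0.
move=> f g; rewrite /fock_dist r1 /fine.
have := fock_norm_ge0 r%:E (fun z => (val f z - val g z)%R).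
case: (fock_norm _ _ _) => [x||]; [|by []|by []].
rewrite poweR_EFin !lee_fin lte_fin => x0 h.
have := @ge0_ler_powR _ r (ltW r0) _ _ _ _ h; rewrite !nnegrE powR_ge0 => /(_ x0 isT).
rewrite -powRrM mulVf ?gt_eqF// powRr1; last by rewrite divr_ge0// ltW.
by move=> /le_lt_trans; apply; lra.
Qed.

Lemma fock_hol (p : \bar R) (f : fock alpha p) z : hol_at (val f) z.
Proof. by have := set_valP f; case=> /entireP h _; exact: h. Qed.

Lemma subr_hol f g : (forall z, hol_at f z) -> (forall z, hol_at g z) ->
  forall z, hol_at (fun z => f z - g z) z.
Proof. by move=> hf hg z; apply: hol_atD => //; exact: hol_atN. Qed.

Lemma fock_weighted_triangle f g h z :
  fock_weighted alpha (fun z => f z - h z) z <=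
  fock_weighted alpha (fun z => f z - g z) z + fock_weighted alpha (fun z => g z - h z) z.
Proof.
rewrite /fock_weighted -mulrDl ler_wpM2r ?expR_ge0//.
have -> : f z - h z = (f z - g z) + (g z - h z) by rewrite addrA subrK.
exact: le_normcD.
Qed.

(** Open in the metric of every exponent, because point evaluations are uniformly bounded; the
    margin between [e'] and [e] leaves room for a perturbation. These sets separate points and make
    cluster points accessible through values. *)
Definition sup_ball (p : \bar R) (g : fock alpha p) (e : R) : set (fock alpha p) :=
  [set h | exists2 e', e' < e & forall z, fock_weighted alpha (fun z => val h z - val g z) z <= e'].

Lemma open_fockE (p : \bar R) : (open : set_system (fock alpha p)) = @fock_open R alpha p.
Proof. by []. Qed.

Lemma sup_ball_open p g e : (0 < p)%E -> open (@sup_ball p g e).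
Proof.
move=> p0; rewrite open_fockE => h [e' e'e hP].
have C0 := evalC_gt0 p.
have d0 : 0 < (e - e') / 2 / evalC p by rewrite !divr_gt0// subr_gt0.
have [b b0 bP] := dist_norm p0 d0; exists b => // k /bP hk.
exists ((e + e') / 2); first by lra.
move=> z; apply: (le_trans (fock_weighted_triangle _ (val h) _ _)).
have := point_evaluation p0 (subr_hol (fock_hol h) (fock_hol k)) (ltW d0) hk z.
rewrite mulrC divfK ?gt_eqF// => h1.
have -> : fock_weighted alpha (fun z0 => val k z0 - val h z0) z =
  fock_weighted alpha (fun z0 => val h z0 - val k z0) z by rewrite /fock_weighted normcBC.
by have := hP z; lra.
Qed.

Lemma sup_ball_center p g e : 0 < e -> @sup_ball p g e g.
Proof.
move=> e0; exists 0 => // z.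
by rewrite /fock_weighted subrr normc0E mul0r.
Qed.

(** Separation is what turns compactness of the image into [precompact]. *)
Lemma fock_hausdorff p : (0 < p)%E -> hausdorff_space (fock alpha p).
Proof.
move=> p0; rewrite open_hausdorff => g h gh.
have [z gzhz] : exists z, val g z != val h z.
  apply: contrapT => /forallNP hn; move/eqP: gh; apply; apply: val_inj; apply/funext => z.
  by have /negP := hn z; rewrite negbK => /eqP.
pose e := fock_weighted alpha (fun z => val g z - val h z) z.
have e0 : 0 < e by rewrite mulr_gt0 ?expR_gt0// normc_gt0 subr_eq0.
have e20 : 0 < e / 2 by rewrite divr_gt0.
exists (sup_ball g (e / 2), sup_ball h (e / 2)) => /=.
  by rewrite !inE; split; exact: sup_ball_center.
split; [exact: sup_ball_open|exact: sup_ball_open|].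
apply/eqP/seteqP; split => // k [[e1 e1e /(_ z) k1] [e2 e2e /(_ z) k2]].
have := fock_weighted_triangle (val g) (val k) (val h) z.
have -> : fock_weighted alpha (fun z0 => val g z0 - val k z0) z =
  fock_weighted alpha (fun z0 => val k z0 - val g z0) z by rewrite /fock_weighted normcBC.
rewrite -/e; lra.
Qed.

End fock_norms.

Section hausdorff_norm.
Context {R : realType} (mu : {measure set (measurableTypeR R) -> \bar R}).
Hypothesis hmu : (\int[mu]_(t in `]0%R, +oo[%classic) (t^-1)%:E = 1)%E.
Hypothesis mu01 : mu `]0%R, 1%R]%classic = 0%E.
Context (alpha : R).
Hypothesis alpha0 : 0 < alpha.
Implicit Types f u : R[i] -> R[i].
Notation H := (hausdorff_op mu).
Notation Norm := (fock_norm alpha).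
Notation mu2 := ((@lebesgue_measure R) \x (@lebesgue_measure R))%E.
Notation plane := (measurableTypeR R * measurableTypeR R)%type.
Notation cx w := (w.1 +i* w.2).

Lemma gavg_measurable r f : (forall z, ccont_at f z) -> measurable_fun setT (gavg alpha r f).
Proof.
move=> cf.
have := @measurable_fun_fubini_tonelli_F _ _ plane plane R area
  (fun zw => (gkernel (kap alpha r) zw.1 zw.2 * Fock_density alpha r f zw.2)%:E).
apply.
- apply/measurable_EFinP; apply: measurable_funM; first exact: gkernel_measurable.
  exact: (measurableT_comp (Fock_density_measurable alpha r cf) measurable_snd).
- by move=> zw; rewrite lee_fin mulr_ge0// ?gkernel_ge0 ?Fock_density_ge0.
Qed.

Lemma gavg_fin r f z : (forall z, ccont_at f z) -> 0 < r -> (Fock_integral alpha r f < +oo)%E ->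
  (gavg alpha r f z < +oo)%E.
Proof.
move=> cf r0; apply: le_lt_trans; apply: ge0_le_integral_real => //.
- by move=> w _; rewrite mulr_ge0 ?gkernel_ge0 ?Fock_density_ge0.
- by apply: measurable_funM; [exact: gkernel_measurable2|exact: Fock_density_measurable].
- exact: Fock_density_measurable.
- move=> w _; rewrite ler_piMl ?Fock_density_ge0// -expR0 ler_expR mulNr oppr_le0.
  by rewrite mulr_ge0 ?addr_ge0 ?sqr_ge0// ltW// kap_gt0.
Qed.

Definition big_square (a : R) : set plane := `[- a, a]%classic `*` `[- a, a]%classic.

Lemma big_square_measurable a : measurable (big_square a).
Proof. by apply: measurableX; exact: measurable_itv. Qed.

Lemma big_square_measure a : 0 < a -> mu2 (big_square a) = ((2 * a) ^+ 2)%:E.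
Proof.
by move=> a0; have := @square_measure R 0 a a0; rewrite /= !add0r.
Qed.

(** Inside the disc of radius [a], contained in a square of area [(2 a)^2], [H u] is at most [2 d].
    Outside, [hausdorff_weighted] gains [eps a], the [r]-th power of [radial_max] is a Gaussian
    average, and [gkernel_tonelli] integrates it. [K] is chosen before [u], [a] and [d]. *)
Lemma hausdorff_integral_bound r : 0 < r -> exists K : R, 0 < K /\
  forall u (a d : R), (forall z, hol_at u z) -> (Fock_integral alpha r u < +oo)%E ->
    0 < a -> 0 <= d -> (forall z, normc z <= a -> normc (u z) <= d) ->
    (Fock_integral alpha r (H u) <= ((2 * d) `^ r * (2 * a) ^+ 2)%:E +
      ((2 * eps mu alpha a) `^ r * K)%:E * Fock_integral alpha r u)%E.
Proof.
move=> r0; have [K [K0 KP]] := gkernel_tonelli (kap_gt0 alpha0 r0).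
pose A := wlC alpha r * expR (2 * kap alpha r).
have A0 : 0 <= A by rewrite mulr_ge0 ?wlC_ge0 ?expR_ge0.
exists (A * K + 1); split; first by rewrite ltr_wpDl// mulr_ge0// ltW.
move=> u a d hu Iu a0 d0 ud.
have cu z : ccont_at u z by exact: hol_at_ccont.
have cH z : ccont_at (H u) z by apply/hol_at_ccont/hausdorff_hol.
set b := (2 * eps mu alpha a) `^ r.
have b0 : 0 <= b by exact: powR_ge0.
set c := (2 * d) `^ r.
have c0 : 0 <= c by exact: powR_ge0.
have gfin z : gavg alpha r u z \is a fin_num by rewrite ge0_fin_numE ?gavg_ge0// gavg_fin.
have ptw (w : plane) : ((Fock_density alpha r (H u) w)%:E <=
    (c * \1_(big_square a) w)%:E + (b * A)%:E * gavg alpha r u w)%E.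
  rewrite -(fineK (gfin w)) -EFinM -EFinD lee_fin.
  have g0 : 0 <= fine (gavg alpha r u w) by rewrite fine_ge0// gavg_ge0.
  have [wa|wa] := leP (normc (cx w)) a.
    have wQ : w \in big_square a.
      rewrite inE; split; rewrite /= in_itv/= -ler_norml.
      - exact: le_trans (normc_Re (cx w)) wa.
      - exact: le_trans (normc_Im (cx w)) wa.
    rewrite indicE wQ mulr1 (@le_trans _ _ c)//; last by rewrite lerDl mulr_ge0// mulr_ge0.
    apply: ge0_ler_powR; rewrite ?nnegrE ?fock_weighted_ge0 ?mulr_ge0 ?(ltW r0)//.
    rewrite /fock_weighted -[leRHS]mulr1 ler_pM ?normc_ge0 ?expR_ge0//.
      apply: hausdorff_sup => // s /andP[s0 s1]; apply: ud.
      rewrite normcM normc_real ger0_norm// (le_trans _ wa)//.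
      by rewrite ler_piMl ?normc_ge0.
    rewrite -expR0 ler_expR mulNr oppr_le0 mulr_ge0 ?sqr_ge0// divr_ge0// ltW//.
  have dom := radial_dominated_max alpha0 r0 hu (gavg_fin w cu r0 Iu).
  have := hausdorff_weighted hmu mu01 alpha0 cu (radial_max_ge0 _ _ _ _) dom.
  have eps_le : eps mu alpha (normc (cx w)) <= eps mu alpha a.
    by apply: eps_mono => //; exact: ltW.
  move=> h; rewrite -mulrA -(radial_max_powR alpha u w r0) -powRM ?radial_max_ge0//; last first.
    by rewrite mulr_ge0 ?eps_ge0.
  rewrite (@le_trans _ _ ((2 * eps mu alpha a * radial_max alpha r u w) `^ r))//; last first.
    by rewrite lerDr mulr_ge0.
  apply: ge0_ler_powR; rewrite ?nnegrE ?fock_weighted_ge0 ?mulr_ge0 ?(ltW r0) ?eps_ge0 ?radial_max_ge0//.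
  apply: (le_trans h); rewrite mulrA ler_wpM2r ?radial_max_ge0//.
  by rewrite ler_wpM2l.
have mQ := big_square_measurable a.
have mI : measurable_fun [set: plane] (\1_(big_square a) : plane -> R) by exact: ((measurable_indicP R _).1 mQ).
have m1 : measurable_fun setT (fun w : plane => (c * \1_(big_square a) w)%:E).
  apply/measurable_EFinP; apply: measurable_funM; first exact: measurable_cst.
  exact: mI.
have m2 : measurable_fun setT (fun w : plane => (b * A)%:E * gavg alpha r u w)%E.
  by apply: emeasurable_funM => //; exact: gavg_measurable.
have n1 (w : plane) : [set: plane] w -> (0 <= (c * \1_(big_square a) w)%:E)%E.
  by move=> _; rewrite lee_fin mulr_ge0.
have n2 (w : plane) : [set: plane] w -> (0 <= (b * A)%:E * gavg alpha r u w)%E.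
  by move=> _; rewrite mule_ge0 ?gavg_ge0// lee_fin mulr_ge0.
apply: (@le_trans _ _ (\int[mu2]_w ((c * \1_(big_square a) w)%:E + (b * A)%:E * gavg alpha r u w))%E).
  apply: ge0_le_integral => //.
  - by move=> w _; rewrite lee_fin Fock_density_ge0.
  - by apply/measurable_EFinP; exact: Fock_density_measurable.
  - exact: emeasurable_funD.
rewrite (ge0_integralD _ _ n1 m1 n2 m2)//.
apply: leeD.
  rewrite (ge0_integralZ_real _ _ c0 mI)//.
  rewrite integral_indic// setIT.
  by rewrite EFinM -(big_square_measure a0); exact: lexx.
have bA0 : (0 <= (b * A)%:E)%E by rewrite lee_fin mulr_ge0.
rewrite (ge0_integralZl _ _ (gavg_measurable r cu) _ bA0)//; last first.
  by move=> w _; exact: gavg_ge0.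
rewrite /gavg (KP _ (Fock_density_measurable alpha r cu) (Fock_density_ge0 alpha r u)).
rewrite muleA -EFinM lee_wpmul2r ?Fock_integral_ge0//.
by rewrite lee_fin -mulrA ler_wpM2l// lerDl.
Qed.

Lemma hausdorff_norm_small (p : \bar R) (B e : R) : (0 < p)%E -> 0 <= B -> 0 < e ->
  exists a d : R, [/\ 0 < a, 0 < d & forall u, (forall z, hol_at u z) -> (Norm p u <= B%:E)%E ->
    (forall z, normc z <= a -> normc (u z) <= d) -> (Norm p (H u) <= e%:E)%E].
Proof.
move=> p0 B0 e0; case: p p0 => [r||]//; last first.
  move=> _; have [a a0 ae] := @eps_small _ _ hmu mu01 _ alpha0 (e / (2 * (B + 1))) ltac:(by rewrite divr_gt0// mulr_gt0// ltr_wpDl).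
  exists (a + 1), (e / 2); split; [by rewrite ltr_wpDl|by rewrite divr_gt0|].
  move=> u hu /fock_norm_inf uB ud; apply/fock_norm_inf => z.
  have cu y : ccont_at u y by exact: hol_at_ccont.
  have [za|za] := leP (normc z) (a + 1).
    have := hausdorff_sup hmu mu01 (B := e / 2) (z := z) cu.
    have -> : 2 * (e / 2) = e by rewrite mulrC divfK.
    move=> h; rewrite -[leRHS]mulr1 ler_pM ?normc_ge0 ?expR_ge0//.
      apply: h => s /andP[s0 s1]; apply: ud; rewrite normcM normc_real ger0_norm//.
      by rewrite (le_trans _ za)// ler_piMl ?normc_ge0.
    by rewrite -expR0 ler_expR mulNr oppr_le0 mulr_ge0 ?sqr_ge0// divr_ge0// ltW.
  have := hausdorff_weighted hmu mu01 alpha0 cu B0 (radial_dominated_sup alpha0 z uB).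
  move=> /le_trans; apply.
  have h1 : eps mu alpha (normc z) <= e / (2 * (B + 1)).
    by apply: le_trans ae; apply: eps_mono => //; rewrite ltW// (le_lt_trans _ za)// lerDl.
  apply: (@le_trans _ _ (2 * (e / (2 * (B + 1)) * B))).
    by rewrite ler_wpM2l// ler_wpM2r.
  have -> : 2 * (e / (2 * (B + 1)) * B) = e * (B / (B + 1)).
    by field; rewrite gt_eqF// ltr_wpDl.
  by rewrite ler_piMr ?(ltW e0)// ler_pdivrMr ?ltr_wpDl// mul1r lerDl.
rewrite lte_fin => r0; have [K [K0 KP]] := hausdorff_integral_bound r0.
have c0 := normC_gt0 alpha0 r0; set cr := normC alpha r in c0.
(* [eta] is the bound on the integral equivalent to a norm at most [e]. Half of it goes to each
   term: [a] is chosen from the bound [B], then [d] from [a]. *)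
pose eta := e `^ r / cr; have eta0 : 0 < eta by exact: divr_gt0 (powR_gt0 _ e0) c0.
pose b := B `^ r / cr; have b0 : 0 <= b by rewrite divr_ge0 ?powR_ge0 ?ltW.
have Kb : 0 < K * b + 1 by rewrite ltr_wpDl// mulr_ge0// ltW.
pose e1 := (eta / 2 / (K * b + 1)) `^ r^-1 / 2.
have e10 : 0 < e1 by exact: divr_gt0 (powR_gt0 _ (divr_gt0 (divr_gt0 eta0 (ltr0n _ 2)) Kb)) (ltr0n _ 2).
have [a' a'0 a'e] := @eps_small _ _ hmu mu01 _ alpha0 e1 e10.
pose a := a' + 1; have a0 : 0 < a by rewrite ltr_wpDl.
pose d := (eta / 2 / (2 * a) ^+ 2) `^ r^-1 / 2.
have a20 : 0 < (2 * a) ^+ 2 by rewrite exprn_gt0// mulr_gt0.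
have d0 : 0 < d by exact: divr_gt0 (powR_gt0 _ (divr_gt0 (divr_gt0 eta0 (ltr0n _ 2)) a20)) (ltr0n _ 2).
exists a, d; split => // u hu uB ud.
rewrite fock_norm_le ?(ltW e0)// -/cr -/eta.
have uI : (Fock_integral alpha r u <= b%:E)%E by rewrite -fock_norm_le.
apply: (le_trans (KP u a d hu (le_lt_trans uI (ltry _)) a0 (ltW d0) ud)).
have half_pow (x : R) : 0 <= x -> (2 * (x `^ r^-1 / 2)) `^ r = x.
  by move=> x0; rewrite mulrC divfK// -powRrM mulVf ?gt_eqF// powRr1.
have -> : (2 * d) `^ r * (2 * a) ^+ 2 = eta / 2.
  rewrite half_pow; first by rewrite divfK// gt_eqF.
  exact: ltW (divr_gt0 (divr_gt0 eta0 (ltr0n _ 2)) a20).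
have h1 : (2 * eps mu alpha a) `^ r <= eta / 2 / (K * b + 1).
  rewrite -[leRHS]half_pow; last exact: ltW (divr_gt0 (divr_gt0 eta0 (ltr0n _ 2)) Kb).
  apply: ge0_ler_powR; first exact: ltW.
  - by rewrite nnegrE mulr_ge0 ?eps_ge0.
  - by rewrite nnegrE mulr_ge0// (ltW e10).
  - apply: ler_wpM2l => //; apply: le_trans a'e; apply: (eps_mono hmu mu01 alpha0 a'0).
    by rewrite /a lerDl.
have k0 : (0 <= ((2 * eps mu alpha a) `^ r * K)%:E)%E by rewrite lee_fin mulr_ge0 ?powR_ge0 ?ltW.
apply: (le_trans (leeD (lexx _) (lee_wpmul2l k0 uI))).
rewrite -EFinM -EFinD lee_fin [leRHS]splitr lerD2l -mulrA.
apply: (@le_trans _ _ (eta / 2 / (K * b + 1) * (K * b))).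
  by rewrite ler_wpM2r// mulr_ge0// ltW.
rewrite mulrAC ler_pdivrMr//; apply: ler_wpM2l; last by rewrite lerDl.
exact: ltW (divr_gt0 eta0 (ltr0n _ 2)).
Qed.

Lemma hausdorff_fock_space (p : \bar R) f : (0 < p)%E -> fock_space alpha p f ->
  fock_space alpha p (H f).
Proof.
move=> p0 [/entireP hf fp]; split.
  by apply/entireP => z; exact: hausdorff_hol.
have cf y : ccont_at f y by exact: (hol_at_ccont (hf y)).
case: p p0 fp => [r||] p0 fp; last by [].
  have r0 : 0 < r by rewrite lte_fin in p0.
  have fI := fock_norm_fin alpha0 r0 fp.
  have [K [K0 KP]] := hausdorff_integral_bound r0.
  (* The estimate at radius 1 already gives finiteness. *)
  have [M [M0 fM]] := ccont_bounded 1 cf.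
  apply: (fock_norm_lty alpha0 r0); apply: (le_lt_trans (KP f 1 M hf fI ltr01 M0 fM)).
  rewrite lte_add_pinfty ?ltry// lte_mul_pinfty// lee_fin mulr_ge0 ?powR_ge0 ?ltW//.
have [B fB] : exists B : R, (Norm +oo f <= B%:E)%E.
  have := fock_norm_ge0 alpha +oo f; case: (fock_norm _ _ _) fp => [x||]// _ _.
  by exists x.
have {}fB := (fock_norm_inf alpha f B).1 fB.
have B0 : 0 <= B by apply: le_trans (fB 0); exact: fock_weighted_ge0.
apply: (@le_lt_trans _ _ (2 * B)%:E); last exact: ltry.
apply/fock_norm_inf => z.
have := hausdorff_weighted hmu mu01 alpha0 cf B0 (radial_dominated_sup alpha0 z fB).
move=> /le_trans; apply; rewrite ler_wpM2l// ler_piMl//; exact: eps_le1.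
Qed.

End hausdorff_norm.

(** * Compactness *)

Section ultra_limits.
Context {R : realType} (T : Type) (U : set_system T).
Context {UU : UltraFilter U}.

(** By compactness of the interval every bounded function converges along an ultrafilter, which thus
    plays the part of a subsequence, for all points [z] at once. *)
Lemma ultra_bounded_cvg (x : T -> R) (b : R) : (forall g, `|x g| <= b) ->
  exists l, forall e, 0 < e -> U [set g | `|x g - l| < e].
Proof.
move=> xb.
have xU : (x @ U) `[- b, b]%classic.
  rewrite /fmap /=; apply: (filterS _ filterT) => g _ /=.
  by rewrite in_itv/= -ler_norml.
have [l [_ lU]] := segment_compact _ xU.
exists l => e e0.
have [//|nU] := in_ultra_setVsetC [set g | `|x g - l| < e] UU.
have xnU : (x @ U) [set y | ~ `|y - l| < e] by [].
have [y [/= ny]] := lU _ _ xnU (nbhsx_ballx l e e0).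
by rewrite /ball /= distrC.
Qed.

Lemma ultra_bounded_ccvg (c : T -> R[i]) (b : R) : (forall g, normc (c g) <= b) ->
  exists l, forall e, 0 < e -> U [set g | normc (c g - l) < e].
Proof.
move=> cb.
have [l1 l1P] := ultra_bounded_cvg (fun g => le_trans (normc_Re (c g)) (cb g)).
have [l2 l2P] := ultra_bounded_cvg (fun g => le_trans (normc_Im (c g)) (cb g)).
exists (l1 +i* l2) => e e0; have e20 : 0 < e / 2 by rewrite divr_gt0.
apply: filterS2 (l1P _ e20) (l2P _ e20) => g /= h1 h2.
apply: (le_lt_trans (normc_le_ReIm _)); move: h1 h2.
by case: (c g) => u v /=; lra.
Qed.

Lemma ultra_limit_le (c : T -> R[i]) (l : R[i]) (b : R) :
  (forall e, 0 < e -> U [set g | normc (c g - l) < e]) ->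
  (forall g, normc (c g) <= b) -> normc l <= b.
Proof.
move=> cl cb; apply/ler_addgt0Pr => e e0.
have [g /= hg] := filter_ex (cl e e0).
have := le_normcB l (c g); rewrite normcBC; have := cb g; move: hg.
by move: (normc _) (normc _) (normc _) => *; lra.
Qed.

(** The limit [f0] is taken pointwise along [U]. The derivatives converge too, and the Taylor
    inequalities, whose constants do not depend on [g], pass to the limit: [f0] is entire.
    Uniformity on discs comes from a common Lipschitz bound and compactness of a square. *)
Lemma montel (F : T -> R[i] -> R[i]) (B : R -> R) : (forall g z, hol_at (F g) z) ->
  (forall g r z, normc z <= r -> normc (F g z) <= B r) ->
  exists f0, (forall z, hol_at f0 z) /\
    forall r e, 0 < e -> U [set g | forall z, normc z <= r -> normc (F g z - f0 z) <= e].
Proof.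
move=> hF FB.
have /choice[f0 f0P] z := ultra_bounded_ccvg (fun g => FB g (normc z) z (lexx _)).
have FBw g w rho z : normc (z - w) <= rho -> normc (F g z) <= B (normc w + rho).
  move=> zw; apply: FB; have := le_normcD (z - w) w; rewrite subrK; move: zw.
  by move: (normc _) (normc _) (normc _) => *; lra.
have f0B r z : normc z <= r -> normc (f0 z) <= B r.
  by move=> zr; apply: (ultra_limit_le (f0P z)) => g; exact: FB.
have h0 : forall z, hol_at f0 z.
  move=> w; have /choice[D DP] g := hF g w.
  have r1 : (0 : R) < 1 by [].
  have Db g : normc (D g) <= 16 * B (normc w + 4 * 1) / 1.
    by apply: (cderiv_bound (hF g) r1 _ (DP g)) => z zw; exact: FBw.
  have [D0 D0P] := ultra_bounded_ccvg Db.
  exists D0; apply: (@taylor2_has_cderiv _ f0 w D0 (2 * (16 * (16 * B (normc w + 8 * 1) / 1) / 1))).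
  move=> h h1; apply/ler_addgt0Pr => e e0.
  have e30 : 0 < e / 3 by rewrite divr_gt0.
  have [g /= [g1 [g2 g3]]] := filter_ex (filterI (f0P (w + h) _ e30) (filterI (f0P w _ e30) (D0P _ e30))).
  have tay := taylor2 (hF g) r1 (fun z zw => FBw g w (8 * 1) z zw) h1 (DP g).
  rewrite mulrA in tay.
  have -> : f0 (w + h) - f0 w - D0 * h = (F g (w + h) - F g w - D g * h) +
    ((f0 (w + h) - F g (w + h)) + ((F g w - f0 w) + (D g - D0) * h)) by ring.
  apply: (le_trans (le_normcD _ _)); apply: lerD => //.
  have m3 : normc ((D g - D0) * h) <= e / 3.
    by rewrite normcM -[leRHS]mulr1 ler_pM ?normc_ge0// ltW.
  have m2 := le_normcD (F g w - f0 w) ((D g - D0) * h).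
  apply: (le_trans (le_normcD _ _)); move: g1 g2 m3 m2; rewrite normcBC.
  move: (normc _) (normc _) (normc _) (normc _) => a1 a2 a3 a4 *; lra.
exists f0; split => // r e e0.
have cov := (@compact_near_coveringP _ _).1 (@compact_square R r) T U
  (fun g w => normc (F g (w.1 +i* w.2) - f0 (w.1 +i* w.2)) <= e) _.
apply: filterS (cov _ _) => [g gP z zr|w _].
  have := gP (complex.Re z, complex.Im z); case: z zr => a b /= zr; apply.
  have ha := le_trans (normc_Re (a +i* b)) zr; have hb := le_trans (normc_Im (a +i* b)) zr.
  by split; rewrite /= in_itv/= -ler_norml.
set wz := w.1 +i* w.2; pose M := B (normc wz + 4 * 1).
have r1 : (0 : R) < 1 by [].
have M0 : 0 <= M by apply: le_trans (normc_ge0 (f0 wz)) _; apply: f0B; rewrite lerDl.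
have K0 : 0 < 16 * M / 1 + 1 by rewrite ltr_wpDl// divr_ge0// mulr_ge0.
pose d := Num.min 1 (e / 3 / (16 * M / 1 + 1)).
have d0 : 0 < d by rewrite lt_min ltr01 !divr_gt0.
have e30 : 0 < e / 3 by rewrite divr_gt0.
have lip (G : R[i] -> R[i]) v : (forall z, hol_at G z) -> (forall z r, normc z <= r -> normc (G z) <= B r) ->
    normc (v - wz) < d -> normc (G v - G wz) <= e / 3.
  move=> hG GB vd; have vd1 : normc (v - wz) <= 1 by rewrite ltW// (lt_le_trans vd)// ge_min lexx.
  have GM z : normc (z - wz) <= 4 * 1 -> normc (G z) <= M.
    move=> zw; apply: GB; have := le_normcD (z - wz) wz; rewrite subrK; move: zw.
    by move: (normc _) (normc _) (normc _) => *; lra.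
  have vd2 : normc (v - wz) <= e / 3 / (16 * M / 1 + 1).
    by rewrite ltW// (lt_le_trans vd)// ge_min lexx orbT.
  rewrite (le_trans (entire_lip hG r1 GM vd1))//.
  apply: (@le_trans _ _ ((16 * M / 1 + 1) * (e / 3 / (16 * M / 1 + 1)))).
    by rewrite ler_pM ?normc_ge0// ?divr_ge0 ?mulr_ge0// lerDl.
  by rewrite mulrC divfK// gt_eqF.
exists ([set v : R * R | normc ((v.1 +i* v.2) - wz) < d], [set g | normc (F g wz - f0 wz) < e / 3]) => /=.
  by split; [exact: nbhs_pair|exact: f0P].
move=> [v g] /= [vd gw]; set vz := v.1 +i* v.2 in vd *.
have hF3 := lip (F g) vz (hF g) (fun z r => FB g r z) vd.
have hf3 := lip f0 vz h0 (fun z r => f0B r z) vd.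
have -> : F g vz - f0 vz = (F g vz - F g wz) + ((F g wz - f0 wz) - (f0 vz - f0 wz)) by ring.
have t1 := le_normcD (F g vz - F g wz) ((F g wz - f0 wz) - (f0 vz - f0 wz)).
have t2 := le_normcB2 (F g wz - f0 wz) (f0 vz - f0 wz).
move: t1 t2 hF3 hf3 gw.
by move: (normc _) (normc _) (normc _) (normc _) (normc _) => *; lra.
Qed.

End ultra_limits.

Section fock_norm_limits.
Context {R : realType} (alpha : R).
Hypothesis alpha0 : 0 < alpha.
Implicit Types f : R[i] -> R[i].
Notation Norm := (fock_norm alpha).
Notation plane := (measurableTypeR R * measurableTypeR R)%type.
Notation mu2 := ((@lebesgue_measure R) \x (@lebesgue_measure R))%E.

Lemma powR_cvg (u : nat -> R) (y r : R) : 0 < r -> 0 <= y -> (forall n, 0 <= u n) ->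
  u @ \oo --> y -> (fun n => u n `^ r) @ \oo --> y `^ r.
Proof.
move=> r0 y0 u0 uy; have [yE|yN] := eqVneq y 0.
  rewrite {y0}yE in uy *; rewrite powR0 ?gt_eqF//.
  apply/cvgrPdist_le => e e0; have e10 : 0 < e `^ r^-1 by rewrite powR_gt0.
  move/cvgrPdist_le : uy => /(_ _ e10); apply: filterS => n.
  rewrite !sub0r !normrN !ger0_norm ?powR_ge0// => h.
  have := @ge0_ler_powR _ r (ltW r0) _ _ _ _ h; rewrite !nnegrE u0 powR_ge0 => /(_ isT isT).
  by rewrite -powRrM mulVf ?gt_eqF// powRr1// ltW.
have {}y0 : 0 < y by rewrite lt_neqAle eq_sym yN.
have h : expR (r * ln (u n)) @[n --> \oo] --> expR (r * ln y).
  apply: continuous_cvg; first exact: continuous_expR.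
  apply: cvgM; first exact: cvg_cst.
  by apply: continuous_cvg => //; exact: continuous_ln.
have -> : y `^ r = expR (r * ln y) by rewrite /powR (negbTE yN).
apply: cvg_trans h; apply: near_eq_cvg.
near=> n; have un : 0 < u n by near: n; exact: (cvgr_gt y uy 0 y0).
by rewrite /powR gt_eqF.
Unshelve. all: by end_near. Qed.

Lemma fock_weighted_dist f g z :
  `|fock_weighted alpha f z - fock_weighted alpha g z| <= normc (f z - g z).
Proof.
rewrite /fock_weighted -mulrBl normrM (ger0_norm (expR_ge0 _)) -[leRHS]mulr1.
apply: ler_pM; rewrite ?expR_ge0//.
  by rewrite ler_norml lerNl opprB le_normcB normcBC le_normcB.
by rewrite -expR0 ler_expR mulNr oppr_le0 mulr_ge0 ?sqr_ge0// divr_ge0// ltW.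
Qed.

(** Fatou's lemma is about sequences while [U] is a filter, so indices [g n] are selected with |F (g
    n) - f| at most [1 / (n + 1)] on the disc of radius [n]. *)
Lemma fock_norm_limit (T : Type) (U : set_system T) {UU : ProperFilter U}
    (F : T -> R[i] -> R[i]) f (p : \bar R) (B : R) :
  (0 < p)%E -> 0 <= B -> (forall g z, hol_at (F g) z) -> (forall z, hol_at f z) ->
  (forall r e, 0 < e -> U [set g | forall z, normc z <= r -> normc (F g z - f z) <= e]) ->
  (forall g, Norm p (F g) <= B%:E)%E -> (Norm p f <= B%:E)%E.
Proof.
move=> p0 B0 hF hf Ff FB; case: p p0 FB => [r||] p0 FB; last by [].
  have r0 : 0 < r by rewrite lte_fin in p0.
  rewrite fock_norm_le//.
  have /choice[g gP] (n : nat) : exists g, forall z, normc z <= n%:R -> normc (F g z - f z) <= n.+1%:R^-1.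
    have n0 : 0 < (n.+1%:R : R)^-1 by rewrite invr_gt0.
    by have [g gn] := filter_ex (Ff n%:R _ n0); exists g.
  pose D n (w : plane) := (Fock_density alpha r (F (g n)) w)%:E.
  have mD n : measurable_fun setT (D n).
    by apply/measurable_EFinP; apply: Fock_density_measurable => y; exact: hol_at_ccont.
  have D0 n w : [set: plane] w -> (0 <= D n w)%E by rewrite lee_fin Fock_density_ge0.
  have lim (w : plane) : limn_einf (D^~ w) = (Fock_density alpha r f w)%:E.
    apply: (cvg_limn_einf_sup _).1; apply: cvg_EFin; first exact: nearW.
    apply: powR_cvg => //; [exact: fock_weighted_ge0|by move=> n; exact: fock_weighted_ge0|].
    apply/cvgrPdist_le => e e0; rewrite -[e]/(PosNum e0)%:num.
    near=> n; rewrite distrC; apply: (le_trans (fock_weighted_dist _ _ _)).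
    apply: (@le_trans _ _ n.+1%:R^-1).
      by apply: gP; near: n; exact: nbhs_infty_ger.
    by apply: ltW; near: n; exact: near_infty_natSinv_lt.
  have := fatou mu2 measurableT mD D0; under eq_integral do rewrite lim.
  move=> /le_trans; apply.
  rewrite limn_einf_lim; apply: lime_le; first exact: is_cvg_einfs.
  apply: nearW => n; apply: (@le_trans _ _ (\int[mu2]_w D n w)%E).
    by apply: ereal_inf_lbound; exists n => /=.
  by have := FB (g n); rewrite fock_norm_le.
apply/fock_norm_inf => z; apply/ler_addgt0Pr => e e0.
have [g gz] := filter_ex (Ff (normc z) e e0).
have := (fock_norm_inf alpha (F g) B).1 (FB g) z.
have := fock_weighted_dist (F g) f z; have := gz z (lexx _).
by rewrite ler_norml; move: (fock_weighted _ _ _) (fock_weighted _ _ _) (normc _) => a b c *; lra.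
Unshelve. all: by end_near. Qed.

(** For finite exponents this rests on [(a + b)^r <= 2^r max(a, b)^r <= 2^r (a^r + b^r)], valid for
    every [r > 0], at the price of a larger constant. *)
Lemma fock_norm_subr (p : \bar R) (B : R) : (0 < p)%E -> 0 <= B -> exists2 C : R, 0 <= C &
  forall f g, (forall z, hol_at f z) -> (forall z, hol_at g z) ->
    (Norm p f <= B%:E)%E -> (Norm p g <= B%:E)%E -> (Norm p (fun z => f z - g z)%R <= C%:E)%E.
Proof.
move=> p0 B0; case: p p0 => [r||] p0; last by [].
  have r0 : 0 < r by rewrite lte_fin in p0.
  exists ((2 `^ r * (B `^ r + B `^ r)) `^ r^-1); first exact: powR_ge0.
  move=> f g hf hg fB gB.
  have {}fB : (Fock_integral alpha r f <= (B `^ r / normC alpha r)%:E)%E by move: fB; rewrite fock_norm_le.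
  have {}gB : (Fock_integral alpha r g <= (B `^ r / normC alpha r)%:E)%E by move: gB; rewrite fock_norm_le.
  rewrite (fock_norm_le alpha0 _ r0 (powR_ge0 _ _)).
  have cf z : ccont_at f z by exact: hol_at_ccont.
  have cg z : ccont_at g z by exact: hol_at_ccont.
  rewrite -powRrM mulVf ?gt_eqF// powRr1; last by rewrite mulr_ge0 ?addr_ge0 ?powR_ge0.
  have mf := Fock_density_measurable alpha r cf; have mg := Fock_density_measurable alpha r cg.
  apply: (@le_trans _ _ (\int[mu2]_w ((2 `^ r)%:E * ((Fock_density alpha r f w)%:E + (Fock_density alpha r g w)%:E)))%E).
    apply: ge0_le_integral => //.
    - by move=> w _; rewrite lee_fin Fock_density_ge0.
    - apply/measurable_EFinP; apply: Fock_density_measurable => y.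
      exact: hol_at_ccont (subr_hol hf hg y).
    - apply: emeasurable_funM => //; apply: emeasurable_funD; exact/measurable_EFinP.
    move=> w _; rewrite -EFinD -EFinM lee_fin /Fock_density.
    set z := _ +i* _; set a := fock_weighted alpha f z; set b := fock_weighted alpha g z.
    have a0 : 0 <= a by exact: fock_weighted_ge0.
    have b0 : 0 <= b by exact: fock_weighted_ge0.
    have ab : fock_weighted alpha (fun z => f z - g z) z <= 2 * Num.max a b.
      apply: (@le_trans _ _ (a + b)).
        by rewrite /a /b /fock_weighted -mulrDl ler_wpM2r ?expR_ge0// le_normcB2.
      by rewrite mulrDl mul1r lerD// le_max lexx ?orbT.
    have m0 : 0 <= Num.max a b by rewrite le_max a0.
    apply: (@le_trans _ _ ((2 * Num.max a b) `^ r)).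
      by apply: ge0_ler_powR; rewrite ?nnegrE ?fock_weighted_ge0 ?mulr_ge0// ltW.
    rewrite powRM// ler_wpM2l ?powR_ge0//.
    by case: (leP a b) => _; [rewrite lerDr powR_ge0|rewrite lerDl powR_ge0].
  have two0 : (0 <= (2 `^ r)%:E)%E by rewrite lee_fin powR_ge0.
  rewrite ge0_integralZl//; last 2 first.
  - by apply: emeasurable_funD; exact/measurable_EFinP.
  - by move=> w _; rewrite adde_ge0 ?lee_fin ?Fock_density_ge0.
  rewrite ge0_integralD//; last 4 first.
  - by move=> w _; rewrite lee_fin Fock_density_ge0.
  - exact/measurable_EFinP.
  - by move=> w _; rewrite lee_fin Fock_density_ge0.
  - exact/measurable_EFinP.
  have -> : 2 `^ r * (B `^ r + B `^ r) / normC alpha r =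
    2 `^ r * (B `^ r / normC alpha r + B `^ r / normC alpha r) by rewrite -mulrA mulrDl.
  by rewrite (EFinM (2 `^ r)) EFinD; exact: (lee_wpmul2l two0 (leeD fB gB)).
exists (B + B); first by rewrite addr_ge0.
move=> f g hf hg /fock_norm_inf fB /fock_norm_inf gB; apply/fock_norm_inf => z.
apply: le_trans (lerD (fB z) (gB z)).
by rewrite /fock_weighted -mulrDl ler_wpM2r ?expR_ge0// le_normcB2.
Qed.

End fock_norm_limits.

Section hausdorff_compactness.
Context {R : realType} (mu : {measure set (measurableTypeR R) -> \bar R}).
Hypothesis hmu : (\int[mu]_(t in `]0%R, +oo[%classic) (t^-1)%:E = 1)%E.
Hypothesis mu01 : mu `]0%R, 1%R]%classic = 0%E.
Context (alpha : R).
Hypothesis alpha0 : 0 < alpha.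
Notation H := (hausdorff_op mu).
Notation Norm := (fock_norm alpha).

Lemma hausdorff_opB f g z : (forall z, hol_at f z) -> (forall z, hol_at g z) ->
  H (fun z => f z - g z) z = H f z - H g z.
Proof.
move=> hf hg.
have cf y : ccont_at f y by exact: hol_at_ccont.
have cg y : ccont_at g y by exact: hol_at_ccont.
have cN u : ccont_at (fun u => -1 * hG g z u) u.
  by apply: ccont_atM; [exact: ccont_at_cst|exact: hG_ccont].
have bN : bounded01 (fun u => -1 * hG g z u).
  have [B BP] := hG_bounded01 z cg; exists B => s s01.
  by rewrite mulN1r normcN BP.
have E : hG (fun z => f z - g z) z = (fun u => hG f z u + -1 * hG g z u).
  by apply/funext => u; rewrite /hG mulrBl mulN1r.
rewrite !hausdorff_opE// E (cID hmu mu01 (fun u => hG_ccont z u cf) (hG_bounded01 z cf) cN bN).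
by rewrite (cIZ hmu mu01 (-1) (fun u => hG_ccont z u cg) (hG_bounded01 z cg)) mulN1r.
Qed.

(** The image [K] of the unit ball is itself compact: the ball is closed under locally uniform
    limits, and [H] turns such limits in the ball into limits in norm by [hausdorff_norm_small]. *)
Lemma hausdorff_precompact (p : \bar R) : (0 < p)%E ->
  precompact [set g : fock alpha p | exists f : fock alpha p,
    (Norm p (val f) <= 1)%E /\ val g = H (val f)].
Proof.
move=> p0; apply: compact_precompact; first exact: fock_hausdorff.
set K := (X in compact X); rewrite compact_ultra => U UU UK.
have [g1 [f1 [f11 gf1]]] := filter_ex UK.
(* A preimage in the unit ball is chosen for each [g] in [K]; off [K], which is negligible since [K]
   belongs to [U], the fixed [f1] keeps [F] total and its values in the ball. *)
have /choice[F FP] (g : fock alpha p) : exists f : fock alpha p,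
    (Norm p (val f) <= 1)%E /\ (K g -> val g = H (val f)).
  have [[f [f_1 gf]]|nK] := pselect (K g); first by exists f.
  by exists f1.
pose B (r : R) := evalC alpha p * 1 * expR (alpha / 2 * r ^+ 2).
have FB g r z : normc z <= r -> normc (val (F g) z) <= B r.
  move=> zr; have := point_evaluation alpha0 p0 (fock_hol (F g)) ler01 (FP g).1 z.
  rewrite /fock_weighted mulNr expRN -ler_pdivlMr ?invr_gt0 ?expR_gt0// invrK => /le_trans; apply.
  rewrite ler_wpM2l ?mulr1 ?(ltW (evalC_gt0 _ _))// ler_expR ler_wpM2l ?divr_ge0 ?(ltW alpha0)//.
  by rewrite ler_pXn2r// nnegrE ?normc_ge0// (le_trans (normc_ge0 z)).
have [f0 [h0 Ff0]] := montel (F := fun g => val (F g)) (fun g => fock_hol (F g)) FB.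
have f0_1 : (Norm p f0 <= 1%:E)%E.
  by apply: (fock_norm_limit alpha0 p0 ler01 (fun g => fock_hol (F g)) h0 Ff0) => g; exact: (FP g).1.
have f0S : fock_space alpha p f0.
  by split; [apply/entireP|apply: (le_lt_trans f0_1); exact: ltry].
have g0S := hausdorff_fock_space hmu mu01 alpha0 p0 f0S.
pose F0 : fock alpha p := SigSub (mem_set f0S); pose g0 : fock alpha p := SigSub (mem_set g0S).
exists g0; split; first by exists F0.
move=> N; rewrite nbhsE => -[V [oV Vg0] VN]; apply: (filterS VN).
move: oV; rewrite open_fockE => /(_ _ Vg0)[e e0 eV].
have [d d0 dP] := norm_dist alpha p0 e0.
have [C C0 CP] := fock_norm_subr alpha0 p0 ler01.
have [a [b [a0 b0 abP]]] := hausdorff_norm_small hmu mu01 alpha0 p0 C0 d0.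
apply: filterS2 UK (Ff0 a b b0) => g Kg gab; apply: eV; apply: dP.
have -> : (fun z => val g0 z - val g z) = H (fun z => f0 z - val (F g) z).
  apply/funext => z; rewrite hausdorff_opB//; last exact: fock_hol.
  by rewrite ((FP g).2 Kg).
apply: abP.
- exact: subr_hol h0 (fock_hol (F g)).
- exact: CP h0 (fock_hol (F g)) f0_1 (FP g).1.
- by move=> z za; rewrite normcBC; exact: gab.
Qed.

Lemma hausdorff_compact_null (p : \bar R) : (0 < p)%E -> hausdorff_compact mu alpha p p.
Proof.
move=> p0; split; last exact: hausdorff_precompact.
move=> f fS; split; last exact: hausdorff_fock_space.
move=> z; apply: hausdorff_integrable => // y.
by have /entireP hf := fS.1; exact: hol_at_ccont.
Qed.

End hausdorff_compactness.

(** * Coherent states *)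

Section coherent_states.
Context {R : realType} (alpha : R).
Hypothesis alpha0 : 0 < alpha.
Notation Norm := (fock_norm alpha).
Notation plane := (measurableTypeR R * measurableTypeR R)%type.
Notation mu2 := ((@lebesgue_measure R) \x (@lebesgue_measure R))%E.

(** Up to [c], the normalized reproducing kernel at the real point [x]. Its weighted modulus is a
    Gaussian centered at [x], so its norm does not depend on [x]. *)
Definition coherent (c x : R) (z : R[i]) : R[i] :=
  (c * expR (- (alpha / 2) * x ^+ 2))%:C * cexp ((alpha * x)%:C * z).

Lemma coherent_hol c x z : hol_at (coherent c x) z.
Proof. by apply: hol_atM; [exact: hol_at_cst|exact: cexp_lin_hol]. Qed.

Lemma Re_realM (a : R) z : complex.Re (a%:C * z) = a * complex.Re z.
Proof. by case: z => u v /=; rewrite mul0r subr0. Qed.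

Lemma normc_coherent c x z : 0 <= c ->
  normc (coherent c x z) = c * expR (alpha * x * complex.Re z - alpha / 2 * x ^+ 2).
Proof.
move=> c0; rewrite normcM normc_cexp normc_real ger0_norm ?mulr_ge0 ?expR_ge0//.
by rewrite Re_realM -(mulrA c) -expRD mulNr addrC.
Qed.

Lemma coherent_weighted c x z : 0 <= c -> fock_weighted alpha (coherent c x) z =
  c * expR (- (alpha / 2) * ((complex.Re z - x) ^+ 2 + complex.Im z ^+ 2)).
Proof.
move=> c0; rewrite /fock_weighted normc_coherent// -(mulrA c) -expRD normc_sqr.
move: (complex.Re z) (complex.Im z) => a b; congr (_ * expR _).
by field.
Qed.

Lemma coherent_norm (p : \bar R) : (0 < p)%E -> exists2 c : R, 0 < c &
  forall x, (Norm p (coherent c x) <= 1%:E)%E.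
Proof.
move=> p0; case: p p0 => [r||] p0; last by [].
  have r0 : 0 < r by rewrite lte_fin in p0.
  have k0 : 0 < r * (alpha / 2) by rewrite mulr_gt0// divr_gt0.
  have [K [K0 KP]] := gkernel_integral k0.
  have n0 := normC_gt0 alpha0 r0.
  have b0 : 0 < (normC alpha r * K)^-1 by rewrite invr_gt0 mulr_gt0.
  have c0 : 0 < (normC alpha r * K)^-1 `^ r^-1 by exact: powR_gt0.
  exists ((normC alpha r * K)^-1 `^ r^-1) => // x.
  rewrite (fock_norm_le alpha0 _ r0 ler01) powR1.
  have E (w : plane) : Fock_density alpha r (coherent ((normC alpha r * K)^-1 `^ r^-1) x) w =
      (normC alpha r * K)^-1 * gkernel (r * (alpha / 2)) w (x, 0).
    rewrite /Fock_density coherent_weighted ?(ltW c0)// powRM ?expR_ge0 ?(ltW c0)//.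
    rewrite -powRrM mulVf ?gt_eqF// powRr1 ?(ltW b0)//; congr (_ * _).
    rewrite /gkernel /= /powR gt_eqF ?expR_gt0// expRK; congr expR.
    by move: (w.1) (w.2) => a b; field.
  rewrite /Fock_integral; under eq_integral => w _ do rewrite E.
  rewrite (@ge0_integralZ_real _ _ _ mu2 setT measurableT _ (fun w => gkernel (r * (alpha / 2)) w (x, 0)) (ltW b0) (gkernel_measurable1 _ _)); last first.
    by move=> w _; exact: gkernel_ge0.
  by rewrite KP -EFinM lee_fin invfM mulfVK ?gt_eqF// div1r.
exists 1 => // x; apply/fock_norm_inf => z; rewrite coherent_weighted// mul1r -expR0 ler_expR.
by rewrite mulNr oppr_le0 mulr_ge0 ?addr_ge0 ?sqr_ge0// divr_ge0// ltW.
Qed.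

End coherent_states.

Section hausdorff_bounds_of_integrable.
Context {R : realType} (mu : {measure set (measurableTypeR R) -> \bar R}).
Hypothesis hmu : (\int[mu]_(t in `]0%R, +oo[%classic) (t^-1)%:E = 1)%E.
Notation H := (hausdorff_op mu).
Notation D := (`]0%R, +oo[%classic : set (measurableTypeR R)).

Lemma inv_integral_le1 (E : set (measurableTypeR R)) : measurable E -> E `<=` D ->
  (\int[mu]_(t in E) (t^-1)%:E <= 1)%E.
Proof.
move=> mE ED; rewrite -hmu; apply: ge0_subset_integral => //.
- by apply/measurable_EFinP; exact: inv_measurable.
- by move=> t; rewrite /= in_itv/= andbT lee_fin => t0; rewrite invr_ge0 ltW.
Qed.

Lemma null_of_inv_integral (t0 : R) : 0 < t0 ->
  (\int[mu]_(t in `]0%R, t0]) (t^-1)%:E = 0)%E -> mu `]0%R, t0]%classic = 0%E.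
Proof.
move=> t00 I0.
have mE : measurable (`]0%R, t0]%classic : set (measurableTypeR R)) by exact: measurable_itv.
have : ((t0^-1)%:E * mu `]0%R, t0]%classic <= 0)%E.
  rewrite -I0 -(integral_cst mu mE); apply: ge0_le_integral => //.
  - by move=> t _; rewrite lee_fin invr_ge0 ltW.
  - apply/measurable_EFinP; apply: measurable_funS (@inv_measurable R) => //.
    by move=> t; rewrite /= !in_itv/= andbT => /andP[].
  - move=> t; rewrite /= in_itv/= => /andP[t0' tt]; rewrite lee_fin lef_pV2// posrE//.
rewrite pmule_rle0 ?lte_fin ?invr_gt0// => h.
by apply/eqP; rewrite eq_le h measure_ge0.
Qed.

Lemma hausdorff_Re_ge f z (t0 A : R) : cintegrable mu D (hausdorff_integrand f z) -> 0 <= A ->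
  (forall t, 0 < t -> 0 <= complex.Re (hausdorff_integrand f z t)) ->
  (forall t, 0 < t <= t0 -> A * t^-1 <= complex.Re (hausdorff_integrand f z t)) ->
  (A%:E * \int[mu]_(t in `]0%R, t0]) (t^-1)%:E <= (normc (H f z))%:E)%E.
Proof.
move=> [iRe _] A0 f0 fA.
have mE : measurable (`]0%R, t0]%classic : set (measurableTypeR R)) by exact: measurable_itv.
have ED : `]0%R, t0]%classic `<=` D by move=> t; rewrite /= !in_itv/= andbT => /andP[].
have mRe := measurable_int mu iRe.
apply: (@le_trans _ _ (complex.Re (H f z))%:E); last first.
  by rewrite lee_fin (le_trans (ler_norm _))// normc_Re.
rewrite /hausdorff_op /cintegral /= /Rintegral fineK; last exact: integrable_fin_num.
apply: (@le_trans _ _ (\int[mu]_(t in `]0%R, t0]) (complex.Re (hausdorff_integrand f z t))%:E)%E); last first.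
  apply: ge0_subset_integral => //.
  by move=> t; rewrite /= in_itv/= andbT lee_fin; exact: f0.
have minv : measurable_fun (`]0%R, t0]%classic : set (measurableTypeR R)) (fun t : R => t^-1).
  by apply: measurable_funS (@inv_measurable R).
rewrite -(@ge0_integralZ_real _ _ _ mu _ mE _ _ A0 minv); last first.
  by move=> t; rewrite /= in_itv/= => /andP[t1 _]; rewrite invr_ge0 ltW.
apply: ge0_le_integral => //.
- by move=> t; rewrite /= in_itv/= => /andP[t1 _]; rewrite lee_fin mulr_ge0// invr_ge0 ltW.
- by apply/measurable_EFinP; apply: measurable_funM.
exact: measurable_funS mRe.
Qed.

Lemma hausdorff_normc_le f z (t0 A : R) : cintegrable mu D (hausdorff_integrand f z) ->
  0 < t0 -> 0 <= A -> mu `]0%R, t0]%classic = 0%E ->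
  (forall t, t0 < t -> normc (hausdorff_integrand f z t) <= A * t^-1) ->
  normc (H f z) <= A + A.
Proof.
move=> [iRe iIm] t00 A0 mu0 fA.
have mE : measurable (`]0%R, t0]%classic : set (measurableTypeR R)) by exact: measurable_itv.
have DE : D `\` `]0%R, t0]%classic = `]t0, +oo[%classic.
  apply/seteqP; split => t /=; rewrite !in_itv/= !andbT.
  - by move=> [t1 /negP]; rewrite t1/= -ltNge.
  - by move=> t1; split; [rewrite (lt_trans _ t1)|apply/negP; rewrite negb_and -!ltNge t1 orbT].
have mF : measurable (`]t0, +oo[%classic : set (measurableTypeR R)) by exact: measurable_itv.
have FD : `]t0, +oo[%classic `<=` D by rewrite -DE; exact: subDsetl.
have minv : measurable_fun (`]t0, +oo[%classic : set (measurableTypeR R)) (fun t : R => t^-1).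
  by apply: measurable_funS (@inv_measurable R).
have bound (u : R -> R) : mu.-integrable D (fun t => (u t)%:E) -> (forall t, t0 < t -> `|u t| <= A * t^-1) ->
    `|\int[mu]_(t in D) u t| <= A.
  move=> iu uA; have mu' := measurable_int mu iu.
  have mD : measurable D by exact: measurable_itv.
  rewrite -lee_fin /Rintegral -fine_abse; last exact: integrable_fin_num.
  rewrite fineK; last by rewrite abse_fin_num; exact: integrable_fin_num.
  apply: (le_trans (le_abse_integral mu mD mu')).
  rewrite (@negligible_integral _ _ _ mu D `]0%R, t0]%classic)//; last first.
    exact: integrable_abse.
  rewrite DE.
  apply: (@le_trans _ _ (\int[mu]_(t in `]t0, +oo[) (A * t^-1)%:E)%E).
    apply: ge0_le_integral => //.
    - by apply: measurableT_comp => //; exact: measurable_funS mu'.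
    - by apply/measurable_EFinP; apply: measurable_funM.
    - by move=> t; rewrite /= in_itv/= andbT => t1; rewrite lee_fin uA.
  rewrite (@ge0_integralZ_real _ _ _ mu _ mF _ _ A0 minv); last first.
    by move=> t; rewrite /= in_itv/= andbT => t1; rewrite invr_ge0 ltW// (lt_trans t00).
  have A0' : (0 <= A%:E)%E by rewrite lee_fin.
  by have := lee_wpmul2l A0' (inv_integral_le1 mF FD); rewrite mule1.
apply: (le_trans (normc_le_ReIm _)); apply: lerD.
- by apply: bound => // t t1; rewrite (le_trans (normc_Re _))// fA.
- by apply: bound => // t t1; rewrite (le_trans (normc_Im _))// fA.
Qed.

End hausdorff_bounds_of_integrable.

(** * Compactness forces [mu] to vanish on ]0, 1] *)

Section compact_null.
Context {R : realType} (mu : {measure set (measurableTypeR R) -> \bar R}).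
Hypothesis hmu : (\int[mu]_(t in `]0%R, +oo[%classic) (t^-1)%:E = 1)%E.
Context (alpha : R).
Hypothesis alpha0 : 0 < alpha.
Notation H := (hausdorff_op mu).
Notation D := (`]0%R, +oo[%classic : set (measurableTypeR R)).

Lemma cexp_real (a : R) : cexp a%:C = (expR a)%:C.
Proof. by rewrite /cexp /= cos0 sin0 mulr1. Qed.

(** At the real center [x] the integrand is real, and nonnegative for [c >= 0] and [t > 0], so
    restricting the integral to ]0, t0] only decreases it. *)
Lemma coherent_integrandE c x t : hausdorff_integrand (coherent alpha c x) x%:C t =
  (c * expR (alpha * x ^+ 2 * t^-1 - alpha / 2 * x ^+ 2) * t^-1)%:C.
Proof.
rewrite /hausdorff_integrand /coherent -fmorphV/= -!rmorphM cexp_real -!rmorphM.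
congr _%:C; congr (_ * _); rewrite -(mulrA c) -expRD; congr (_ * expR _).
by move: (t^-1) => s; field.
Qed.

Lemma coherent_lower c x t0 J : 0 <= c -> 0 < t0 ->
  cintegrable mu D (hausdorff_integrand (coherent alpha c x) x%:C) ->
  (\int[mu]_(t in `]0%R, t0]) (t^-1)%:E = J%:E)%E ->
  c * expR (alpha * x ^+ 2 * (t0^-1 - 1)) * J <= fock_weighted alpha (H (coherent alpha c x)) x%:C.
Proof.
move=> c0 t00 iH JE.
have A0 : 0 <= c * expR (alpha * x ^+ 2 * t0^-1 - alpha / 2 * x ^+ 2) by rewrite mulr_ge0 ?expR_ge0.
have h0 t : 0 < t -> 0 <= complex.Re (hausdorff_integrand (coherent alpha c x) x%:C t).
  by move=> tt; rewrite coherent_integrandE /= mulr_ge0 ?mulr_ge0 ?expR_ge0// invr_ge0 ltW.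
have := hausdorff_Re_ge iH A0 h0 _.
move=> /(_ t0); rewrite JE -EFinM lee_fin => h.
have {}h : c * expR (alpha * x ^+ 2 * t0^-1 - alpha / 2 * x ^+ 2) * J <= normc (H (coherent alpha c x) x%:C).
  apply: h => t /andP[t1 tt]; rewrite coherent_integrandE /= ler_wpM2r ?invr_ge0 ?(ltW t1)//.
  rewrite ler_wpM2l// ler_expR lerD2r.
  apply: ler_wpM2l; first exact: mulr_ge0 (ltW alpha0) (sqr_ge0 x).
  by rewrite lef_pV2 ?posrE.
have := ler_wpM2r (expR_ge0 (- (alpha / 2) * x ^+ 2)) h.
rewrite /fock_weighted normc_real real_normK ?num_real// => /(le_trans _); apply.
rewrite le_eqVlt; apply/orP; left; apply/eqP.
rewrite [RHS]mulrAC -[in RHS](mulrA c) -expRD; congr (_ * expR _ * _).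
by move: (t0^-1) => s; field.
Qed.

(** Off the null set ]0, t0], [z / t] stays in the disc of radius [|z| / t0], where the quadratic
    term in [x] eventually beats the linear one. *)
Lemma coherent_upper c x t0 z : 0 <= c -> 0 <= x -> 0 < t0 ->
  cintegrable mu D (hausdorff_integrand (coherent alpha c x) z) ->
  mu `]0%R, t0]%classic = 0%E ->
  normc (H (coherent alpha c x) z) <=
    2 * (c * expR (alpha * x * (normc z / t0) - alpha / 2 * x ^+ 2)).
Proof.
move=> c0 x0 t00 iH mu0; rewrite mulrDl mul1r.
apply: (hausdorff_normc_le hmu iH t00 _ mu0); first by rewrite mulr_ge0 ?expR_ge0.
move=> t tt; have t1 : 0 < t by exact: lt_trans tt.
rewrite /hausdorff_integrand normcM normcV normc_real (gtr0_norm t1) ler_wpM2r ?invr_ge0 ?(ltW t1)//.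
rewrite normc_coherent// ler_wpM2l// ler_expR lerD2r ler_wpM2l ?mulr_ge0 ?(ltW alpha0)//.
apply: (le_trans (ler_norm _)); apply: (le_trans (normc_Re _)).
rewrite normcM normcV normc_real (gtr0_norm t1) ler_wpM2l ?normc_ge0//.
by rewrite lef_pV2 ?posrE// ltW.
Qed.

Lemma nat_eventually_ge (x : R) : exists N : nat, forall n, (N <= n)%N -> x <= n%:R.
Proof.
exists (Num.bound `|x|) => n Nn; apply: (le_trans (ler_norm x)); apply: ltW.
by apply: (lt_le_trans (archi_boundP (normr_ge0 x))); rewrite ler_nat.
Qed.

Lemma gauss_eventually_small (c b e : R) : 0 <= c -> 0 <= b -> 0 < e ->
  exists N : nat, forall n : nat, (N <= n)%N ->
    2 * (c * expR (alpha * n%:R * b - alpha / 2 * n%:R ^+ 2)) <= e.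
Proof.
(* With [x >= 1] and [x >= 4 b] the exponent is at most [- alpha x / 4]; then [exp (- y) <= 1 / y],
   and [x >= 8 c / (alpha e)] concludes. *)
move=> c0 b0 e0; have [N NP] := nat_eventually_ge (1 + 4 * b + 8 * c / (alpha * e)).
exists N => n /NP; move: (n%:R : R) => x xP.
have r0 : 0 <= 8 * c / (alpha * e) by rewrite divr_ge0 ?mulr_ge0 ?(ltW alpha0) ?(ltW e0).
have x1 : 1 <= x by lra.
have xb : 4 * b <= x by lra.
have xc : 8 * c / (alpha * e) <= x by lra.
have x0 : 0 < x by lra.
have y0 : 0 < alpha / 4 * x by rewrite mulr_gt0 ?divr_gt0.
have h1 : alpha * x * b - alpha / 2 * x ^+ 2 <= - (alpha / 4 * x).
  have -> : - (alpha / 4 * x) = alpha * x * - 4^-1 by field.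
  have -> : alpha * x * b - alpha / 2 * x ^+ 2 = alpha * x * (b - x / 2) by field.
  by rewrite ler_wpM2l ?mulr_ge0 ?(ltW alpha0) ?(ltW x0)//; lra.
have h2 : expR (- (alpha / 4 * x)) <= (alpha / 4 * x)^-1.
  by rewrite expRN lef_pV2 ?posrE ?expR_gt0// (le_trans _ (expR_ge1Dx _))// lerDr.
have h3 : c * expR (alpha * x * b - alpha / 2 * x ^+ 2) <= c * (alpha / 4 * x)^-1.
  by rewrite ler_wpM2l// (le_trans _ h2)// ler_expR.
have xc' : 8 * c <= x * (alpha * e) by rewrite -ler_pdivrMr// mulr_gt0.
apply: (@le_trans _ _ (2 * (c * (alpha / 4 * x)^-1))); first by rewrite ler_wpM2l.
rewrite mulrA ler_pdivrMr//.
have -> : e * (alpha / 4 * x) = x * (alpha * e) / 4 by field.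
by move: xc'; move: (x * (alpha * e)) => y; lra.
Qed.

Lemma hausdorff_compact_imp_null (p q : \bar R) : (0 < p)%E -> (0 < q)%E ->
  hausdorff_compact mu alpha p q -> mu `]0%R, 1%R]%classic = 0%E.
Proof.
move=> p0 q0 [wd [V KV [cV _]]].
have [c c0 cn] := coherent_norm alpha0 p0.
pose k (n : nat) := coherent alpha c n%:R.
have kS n : fock_space alpha p (k n).
  split; first by apply/entireP => z; exact: coherent_hol.
  by apply: le_lt_trans (cn _) _; exact: ltry.
pose G n : fock alpha q := SigSub (mem_set (wd _ (kS n)).2).
have GV : (G @ \oo) V.
  exists 0%N => // n _; apply: KV; exists (SigSub (mem_set (kS n))); split; first exact: cn.
  by [].
have [g [_ gcl]] := cV _ _ GV.
have iH n z : cintegrable mu D (hausdorff_integrand (k n) z) by exact: (wd _ (kS n)).1.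
(* A cluster point is approached along some indices only, but these can be taken arbitrarily
   large. *)
have clus e N : 0 < e -> exists n, (N <= n)%N /\
    forall z, fock_weighted alpha (fun z => H (k n) z - val g z) z <= e.
  move=> e0; have GN : (G @ \oo) [set h | exists2 n, (N <= n)%N & h = G n].
    by exists N => // n Nn; exists n.
  have [h [[n Nn ->] [e' e'e hP]]] := gcl _ _ GN (open_nbhs_nbhs (conj (sup_ball_open alpha0 q0) (sup_ball_center g e0))).
  by exists n; split => // z; apply: le_trans (ltW e'e); exact: hP.
have [M gM] : exists M, forall z, fock_weighted alpha (val g) z <= M.
  have := set_valP g; move: (fock_hol g); move: (val g) => f hf [_ fq].
  have := fock_norm_ge0 alpha q f; case E : (fock_norm alpha q f) fq => [B||]// _ B0.
  exists (evalC alpha q * B) => z; apply: (point_evaluation alpha0 q0 hf B0).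
  by rewrite E.
have fle n z : fock_weighted alpha (H (k n)) z <=
    fock_weighted alpha (fun z => H (k n) z - val g z) z + fock_weighted alpha (val g) z.
  rewrite /fock_weighted -mulrDl ler_wpM2r ?expR_ge0//.
  by rewrite -{1}(subrK (val g z) (H (k n) z)) le_normcD.
have gle n z : fock_weighted alpha (val g) z <=
    fock_weighted alpha (fun z => H (k n) z - val g z) z + fock_weighted alpha (H (k n)) z.
  rewrite /fock_weighted -mulrDl ler_wpM2r ?expR_ge0//.
  by have := le_normcD (val g z - H (k n) z) (H (k n) z); rewrite subrK normcBC.
have fin_inv t0 : exists J, [/\ 0 <= J & (\int[mu]_(t in `]0%R, t0]) (t^-1)%:E = J%:E)%E].
  have I1 : (\int[mu]_(t in `]0%R, t0]) (t^-1)%:E <= 1)%E.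
    apply: inv_integral_le1 => //.
    by move=> t; rewrite /= !in_itv/= andbT => /andP[].
  have I0 : (0 <= \int[mu]_(t in `]0%R, t0]) (t^-1)%:E)%E.
    apply: integral_ge0 => t; rewrite /= in_itv/= => /andP[t1 _].
    by rewrite lee_fin invr_ge0 ltW.
  by move: I0 I1; case: (integral _ _ _) => // J J0 _; exists J.
have half0 : (0 : R) < 2^-1 by rewrite invr_gt0.
have mu_half : mu `]0%R, 2^-1]%classic = 0%E.
  apply: null_of_inv_integral => //; have [J [J0 JE]] := fin_inv 2^-1.
  rewrite JE; congr _%:E; apply/eqP; rewrite eq_le J0 andbT leNgt; apply/negP => {}J0.
  have a0 : 0 < c * alpha * J by rewrite !mulr_gt0.
  (* Since [exp (alpha n^2) >= alpha n^2 >= alpha n] for [n >= 1], the lower bound yields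
     [c * alpha * J * n <= M + 1], which this choice of [N] contradicts. *)
  have [N NP] := nat_eventually_ge ((M + 2) / (c * alpha * J) + 1).
  have [n [/NP nN nP]] := clus 1 N ltr01.
  have M0 : 0 <= M by apply: le_trans (gM 0); exact: fock_weighted_ge0.
  have Ma : 0 <= (M + 2) / (c * alpha * J) by rewrite divr_ge0 ?(ltW a0)// addr_ge0.
  have n1 : 1 <= n%:R :> R by rewrite (le_trans _ nN)// lerDr.
  have {}nN : M + 2 <= n%:R * (c * alpha * J).
    by rewrite -ler_pdivrMr// (le_trans _ nN)// lerDl.
  have low := coherent_lower (ltW c0) half0 (iH n n%:R%:C) JE.
  have := le_trans low (fle n _); rewrite -/(k n).
  have := nP n%:R%:C; have := gM n%:R%:C.
  move: (fock_weighted _ _ _) (fock_weighted _ _ _) => u v uM v1 luv.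
  have : c * alpha * J * n%:R <= M + 1.
    apply: (@le_trans _ _ (u + v)); last by lra.
    apply: le_trans (_ : c * expR (alpha * n%:R ^+ 2 * (2^-1^-1 - 1)) * J <= _); last by lra.
    rewrite (_ : c * alpha * J * n%:R = c * (alpha * n%:R) * J); last by ring.
    rewrite ler_wpM2r ?(ltW J0)// ler_wpM2l ?(ltW c0)//.
    rewrite invrK (_ : 2 - 1 = 1 :> R) ?mulr1; last by ring.
    apply: (@le_trans _ _ (alpha * n%:R ^+ 2)).
      rewrite ler_wpM2l ?(ltW alpha0)// expr2 ler_peMr//.
    by rewrite (le_trans _ (expR_ge1Dx _))// lerDr.
  by move: nN; rewrite mulrC; move: (_ * n%:R) => y; lra.
have g0 z : fock_weighted alpha (val g) z = 0.
  apply/eqP; rewrite eq_le fock_weighted_ge0 andbT; apply/ler_addgt0Pr => e e0; rewrite add0r.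
  have e20 : 0 < e / 2 by rewrite divr_gt0.
  have b0 : 0 <= normc z / 2^-1 by rewrite divr_ge0 ?normc_ge0.
  have [N NP] := gauss_eventually_small (ltW c0) b0 e20.
  have [n [/NP nN nP]] := clus (e / 2) N e20.
  have up := coherent_upper (ltW c0) (ler0n R n) half0 (iH n z) mu_half.
  have fn : fock_weighted alpha (H (k n)) z <= e / 2.
    apply: le_trans (le_trans up nN); rewrite -[leRHS]mulr1 ler_wpM2l ?normc_ge0//.
    by rewrite -expR0 ler_expR mulNr oppr_le0 mulr_ge0 ?sqr_ge0// divr_ge0// ltW.
  rewrite [leRHS]splitr; apply: (le_trans (gle n z)); exact: lerD.
apply: null_of_inv_integral => //; have [J [J0 JE]] := fin_inv 1.
rewrite JE; congr _%:E; apply/eqP; rewrite eq_le J0 andbT.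
rewrite -(pmulr_rle0 _ c0); apply/ler_addgt0Pr => e e0; rewrite add0r.
have [n [_ nP]] := clus e 0 e0.
(* At [t0 = 1] the exponential is 1 for every [n]: the lower bound [c * J] does not grow, and the
   contribution of [g] has to vanish for the distance alone to bound it. *)
have := coherent_lower (ltW c0) ltr01 (iH n n%:R%:C) JE.
rewrite invr1 subrr mulr0 expR0 mulr1 => /le_trans; apply.
by apply: (le_trans (fle n _)); rewrite g0 addr0.
Qed.

End compact_null.

Theorem theorem6p2 (R : realType) (alpha : R) (halpha : 0 < alpha)
    (mu : {measure set (measurableTypeR R) -> \bar R})
    (hmu : (\int[mu]_(t in `]0%R, +oo[%classic) (t^-1)%:E = 1)%E) :
  [/\ (exists p q : \bar R,
         [/\ (0 < p)%E, (0 < q)%E & hausdorff_compact mu alpha p q]) <->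
        mu `]0%R, 1%R]%classic = 0%E
    & mu `]0%R, 1%R]%classic = 0%E <->
        (forall p : \bar R, (0 < p)%E -> hausdorff_compact mu alpha p p)].
Proof.
have null := hausdorff_compact_imp_null hmu halpha.
have compact_of := fun mu01 => hausdorff_compact_null hmu mu01 halpha.
have one_gt0 : (0 < 1 :> \bar R)%E := lte01.
split; split.
- by move=> [p [q [p0 q0 pq]]]; exact: (null _ _ p0 q0 pq).
- by move=> mu01; exists 1%E, 1%E; split; [exact: one_gt0|exact: one_gt0|exact: compact_of].
- by move=> mu01 p; exact: compact_of.
- by move=> h; exact: (null _ _ one_gt0 one_gt0 (h _ one_gt0)).
Qed.
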